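(* Let $\sigma:\mathbb{R}^d\to\mathbb{R}^{d\times d}$ and $b:\mathbb{R}^d\to\mathbb{R}^d$ be Lipschitz continuous, and for $x\in\mathbb{R}^d$ let $\{X^x_t\}_{t\ge0}$ denote the solution of $$dX_t=\sigma(X_t)\,dB_t+b(X_t)\,dt,\quad t\ge 0,\qquad X_0=x.$$ Let $\mathscr{D}:=\{g\in C^1([0,\infty),\mathbb{R}): g(0)=1\}$. (i) Suppose there is a function $f:[0,\infty)\times\mathbb{R}^d\to\mathbb{R}^d$ such that for every $x\in\mathbb{R}^d$, almost surely, $X^x_t=f(t,x)+X^0_t$ for all $t\ge0$, and suppose that $f(t,x)=g(t)h(x)$ with $g\in C^1([0,\infty),\mathbb{R})$ and $h:\mathbb{R}^d\to\mathbb{R}^d$. Then there is some $\tilde g\in\mathscr{D}$ such that $f(t,x)=\tilde g(t)x$ for all $(t,x)\in[0,\infty)\times\mathbb{R}^d$. (ii) Let $g\in\mathscr{D}$. Then the following are equivalent: (a) for each $x\in\mathbb{R}^d$, almost surely, $X^x_t=g(t)x+X^0_t$ for all $t\ge0$; (b) $\sigma$ is a constant $d\times d$ matrix and there exist $\alpha\in\mathbb{R}^d$ and $\beta\in\mathbb{R}$ such that $b(x)=\alpha+\beta x$ for all $x\in\mathbb{R}^d$ and $g(t)=e^{\beta t}$ for all $t\ge0$. In this case, the solution has the form $$X^x_t=\begin{cases} e^{\beta t}x+\sigma\int_0^t e^{\beta(t-s)}\,dB_s+\dfrac{e^{\beta t}-1}{\beta}\,\alpha, & \text{if }\beta\neq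 0,\\[2mm] x+t\alpha+\sigma B_t, & \text{if }\beta=0.\end{cases}$$
   Context: $(\Omega,\mathcal{F},(\mathcal{F}_t),P)$ is a filtered complete probability space satisfying the usual conditions, and $\{B_t\}$ is a standard $d$-dimensional $(\mathcal{F}_t)$ Brownian motion ($B_0=0$). Solutions are the (pathwise unique) strong solutions with continuous paths, which exist because $\sigma$ and $b$ are Lipschitz. *)

(* Defs.v *)
From HB Require Import structures.
From mathcomp Require Export all_boot all_order all_algebra.
From mathcomp Require Export all_classical all_reals all_analysis.

Set Implicit Arguments.
Unset Strict Implicit.
Unset Printing Implicit Defensive.

Export Order.TTheory GRing.Theory Num.Theory.
Export numFieldNormedType.Exports.

Local Open Scope classical_set_scope.
Local Open Scope ring_scope.

(* Time is [0, +oo[: processes, filtrations and functions of time are indexed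
   by R, and nothing is required of (or claimed about) negative times.
   R^n is 'cV[R]_n; the library norm on matrices is the max norm, which is
   equivalent to the Euclidean one. *)

(* g is C^1 on [0, +oo[, with a one-sided derivative at 0. *)
Definition C1_nonneg (R : realType) (g : R -> R) : Prop :=
  exists g' : R -> R,
    {within `[0, +oo[, continuous g'} /\
    forall t : R, 0 <= t ->
      (fun s => (g s - g t) / (s - t)) @ within `[0, +oo[ (t^') --> g' t.

Definition D_class (R : realType) : set (R -> R) :=
  [set g | C1_nonneg g /\ g 0 = 1].

Section StochasticCalculus.
Context (R : realType) (disp : measure_display) (Omega : measurableType disp).
Variable P : probability Omega R.

(* f is measurable from the sigma-algebra G to the Borel sets of T. *)
Definition measurable_wrt (T : topologicalType) (G : set (set Omega))
    (f : Omega -> T) : Prop :=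
  forall A : set T, <<s (@open T) >> A -> G (f @^-1` A).

Definition filtration (F : R -> set (set Omega)) : Prop :=
  [/\ forall t, 0 <= t -> sigma_algebra setT (F t),
      forall t, 0 <= t -> F t `<=` measurable
    & forall s t, 0 <= s -> s <= t -> F s `<=` F t].

Definition usual_conditions (F : R -> set (set Omega)) : Prop :=
  [/\ measure_is_complete P,
      P.-negligible `<=` F 0
    & forall t, 0 <= t -> \bigcap_(s in `]t, +oo[) F s `<=` F t].

Definition adapted (F : R -> set (set Omega)) (T : topologicalType)
    (X : R -> Omega -> T) : Prop :=
  forall t, 0 <= t -> measurable_wrt (F t) (X t).

Definition continuous_paths (T : topologicalType) (X : R -> Omega -> T) : Prop :=
  {ae P, forall w, {within `[0, +oo[, continuous (fun t => X t w)}}.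

Record brownian_motion (F : R -> set (set Omega)) (n : nat)
    (B : R -> Omega -> 'cV[R]_n) : Prop := {
  bm_adapted : adapted F B ;
  bm_start : {ae P, forall w, B 0 w = 0} ;
  bm_continuous : continuous_paths B ;
  bm_independent : forall s t, 0 <= s -> s < t ->
    forall (E : set Omega) (A : set 'cV[R]_n),
      F s E -> <<s (@open 'cV[R]_n) >> A ->
      P (E `&` [set w | A (B t w - B s w)]) =
        (P E * P [set w | A (B t w - B s w)%R])%E ;
  (* B_t - B_s has law N(0, (t - s) I_n), the product of n copies of
     N(0, t - s); the second argument of normal_prob is the standard
     deviation. *)
  bm_normal : forall s t, 0 <= s -> s < t ->
    forall A : 'I_n -> set R, (forall i, measurable (A i)) ->
      P [set w | forall i, A i ((B t w - B s w) i ord0)] =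
        (\prod_(i < n) fine (normal_prob 0 (Num.sqrt (t - s)) (A i)))%:E }.

(* Bounded simple integrands on [0, t], with values in the n x n matrices:
   sum_(i < k) xi_i 1_]t_i, t_(i+1)] with 0 = t_0 <= ... <= t_k = t and xi_i
   bounded and F_(t_i)-measurable. *)
Record simple_process (F : R -> set (set Omega)) (n : nat) (t : R) := {
  sp_size : nat ;
  sp_time : nat -> R ;
  sp_coef : nat -> Omega -> 'M[R]_n ;
  sp_time_first : sp_time 0 = 0 ;
  sp_time_last : sp_time sp_size = t ;
  sp_time_mono : forall i, (i < sp_size)%N -> sp_time i <= sp_time i.+1 ;
  sp_coef_measurable : forall i, (i < sp_size)%N ->
    measurable_wrt (F (sp_time i)) (sp_coef i) ;
  sp_coef_bounded : exists C : R, forall i w, (i < sp_size)%N ->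
    `|sp_coef i w| <= C }.

Definition sp_eval F n t (H : simple_process F n t) (s : R) (w : Omega)
    : 'M[R]_n :=
  \sum_(i < sp_size H)
    (\1_(`]sp_time H i, sp_time H i.+1]%classic) s : R) *: sp_coef H i w.

Definition sp_integral F n t (B : R -> Omega -> 'cV[R]_n)
    (H : simple_process F n t) (w : Omega) : 'cV[R]_n :=
  \sum_(i < sp_size H)
    sp_coef H i w *m (B (sp_time H i.+1) w - B (sp_time H i) w).

Definition cvg_to_0_in_probability (Z : nat -> Omega -> \bar R) : Prop :=
  forall eps : R, 0 < eps ->
    P [set w | (eps%:E <= Z k w)%E] @[k --> \oo] --> 0%E.

(* Y is (a version of) the Ito integral int_0^t H_s dB_s: there are simple
   processes H^k with int_0^t |H^k_s - H_s|^2 ds -> 0 in probability and whose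
   elementary integrals converge to Y in probability. Such H^k exist whenever H
   is adapted with continuous paths, and Y is then unique up to a null set. *)
Definition ito_integral F n (B : R -> Omega -> 'cV[R]_n) (t : R)
    (H : R -> Omega -> 'M[R]_n) (Y : Omega -> 'cV[R]_n) : Prop :=
  measurable_wrt (F t) Y /\
  exists Hk : nat -> simple_process F n t,
    cvg_to_0_in_probability (fun k w =>
      (\int[lebesgue_measure]_(s in `[0%R, t])
         ((`|sp_eval (Hk k) s w - H s w| ^+ 2)%R)%:E)%E) /\
    cvg_to_0_in_probability (fun k w =>
      (`|sp_integral B (Hk k) w - Y w|)%:E).

Definition sde_solution F n (B : R -> Omega -> 'cV[R]_n)
    (sigma : 'cV[R]_n -> 'M[R]_n) (b : 'cV[R]_n -> 'cV[R]_n) (x : 'cV[R]_n)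
    (X : R -> Omega -> 'cV[R]_n) : Prop :=
  [/\ adapted F X,
      continuous_paths X,
      {ae P, forall w, X 0 w = x}
    & exists M : R -> Omega -> 'cV[R]_n,
        [/\ continuous_paths M,
            forall t, 0 <= t ->
              ito_integral F B t (fun s w => sigma (X s w)) (M t)
          & {ae P, forall w, forall t, 0 <= t ->
              X t w = x + M t w
                + \col_i \int[lebesgue_measure]_(s in `[0%R, t])
                           b (X s w) i ord0}]].

End StochasticCalculus.

(* Main.v *)
Require Import Defs.
From mathcomp Require Import measurable_realfun ring lra.
Set Implicit Arguments.
Unset Strict Implicit.
Unset Printing Implicit Defensive.
Local Open Scope classical_set_scope.
Local Open Scope ring_scope.

(* Let X^x solve the equation with initial value x.

   (a) => (b).  By (a) the difference of the stochastic integrals of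
   sigma(X^x) and sigma(X^0) equals
   (g(t) - 1) x - int_0^t (b(X^x_s) - b(X^0_s)) ds, which is O(t) as t -> 0.
   On the other hand it is (sigma(x) - sigma(0)) B_t + o(sqrt t) in
   probability, because the integrands are continuous at time 0.  As
   B_t / sqrt t is a standard normal vector, sigma(x) = sigma(0).  The
   martingale parts then cancel, and dividing the drift identity by t gives
   b(x) = b(0) + g'(0) x.

   (b) => (a) and the formulas.  The Ito integral of a constant matrix S is
   S B_t, so each path solves a linear Volterra equation, whose solution
   features J_t = B_t + beta int_0^t e^(beta (t - s)) B_s ds.  Summation by
   parts shows that J_t is the Ito integral of e^(beta (t - s)).

   Both parts rest on one estimate (ito_distance_le): if Y is the Ito integral
   of H over [0, t], then P(|Y - S B_t| >= eps) is at most
   P(int_0^t |H - S|^2 >= delta / 4) plus a multiple of delta / eps^2. *)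

(** * Independence and Gaussian moments *)

(** As a limit in probability, [ito_integral] supplies no second moments. A simple integrand is
    therefore stopped at energy delta before Chebyshev's inequality is applied, which produces the
    term in delta / eps^2. With eps proportional to sqrt t and delta proportional to t this term no
    longer depends on t, and the ratio delta / t is free to be small: this is how o(sqrt t) is
    reached. If sigma(x) - sigma(0) = D has a nonzero entry D i j, the contradiction is
    quantitative. The event |D B_t| >= |D i j| sqrt t has probability at least a constant c > 0
    independent of t, yet for suitable small t it is covered by three events of probability at most
    c / 4. The exponential form of g comes last: once sigma is constant and b is affine with slope
    beta = g'(0), the explicit solutions give a second shift formula, with factor e^(beta t), and
    the two formulas are compared at one nonzero x. Part (i) is the value at t = 0: x = g(0) h(x),
    so g(0) is nonzero because d > 0, and g / g(0) is the required function. *)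

Section independence.
Context (R : realType) (disp : measure_display) (Omega : measurableType disp).
Context d1 d2 (T1 : measurableType d1) (T2 : measurableType d2).
Variable P : probability Omega R.

Definition indep_fun (Z : Omega -> T1) (U : Omega -> T2) : Prop :=
  forall A C, measurable A -> measurable C ->
    P (Z @^-1` A `&` U @^-1` C) = (P (Z @^-1` A) * P (U @^-1` C))%E.

(** Independence makes the law of the pair agree with the product of the two laws on rectangles,
    hence everywhere; Tonelli's theorem does the rest. *)
Lemma indep_integral_ge0 (Z : {mfun Omega >-> T1}) (U : {mfun Omega >-> T2})
    (f : T1 * T2 -> \bar R) : indep_fun Z U ->
  measurable_fun setT f -> (forall x, 0 <= f x)%E ->
  (\int[P]_w f (Z w, U w) = \int[P]_w \int[P]_v f (Z w, U v))%E.
Proof.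
move=> ZU mf f0.
have mZU : measurable_fun setT (fun w => (Z w, U w)).
  exact: measurable_fun_pair.
pose ZUm : {mfun Omega >-> (T1 * T2)%type} := mfun_Sub (mem_set mZU).
have E X : measurable X ->
    (distribution P Z \x distribution P U)%E X = distribution P ZUm X.
  apply: product_measure_unique => A C mA mC.
  by rewrite /distribution /pushforward /= -ZU.
transitivity (\int[distribution P ZUm]_z f z)%E.
  by rewrite ge0_integral_distribution.
transitivity (\int[distribution P Z \x distribution P U]_z f z)%E.
  by apply: eq_measure_integral => A mA _; exact/esym/E.
rewrite fubini_tonelli1//= ge0_integral_distribution//=; first last.
- by move=> x; apply: integral_ge0.
- exact: measurable_fun_fubini_tonelli_F.
apply: eq_integral => w _ /=; rewrite /fubini_F ge0_integral_distribution//.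
by apply: measurableT_comp => //.
Qed.

End independence.

Section independence_real.
Context (R : realType) (disp : measure_display) (Omega : measurableType disp).
Variable P : probability Omega R.

Lemma indep_integralM_ge0 (Z U : {mfun Omega >-> R}) (f g : R -> R) :
  indep_fun P Z U -> measurable_fun setT f -> measurable_fun setT g ->
  (forall x, 0 <= f x) -> (forall x, 0 <= g x) ->
  (\int[P]_w (f (Z w) * g (U w))%:E =
   (\int[P]_w (f (Z w))%:E) * \int[P]_w (g (U w))%:E)%E.
Proof.
move=> ZU mf mg f0 g0.
pose F (x : R * R) := (f x.1 * g x.2)%:E.
have mF : measurable_fun setT F.
  apply/measurable_EFinP; apply: measurable_funM.
    exact: (measurableT_comp mf).
  exact: (measurableT_comp mg).
rewrite (indep_integral_ge0 (f := F))//; last first.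
  by move=> x; rewrite lee_fin mulr_ge0.
rewrite /F/=.
under eq_integral => w _.
  under eq_integral do rewrite EFinM.
  rewrite ge0_integralZl//=; last 3 first.
  - by apply/measurable_EFinP; exact: measurableT_comp.
  - by move=> ? _; rewrite lee_fin.
  - by rewrite lee_fin.
  over.
rewrite ge0_integralZr//.
- by apply/measurable_EFinP; exact: measurableT_comp.
- by move=> ? _; rewrite lee_fin.
- by apply: integral_ge0 => ? _; rewrite lee_fin.
Qed.

(** Splitting both factors into positive and negative parts leaves four nonnegative products, each
    of which factorizes by [indep_integralM_ge0]; they cancel in pairs. The last hypothesis is E U =
    0, written without a difference of extended reals. *)
Lemma indep_integralM_eq0 (Z U : {mfun Omega >-> R}) :
  indep_fun P Z U -> P.-integrable setT (EFin \o Z) ->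
  P.-integrable setT (EFin \o U) ->
  (\int[P]_w (Num.max (U w) 0)%:E = \int[P]_w (Num.max (- U w) 0)%:E)%E ->
  (\int[P]_w (Z w * U w)%:E = 0)%E.
Proof.
move=> ZU iZ iU symU.
have mp : measurable_fun setT (fun x : R => Num.max x 0).
  by apply: measurable_maxr.
have mn : measurable_fun setT (fun x : R => Num.max (- x) 0).
  by apply: measurable_maxr => //.
have ge0p (x : R) : (0 <= Num.max x 0) by rewrite le_max lexx orbT.
have E x y : (x * y = (Num.max x 0 * Num.max y 0 + Num.max (- x) 0 * Num.max (-
  y) 0)
   - (Num.max x 0 * Num.max (- y) 0 + Num.max (- x) 0 * Num.max y 0) :> R).
  have D (u : R) : u = (Num.max u 0 - Num.max (- u) 0).
    rewrite /Num.max; case: ifP => h1; case: ifP => h2; move: h1 h2; lra.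
  rewrite {1}(D x) {1}(D y); ring.
(* The product is integrable by independence alone: its integral is a product of two finite
   integrals. *)
have iM (f g : R -> R) : measurable_fun setT f -> measurable_fun setT g ->
    (forall x, 0 <= f x <= `|x|) -> (forall x, 0 <= g x <= `|x|) ->
    P.-integrable setT (fun w => (f (Z w) * g (U w))%:E).
  move=> mf mg f0 g0; apply/integrableP; split.
    by apply/measurable_EFinP; apply: measurable_funM; apply: measurableT_comp.
  under eq_integral => w _.
    rewrite gee0_abs; last first.
      by rewrite lee_fin mulr_ge0//; [case/andP: (f0 (Z w))|case/andP: (g0 (U
        w))].
    over.
  rewrite indep_integralM_ge0//; last 2 first.
  - by move=> x; case/andP: (f0 x).
  - by move=> x; case/andP: (g0 x).
  have bnd (V : {mfun Omega >-> R}) (h : R -> R) : measurable_fun setT h ->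
      P.-integrable setT (EFin \o V) ->
      (forall x, 0 <= h x <= `|x|) -> (\int[P]_w (h (V w))%:E < +oo)%E.
    move=> mh /integrableP[_ fin] h0; apply: le_lt_trans fin.
    apply: ge0_le_integral => //.
    - by move=> w _; rewrite lee_fin; case/andP: (h0 (V w)).
    - by apply/measurable_EFinP; exact: measurableT_comp.
    - by apply: measurableT_comp => //; apply/measurable_EFinP.
    - by move=> w _; rewrite /= lee_fin; case/andP: (h0 (V w)).
  rewrite lte_mul_pinfty//.
  - by apply: integral_ge0 => w _; rewrite lee_fin; case/andP: (f0 (Z w)).
  - rewrite ge0_fin_numE; last first.
      by apply: integral_ge0 => w _; rewrite lee_fin; case/andP: (f0 (Z w)).
    exact: bnd.
  - exact: bnd.
have bp (x : R) : (0 <= Num.max x 0 <= `|x|).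
  by rewrite ge0p/= ge_max ler_norm normr_ge0.
have bn (x : R) : (0 <= Num.max (- x) 0 <= `|x|).
  by rewrite ge0p/= ge_max ler_normr lexx orbT normr_ge0.
under eq_integral do rewrite E EFinB.
rewrite integralB//; last 2 first.
- exact: (integrableD measurableT (iM _ _ mp mp bp bp) (iM _ _ mn mn bn bn)).
- exact: (integrableD measurableT (iM _ _ mp mn bp bn) (iM _ _ mn mp bn bp)).
under eq_integral do rewrite EFinD.
rewrite (integralD measurableT (iM _ _ mp mp bp bp) (iM _ _ mn mn bn bn)).
under [X in (_ - X)%E]eq_integral do rewrite EFinD.
rewrite (integralD measurableT (iM _ _ mp mn bp bn) (iM _ _ mn mp bn bp)).
have fin (f g : R -> R) : measurable_fun setT f -> measurable_fun setT g ->
    (forall x, 0 <= f x <= `|x|) -> (forall x, 0 <= g x <= `|x|) ->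
    (\int[P]_w (f (Z w) * g (U w))%:E)%E \is a fin_num.
  by move=> mf mg f0 g0; apply: integrable_fin_num => //; exact: iM.
have := fin _ _ mp mp bp bp; have := fin _ _ mn mn bn bn.
rewrite !(indep_integralM_ge0 ZU mp mp)// !(indep_integralM_ge0 ZU mp mn)//.
rewrite !(indep_integralM_ge0 ZU mn mp)// !(indep_integralM_ge0 ZU mn mn)//
  symU.
by move=> f1 f2; apply: subee; rewrite fin_numD f1 f2.
Qed.

End independence_real.

(** * Integration against a measure with a density *)

Section density.
Context d (T : measurableType d) (R : realType).
Variables (mu nu : {measure set T -> \bar R}) (p : T -> R).
Hypotheses (mp : measurable_fun setT p) (p0 : forall x, 0 <= p x).
Hypothesis nuE : forall A, measurable A ->
  nu A = (\int[mu]_(x in A) (p x)%:E)%E.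

Import HBNNSimple.

(** Both sides are monotone limits along simple functions increasing to [f]; for a simple function
    linearity reduces the claim to indicators, where it is [nuE]. *)
Lemma ge0_integral_density (f : T -> \bar R) :
  measurable_fun setT f -> (forall x, 0 <= f x)%E ->
  (\int[nu]_x f x = \int[mu]_x (f x * (p x)%:E))%E.
Proof.
move=> mf f0.
pose f_ := nnsfun_approx measurableT mf.
have mpE : measurable_fun setT (fun x => (p x)%:E) by apply/measurable_EFinP.
transitivity (limn (fun n => \int[nu]_x (f_ n x)%:E)%E).
  rewrite -monotone_convergence//=.
  - apply: eq_integral => ? /[!inE] xD; apply/esym/cvg_lim => //=.
    by apply: cvg_nnsfun_approx => // *; exact: f0.
  - by move=> n; apply/measurable_EFinP.
  - by move=> n ? _; rewrite lee_fin.
  - by move=> ? _ ? ? mn; rewrite lee_fin; exact/lefP/nd_nnsfun_approx.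
rewrite [RHS](_ : _ = limn (fun n =>
    \int[mu]_x ((f_ n x)%:E * (p x)%:E))%E); last first.
  rewrite -monotone_convergence//=.
  - apply: eq_integral => x _; apply/esym/cvg_lim => //.
    by apply: cvgeZr => //; apply: cvg_nnsfun_approx => // *; exact: f0.
  - by move=> n; apply: emeasurable_funM => //; apply/measurable_EFinP.
  - by move=> n ? _; rewrite mule_ge0// lee_fin.
  - move=> x _ a b ab; rewrite lee_wpmul2r ?lee_fin//.
    exact/lefP/nd_nnsfun_approx.
apply: congr_lim; apply/funext => n /=.
move: (f_ n) => g {f_}.
under [LHS]eq_integral do rewrite fimfunE -fsumEFin//.
rewrite [LHS]ge0_integral_fsum//; last 2 first.
  - by move=> r; exact/measurable_EFinP/measurableT_comp.
  - by move=> m x _; rewrite EFinM nnfun_muleindic_ge0.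
under [RHS]eq_integral.
  move=> x xD; rewrite fimfunE -fsumEFin// ge0_mule_fsuml; last first.
    by move=> r; rewrite EFinM nnfun_muleindic_ge0.
  over.
rewrite [RHS]ge0_integral_fsum//; last 2 first.
  - move=> r; apply: emeasurable_funM => //.
    by apply/measurable_EFinP; apply/measurableT_comp => //.
  - move=> m x _; rewrite EFinM mule_ge0//; last by rewrite lee_fin.
    exact: nnfun_muleindic_ge0.
apply: eq_fsbigr => r _.
under [RHS]eq_integral do rewrite EFinM -muleA.
have [r0|r0] := leP 0 r; last first.
  rewrite preimage_nnfun0//.
  under eq_integral do rewrite indic0 mulr0.
  under [RHS]eq_integral do rewrite indic0 mul0e mule0.
  by rewrite !integral0.
rewrite [RHS]ge0_integralZl//; last 2 first.
  - apply: emeasurable_funM => //; apply/measurable_EFinP;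
      exact: measurable_indic.
  - by move=> x _; rewrite mule_ge0// lee_fin.
under [LHS]eq_integral do rewrite EFinM.
rewrite ge0_integralZl//; last first.
  - by apply/measurable_EFinP; exact: measurable_indic.
congr (_ * _)%E.
rewrite integral_indic//= setIT nuE// [LHS]integral_mkcond.
apply: eq_integral => x _; rewrite patchE indicE.
by case: ifPn; rewrite ?mul1e ?mul0e.
Qed.

End density.

(** * Moments and masses of centred normal laws *)

Section normal_moments.
Variable R : realType.
Local Notation mu := (@lebesgue_measure R).
Implicit Types (s : R) (G : R -> R).

Lemma ge0_integral_normal_prob s (f : R -> \bar R) :
  measurable_fun setT f -> (forall x, 0 <= f x)%E ->
  (\int[normal_prob 0 s]_x f x = \int[mu]_x (f x * (normal_pdf 0 s x)%:E))%E.
Proof.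
apply: (@ge0_integral_density _ _ _ lebesgue_measure (normal_prob 0 s)) => //;
  first exact: measurable_normal_pdf.
by move=> x; exact: normal_pdf_ge0.
Qed.

(** The change of variable is made on half-lines: the line is cut at 0 and the two halves are
    exchanged. *)
Lemma ge0_integral_opp G : continuous G -> (forall x, 0 <= G x) ->
  (\int[mu]_x (G x)%:E = \int[mu]_x (G (- x))%:E)%E.
Proof.
move=> cG G0.
have cGN : continuous (fun x => G (- x)).
  by move=> x; apply: continuous_comp; [exact: opp_continuous|exact: cG].
have split_ (H : R -> R) : continuous H -> (forall x, 0 <= H x) ->
    (\int[mu]_x (H x)%:E = \int[mu]_(x in `]-oo, 0%R]) (H x)%:E +
                           \int[mu]_(x in `[0%R, +oo[) (H x)%:E)%E.
  move=> cH H0; have mH : measurable_fun [set: R] H by exact: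
    continuous_measurable_fun.
  rewrite -(@integral_itv_bndo_bndc _ -oo%O 0); last first.
    by apply/measurable_EFinP/measurable_funTS.
  rewrite -(setUv `]-oo, (0:R)[%classic) ge0_integral_setU//=; last 4 first.
  - exact: measurableC.
  - by apply/measurable_EFinP/measurable_funTS.
  - by move=> x _; rewrite lee_fin.
  - exact/disj_setPCl.
  by rewrite setCitvl.
rewrite split_// (split_ (fun x => G (- x)))//.
rewrite addeC; congr (_ + _)%E.
  rewrite -[in RHS]oppr0 ge0_integration_by_substitutionNy//.
  - by apply: eq_integral => x _ /=; rewrite opprK.
  - exact: continuous_subspaceT.
rewrite -[in LHS]oppr0 ge0_integration_by_substitutionNy//.
exact: continuous_subspaceT.
Qed.

(** The density is even. This is the centring of Brownian increments, in the form that
    [indep_integralM_eq0] takes. *)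
Lemma normal_prob_sym s : s != 0 ->
  (\int[normal_prob 0 s]_x (Num.max x 0)%:E =
   \int[normal_prob 0 s]_x (Num.max (- x) 0)%:E)%E.
Proof.
move=> s0.
have ge0p (x : R) : 0 <= Num.max x 0 by rewrite le_max lexx orbT.
have cmax : continuous (fun x : R => Num.max x 0).
  by move=> x; apply: continuous_max; [exact: cvg_id|exact: cvg_cst].
rewrite !ge0_integral_normal_prob//; last 3 first.
- by apply/measurable_EFinP; apply: measurable_maxr.
- by move=> x; rewrite lee_fin.
- by apply/measurable_EFinP; apply: measurable_maxr.
have cG : continuous (fun x : R => Num.max x 0 * normal_pdf 0 s x).
  by move=> x; apply: cvgM; [exact: cmax|exact: continuous_normal_pdf].
transitivity (\int[mu]_x (Num.max x 0 * normal_pdf 0 s x)%:E)%E.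
  by apply: eq_integral => x _; rewrite EFinM.
rewrite (ge0_integral_opp cG); last first.
  by move=> x; rewrite mulr_ge0// normal_pdf_ge0.
apply: eq_integral => x _; rewrite -EFinM; congr (_ * _)%:E.
by rewrite !normal_pdfE// /normal_fun !subr0 sqrrN.
Qed.

Lemma normal_peakE s : 0 < s -> normal_peak s = (s * Num.sqrt (pi *+ 2))^-1.
Proof.
move=> s0; rewrite /normal_peak -mulrnAr sqrtrM ?sqr_ge0//.
by rewrite sqrtr_sqr ger0_norm// ltW.
Qed.

(* Domination of x^2 times the density of N(0, s^2) by 8 s^2 times the density
   of N(0, (2 s)^2); the exact variance is never needed. *)
Lemma normal_prob_sqr_le s : 0 < s ->
  (\int[normal_prob 0 s]_x (x ^+ 2)%:E <= (8 * s ^+ 2)%:E)%E.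
Proof.
move=> s0.
rewrite ge0_integral_normal_prob//; last 2 first.
- by apply/measurable_EFinP; exact: measurable_funX.
- by move=> x; rewrite lee_fin sqr_ge0.
under eq_integral do rewrite -EFinM.
apply: (@le_trans _ _ (\int[mu]_x ((8 * s ^+ 2)%:E * (normal_pdf 0 (2 * s)
  x)%:E))%E); last first.
  rewrite ge0_integralZl//.
  - by rewrite integral_normal_pdf mule1.
  - by apply/measurable_EFinP; exact: measurable_normal_pdf.
  - by move=> x _; rewrite lee_fin normal_pdf_ge0.
  - by rewrite lee_fin mulr_ge0// sqr_ge0.
apply: ge0_le_integral => //.
- by move=> x _; rewrite lee_fin mulr_ge0 ?sqr_ge0 ?normal_pdf_ge0.
- apply/measurable_EFinP; apply: measurable_funM; last exact:
    measurable_normal_pdf.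
  exact: measurable_funX.
- apply: emeasurable_funM => //.
  by apply/measurable_EFinP; exact: measurable_normal_pdf.
move=> x _; rewrite -EFinM lee_fin.
rewrite !normal_pdfE ?gt_eqF ?mulr_gt0// !normal_peakE ?mulr_gt0//.
rewrite /normal_fun !subr0.
set q := Num.sqrt _; have q0 : 0 < q by rewrite sqrtr_gt0 mulrn_wgt0// pi_gt0.
have -> : (s * q)^-1 = 2 * (2 * s * q)^-1 by field; rewrite !gt_eqF.
set w := (2 * s * q)^-1.
have w0 : 0 < w by rewrite invr_gt0 !mulr_gt0.
(* In terms of u the two exponents are - 2 u and - u / 2, and the claim becomes u e^(- 2 u) <= e^(-
   u / 2), which follows from u e^(- u) <= 1. *)
pose u := x ^+ 2 / (4 * s ^+ 2).
have u0 : 0 <= u by rewrite divr_ge0 ?sqr_ge0// mulr_ge0// sqr_ge0.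
have -> : x ^+ 2 = 4 * s ^+ 2 * u by rewrite /u mulrC divfK// gt_eqF//
  mulr_gt0// exprn_gt0.
have -> : - (4 * s ^+ 2 * u) / (s ^+ 2 *+ 2) = - u - u.
  by rewrite -mulr_natr; field; rewrite gt_eqF.
have -> : - (4 * s ^+ 2 * u) / ((2 * s) ^+ 2 *+ 2) = - u / 2.
  by rewrite -mulr_natr; field; rewrite gt_eqF.
rewrite expRD.
have h1 : u * expR (- u) <= 1.
  rewrite expRN ler_pdivrMr ?expR_gt0// mul1r.
  by apply: le_trans (expR_ge1Dx u); rewrite lerDr.
have h2 : expR (- u) <= expR (- u / 2) by rewrite ler_expR; lra.
have := expR_gt0 (- u); set e1 := expR (- u) in h1 h2 *;
  set e2 := expR _ in h2 *.
move=> e10.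
have -> : 4 * s ^+ 2 * u * (2 * w * (e1 * e1)) = 8 * s ^+ 2 * (w * ((u * e1) *
  e1)) by ring.
rewrite ler_pM2l ?mulr_gt0 ?exprn_gt0// ler_pM2l//.
apply: le_trans h2; rewrite ler_piMl// ltW//.
Qed.

(** On both intervals x^2 <= (2 s)^2, so the density is at least e^(-2) times its peak 1 / (s sqrt
    (2 pi)). The length s of the interval cancels the s of the peak, and the bound is the same at
    every scale. *)
Lemma normal_prob_itv_ge s : 0 < s ->
  ((expR (- 2) / Num.sqrt (pi *+ 2))%:E <= normal_prob 0 s `[s, (2 * s)%R])%E /\
  ((expR (- 2) / Num.sqrt (pi *+ 2))%:E <=
     normal_prob 0 s `[(- (2 * s))%R, (- s)%R])%E.
Proof.
move=> s0.
have H (a b : R) : b - a = s -> (forall x, a <= x <= b -> x ^+ 2 <= (2 * s) ^+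
  2) ->
    ((expR (- 2) / Num.sqrt (pi *+ 2))%:E <= normal_prob 0 s `[a, b])%E.
  move=> ab xab.
  have -> : (expR (- 2) / Num.sqrt (pi *+ 2))%:E =
      (\int[mu]_(x in `[a, b]) (normal_peak s * expR (- 2))%:E)%E :> \bar R.
    rewrite integral_cst//= lebesgue_measure_itv/= lte_fin ifT; last by lra.
    rewrite -EFinB -EFinM ab normal_peakE//; congr EFin.
    by field; rewrite !gt_eqF// sqrtr_gt0 mulrn_wgt0// pi_gt0.
  rewrite /normal_prob; apply: ge0_le_integral => //.
  - by move=> x _; rewrite lee_fin mulr_ge0 ?normal_peak_ge0 ?expR_ge0.
  - by apply/measurable_EFinP/measurable_funTS; exact: measurable_normal_pdf.
  move=> x /=; rewrite in_itv/= => /xab x2; rewrite lee_fin normal_pdfE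
    ?gt_eqF//.
  rewrite ler_wpM2l ?normal_peak_ge0// ler_expR subr0 mulNr lerN2.
  rewrite ler_pdivrMr ?pmulrn_lgt0 ?exprn_gt0//.
  by apply: le_trans (x2) _; rewrite (_ : (2 * s) ^+ 2 = 2 * (s ^+ 2 *+ 2))//;
    ring.
by split; apply: H; [ring| |ring|] => x /andP[h1 h2]; nra.
Qed.

End normal_moments.

(** * Sums of martingale increments *)

Section sub_sigma_algebra.
Context (R : realType) (disp : measure_display) (Omega : measurableType disp).
Implicit Types (G H : set (set Omega)) (f g : Omega -> R).

(** Going through the type that carries the sigma-algebra generated by [G] makes the closure
    properties of measurable functions (sums, products, limits) directly applicable. *)
Definition mfun_wrt G f :=
  measurable_fun setT (f : g_sigma_algebraType G -> R).

Lemma mfun_wrtP G f : sigma_algebra setT G ->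
  mfun_wrt G f <-> forall A, measurable A -> G (f @^-1` A).
Proof.
move=> sG; split=> [mf A mA|Gf _ A mA].
  have := mf measurableT _ mA; rewrite setTI.
  by rewrite [X in X _ -> _]/measurable/= sigma_algebra_id.
by rewrite setTI /measurable/= sigma_algebra_id//; exact: Gf.
Qed.

Lemma mfun_wrtS G H f : sigma_algebra setT G -> sigma_algebra setT H ->
  G `<=` H -> mfun_wrt G f -> mfun_wrt H f.
Proof.
move=> sG sH GH /(mfun_wrtP _ sG) mf; apply/(mfun_wrtP _ sH) => A mA.
exact/GH/mf.
Qed.

Lemma mfun_wrt_measurable G f : sigma_algebra setT G -> G `<=` measurable ->
  mfun_wrt G f -> measurable_fun setT f.
Proof.
move=> sG GH /(mfun_wrtP _ sG) mf _ A mA; rewrite setTI.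
exact/GH/mf.
Qed.

End sub_sigma_algebra.

Section martingale_transform.
Context (R : realType) (disp : measure_display) (Omega : measurableType disp).
Variable P : probability Omega R.
Variables (G : nat -> set (set Omega)) (z u : nat -> Omega -> R).
Variables (v : nat -> R) (C : R) (N : nat).
Hypothesis sG : forall i, (i <= N)%N -> sigma_algebra setT (G i).
Hypothesis Gm : forall i, (i <= N)%N -> G i `<=` measurable.
Hypothesis GS : forall i, (i < N)%N -> G i `<=` G i.+1.
Hypothesis mz : forall i, (i < N)%N -> mfun_wrt (G i) (z i).
Hypothesis um : forall i, (i < N)%N -> mfun_wrt (G i.+1) (u i).
Hypothesis zC : forall i w, (i < N)%N -> `|z i w| <= C.
Hypothesis u_sqr : forall i, (i < N)%N ->
  (\int[P]_w (u i w ^+ 2)%:E <= (v i)%:E)%E.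
Hypothesis u_sym : forall i, (i < N)%N ->
  (\int[P]_w (Num.max (u i w) 0)%:E = \int[P]_w (Num.max (- u i w) 0)%:E)%E.
Hypothesis u_indep : forall i, (i < N)%N -> forall E A,
  G i E -> measurable A ->
  P (E `&` u i @^-1` A) = (P E * P (u i @^-1` A))%E.

Lemma sqr_integrable_integrable (f : Omega -> R) : measurable_fun setT f ->
  (\int[P]_w (f w ^+ 2)%:E < +oo)%E -> P.-integrable setT (EFin \o f).
Proof.
move=> mf f2.
have i1 : P.-integrable setT (fun w => (1 + f w ^+ 2)%:E).
  apply: (@integrableD _ _ _ P setT measurableT (fun=> 1%E) (fun w => (f w ^+
    2)%:E)).
    by apply: finite_measure_integrable_cst.
  apply/integrableP; split.
    by apply/measurable_EFinP; exact: measurable_funX.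
  under eq_integral do rewrite gee0_abs ?lee_fin ?sqr_ge0//.
  exact: f2.
apply: le_integrable i1 => //; first exact/measurable_EFinP.
move=> w _; rewrite /= lee_fin [leRHS]ger0_norm ?addr_ge0 ?sqr_ge0//.
by rewrite -(real_normK (num_real (f w))); have := normr_ge0 (f w); nra.
Qed.

(** The discrete form of Ito's isometry. When the square of the sum is expanded, the cross term
    vanishes because the partial sum times [z k] is [G k]-measurable while [u k] is centred and
    independent of [G k]; the diagonal term factorizes. The bound [C] makes the cross term
    integrable and leaves no trace in the estimate. Measurability of the partial sums is carried
    along for the induction. *)
Lemma martingale_transform_sqr_le k : (k <= N)%N ->
  mfun_wrt (G k) (fun w => \sum_(i < k) z i w * u i w) /\
  (\int[P]_w ((\sum_(i < k) z i w * u i w) ^+ 2)%:E <=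
   \sum_(i < k) (v i)%:E * \int[P]_w (z i w ^+ 2)%:E)%E.
Proof.
have z2C i w : (i < N)%N -> z i w ^+ 2 <= C ^+ 2.
  move=> iN; rewrite -(real_normK (num_real (z i w))).
  by rewrite lerXn2r ?nnegrE// ?(le_trans _ (zC w iN))// ?zC.
have zfin i : (i < N)%N -> (\int[P]_w (z i w ^+ 2)%:E < +oo)%E.
  move=> iN; apply: (@le_lt_trans _ _ (\int[P]_w (C ^+ 2)%:E)%E); last first.
    by rewrite integral_cst//= probability_setT mule1 ltry.
  have mzi := mfun_wrt_measurable (sG (ltnW iN)) (Gm (ltnW iN)) (mz iN).
  apply: ge0_le_integral => //.
  - by move=> w _; rewrite lee_fin sqr_ge0.
  - by apply/measurable_EFinP; exact: measurable_funX.
  - by move=> w _; rewrite lee_fin z2C.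
have v0 i : (i < N)%N -> 0 <= v i.
  move=> iN; rewrite -lee_fin; apply: le_trans (u_sqr iN).
  by apply: integral_ge0 => w _; rewrite lee_fin sqr_ge0.
elim: k => [_|k IH kN].
  split.
    under eq_fun do rewrite big_ord0; exact: measurable_cst.
  under eq_integral do rewrite big_ord0 expr0n/=.
  by rewrite integral0 big_ord0.
have [mW W2] := IH (ltnW kN).
pose W w := \sum_(i < k) z i w * u i w; rewrite -/W in mW W2.
have [mzk muk] := (mz kN, um kN).
have skW := mfun_wrtS (sG (ltnW kN)) (sG kN) (GS kN) mW.
have skz := mfun_wrtS (sG (ltnW kN)) (sG kN) (GS kN) mzk.
split.
  under eq_fun do rewrite big_ord_recr/=.
  by apply: measurable_funD => //; exact: measurable_funM.
have mWT := mfun_wrt_measurable (sG kN) (Gm kN) skW.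
have mzT := mfun_wrt_measurable (sG kN) (Gm kN) skz.
have muT := mfun_wrt_measurable (sG kN) (Gm kN) muk.
have Wfin : (\int[P]_w (W w ^+ 2)%:E < +oo)%E.
  apply: le_lt_trans W2 _; rewrite lte_sum_pinfty// => i _.
  have iN := ltn_trans (ltn_ord i) kN.
  rewrite lte_mul_pinfty ?lee_fin ?v0//; exact: zfin.
have ufin : (\int[P]_w (u k w ^+ 2)%:E < +oo)%E.
  by apply: le_lt_trans (u_sqr kN) _; rewrite ltry.
pose Um : {mfun Omega >-> R} := mfun_Sub (mem_set muT).
pose Zm : {mfun Omega >-> R} := mfun_Sub (mem_set mzT).
(* The whole past, W times z k, is treated as one factor, so that only its independence from the
   next increment matters. *)
have mWz : measurable_fun setT (fun w => W w * z k w) by exact: measurable_funM.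
pose WZm : {mfun Omega >-> R} := mfun_Sub (mem_set mWz).
have indZ : indep_fun P Zm Um.
  move=> A D mA mD; apply: u_indep => //.
  by move/(mfun_wrtP _ (sG (ltnW kN))) : mzk; exact.
have indWZ : indep_fun P WZm Um.
  move=> A D mA mD; apply: u_indep => //.
  have : mfun_wrt (G k) (fun w => W w * z k w) by exact: measurable_funM.
  by move/(mfun_wrtP _ (sG (ltnW kN))); exact.
have zu2 : (\int[P]_w (z k w ^+ 2 * u k w ^+ 2)%:E <=
    (v k)%:E * \int[P]_w (z k w ^+ 2)%:E)%E.
  rewrite (@indep_integralM_ge0 _ _ _ P Zm Um (fun x => x ^+ 2) (fun x => x ^+
    2))//;
    [|exact: measurable_funX..|by move=> x; exact: sqr_ge0|by move=> x;
      exact: sqr_ge0].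
  rewrite muleC; apply: lee_wpmul2r => //; last exact: u_sqr.
  by apply: integral_ge0 => w _; rewrite lee_fin sqr_ge0.
have zufin : (\int[P]_w (z k w ^+ 2 * u k w ^+ 2)%:E < +oo)%E.
  apply: le_lt_trans zu2 _; rewrite lte_mul_pinfty ?lee_fin ?v0//; exact: zfin.
have iWZ : P.-integrable setT (EFin \o WZm).
  apply: sqr_integrable_integrable => //=.
  apply: (@le_lt_trans _ _ ((C ^+ 2)%:E * \int[P]_w (W w ^+ 2)%:E)%E);
    last first.
    by rewrite lte_mul_pinfty// lee_fin sqr_ge0.
  rewrite -ge0_integralZl//; last 3 first.
  - by apply/measurable_EFinP; exact: measurable_funX.
  - by move=> w _; rewrite lee_fin sqr_ge0.
  - by rewrite lee_fin sqr_ge0.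
  apply: ge0_le_integral => //.
  - by move=> w _; rewrite lee_fin sqr_ge0.
  - by apply/measurable_EFinP; exact: measurable_funX.
  - apply/measurable_EFinP; apply: measurable_funM => //;
      exact: measurable_funX.
  - move=> w _; rewrite -EFinM lee_fin /= exprMn mulrC.
    by apply: ler_wpM2r; [exact: sqr_ge0|exact: z2C].
have iU : P.-integrable setT (EFin \o Um) by exact: sqr_integrable_integrable.
have cross : (\int[P]_w (WZm w * Um w)%:E = 0)%E.
  by apply: indep_integralM_eq0 => //; exact: u_sym.
have iW2 : P.-integrable setT (fun w => (W w ^+ 2)%:E).
  apply/integrableP; split; first by apply/measurable_EFinP;
    exact: measurable_funX.
  by under eq_integral do rewrite gee0_abs ?lee_fin ?sqr_ge0//.
have izu2 : P.-integrable setT (fun w => (z k w ^+ 2 * u k w ^+ 2)%:E).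
  apply/integrableP; split.
    by apply/measurable_EFinP; apply: measurable_funM; exact: measurable_funX.
  under eq_integral => w _.
    rewrite gee0_abs; last by rewrite lee_fin mulr_ge0 ?sqr_ge0.
    over.
  exact: zufin.
have iD := integrableD measurableT iW2 izu2.
have icross : P.-integrable setT (fun w => (WZm w * Um w)%:E).
  apply: le_integrable iD => //.
    by apply/measurable_EFinP; exact: measurable_funM.
  move=> w _; rewrite /= lee_fin [leRHS]ger0_norm; last first.
    by rewrite -exprMn addr_ge0 ?sqr_ge0.
  rewrite -mulrA -exprMn ler_norml.
  by set a := W w; set b := z k w * u k w; nra.
rewrite big_ord_recr/=.
have -> : (\int[P]_w ((\sum_(i < k.+1) z i w * u i w) ^+ 2)%:E =
   \int[P]_w ((W w ^+ 2)%:E + (z k w ^+ 2 * u k w ^+ 2)%:E +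
      2%:E * (WZm w * Um w)%:E))%E.
  apply: eq_integral => w _; rewrite big_ord_recr/= -!(EFinD, EFinM) -/(W w).
  by congr EFin; ring.
rewrite (integralD measurableT iD (integrableZl measurableT 2 icross)).
rewrite integralZl// cross mule0 adde0 (integralD measurableT iW2 izu2).
exact: leeD.
Qed.

End martingale_transform.

(** * Measurability of matrix-valued maps *)

Section matrix_norm.
Variables (R : realType) (m n : nat).
Implicit Types A : 'M[R]_(m, n).

Lemma ler_mx_norm A i j : `|A i j| <= `|A|.
Proof.
rewrite /Num.norm/= mx_normrE.
exact: (le_bigmax _ (fun i : 'I_m * 'I_n => `|A i.1 i.2|) (i, j)).
Qed.

Lemma mx_norm_le A c : 0 <= c -> (`|A| <= c) = [forall i, forall j,
  `|A i j| <= c].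
Proof.
move=> c0; apply/idP/forallP => [Ac i|Ac].
  by apply/forallP => j; exact: le_trans (ler_mx_norm _ _ _) Ac.
rewrite /Num.norm/= mx_normrE; apply: bigmax_le => // -[i j] _ /=.
by have /forallP := Ac i.
Qed.

Lemma mx_norm_lt A c : 0 < c -> (`|A| < c) = [forall i, forall j, `|A i j| < c].
Proof.
move=> c0; apply/idP/forallP => [Ac i|Ac].
  by apply/forallP => j; exact: le_lt_trans (ler_mx_norm _ _ _) Ac.
rewrite /Num.norm/= mx_normrE; apply: bigmax_lt => // -[i j] _ /=.
by have /forallP := Ac i.
Qed.

End matrix_norm.

Section matrix_measurability.
Context (R : realType) d (T : measurableType d) (m n : nat).

Lemma measurable_mx_norm (f : T -> 'M[R]_(m, n)) :
  (forall i j, measurable_fun setT (fun w => f w i j)) ->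
  measurable_fun setT (fun w => `|f w|).
Proof.
move=> mf; under eq_fun do rewrite /Num.norm/= mx_normrE.
elim: (index_enum _) => [|x s IH].
  under eq_fun do rewrite big_nil; exact: measurable_cst.
under eq_fun do rewrite big_cons.
by apply: measurable_maxr => //; apply: measurableT_comp => //; exact: mf.
Qed.

(** An open set is the union of the balls inside it that have a rational centre and a radius 1 / (k
    + 1). There are countably many, and the preimage of each is described by the norm of a
    measurable map. *)
Lemma measurable_mx_open (f : T -> 'M[R]_(m, n)) :
  (forall i j, measurable_fun setT (fun w => f w i j)) ->
  forall A, <<s (@open 'M[R]_(m, n)) >> A -> measurable (f @^-1` A).
Proof.
move=> mf.
suff : <<s (@open 'M[R]_(m, n)) >> `<=` [set A | measurable (f @^-1` A)] by [].
apply: smallest_sub.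
  split; rewrite /=.
  - by rewrite preimage_set0.
  - by move=> B mB; rewrite setTD preimage_setC; exact: measurableC.
  - by move=> B mB; rewrite preimage_bigcup; apply: bigcupT_measurable => i;
      exact: mB.
move=> U oU /=.
pose I := (nat * 'M[rat]_(m, n))%type.
pose bx (p : I) := [set x : 'M[R]_(m, n) | `|map_mx ratr p.2 - x| <
  p.1.+1%:R^-1].
have -> : f @^-1` U = \bigcup_(p in [set p | bx p `<=` U]) (f @^-1` (bx p)).
  apply/seteqP; split=> [w Uw|w [p /= pU]]; last exact: pU.
  have /nbhs_ballP[e /= e0 eU] := open_nbhs_nbhs (conj oU Uw).
  rewrite mx_norm_ball in eU.
  have [k ke] : exists k, k.+1%:R^-1 < e / 2 :> R.
    have e20 : 0 < e / 2 by rewrite divr_gt0.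
    by have [k] := ltr_add_invr e20; rewrite add0r; exists k.
  have kp : 0 < k.+1%:R^-1 :> R by rewrite invr_gt0.
  have Q (i : 'I_m) (j : 'I_n) : exists q : rat, `|ratr q - f w i j| <
    k.+1%:R^-1 :> R.
    have lt2 : f w i j - k.+1%:R^-1 < f w i j + k.+1%:R^-1.
      by rewrite ltrD2l gt0_cp.
    have [q] := rat_in_itvoo lt2; rewrite in_itv/= => /andP[q1 q2]; exists q.
    by rewrite ltr_distl q1 q2.
  pose q : 'M[rat]_(m, n) := \matrix_(i, j) projT1 (cid (Q i j)).
  have qw : bx (k, q) (f w).
    rewrite /bx/= mx_norm_lt//; apply/forallP => i; apply/forallP => j.
    by rewrite !mxE; exact: (projT2 (cid (Q i j))).
  exists (k, q) => //= x bxx; apply: eU.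
  rewrite /ball_/=.
  have -> : f w - x = (f w - map_mx ratr q) + (map_mx ratr q - x).
    by rewrite addrA subrK.
  apply: le_lt_trans (ler_normD _ _) _; rewrite distrC.
  by rewrite (splitr e) ltrD// (lt_trans _ ke).
rewrite bigcup_mkcond; apply: countable_bigcupT_measurable => [|p].
  exact: countableP.
case: ifPn => // _.
have -> : f @^-1` bx p = (fun w => `|map_mx ratr p.2 - f w|) @^-1` `]-oo,
  (p.1.+1%:R^-1 : R)[.
  by apply/seteqP; split=> w; rewrite /bx/= in_itv.
have mn : measurable_fun setT (fun w => `|map_mx ratr p.2 - f w|).
  apply: measurable_mx_norm => i j; under eq_fun do rewrite !mxE.
  by apply: measurable_funB => //; exact: mf.
by rewrite -[X in measurable X]setTI; apply: mn.
Qed.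

Lemma coord_borel (A : set R) i j : measurable A ->
  <<s (@open 'M[R]_(m, n)) >> ((fun x : 'M[R]_(m, n) => x i j) @^-1` A).
Proof.
move=> mA.
pose g (x : g_sigma_algebraType (@open 'M[R]_(m, n))) : R := x i j.
have mg : measurable_fun setT g.
  apply: (measurability _ (RGenOpens.measurableE R)) => // _ [_ [x [y ->]] <-].
  rewrite setTI; apply: sub_sigma_algebra.
  apply: (@open_comp _ _ (fun x : 'M[R]_(m, n) => x i j)).
    by move=> M _; exact: coord_continuous.
  exact: interval_open.
by have := mg measurableT _ mA; rewrite setTI.
Qed.

End matrix_measurability.

Section measurable_wrt.
Context (R : realType) disp (Omega : measurableType disp) (m n : nat).
Implicit Types (G : set (set Omega)) (f : Omega -> 'M[R]_(m, n)).

Lemma measurable_wrt_coordP G f : sigma_algebra setT G ->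
  measurable_wrt G f <-> forall i j, mfun_wrt G (fun w => f w i j).
Proof.
move=> sG; split=> [mf i j|mf A mA].
  apply/mfun_wrtP => // A mA.
  exact: (mf _ (coord_borel i j mA)).
have : measurable (f @^-1` A : set (g_sigma_algebraType G)).
  by apply: measurable_mx_open.
by rewrite /measurable/= sigma_algebra_id.
Qed.

End measurable_wrt.

(** * Almost sure limits in a sigma-algebra containing the null sets *)

Section ae_limit.
Context (R : realType) disp (Omega : measurableType disp) (m n : nat).
Variables (P : probability Omega R) (G : set (set Omega)).
Hypothesis sG : sigma_algebra setT G.
Hypothesis nG : P.-negligible `<=` G.

(** The two preimages of a set differ only inside a negligible set, all of whose subsets belong to
    [G]. *)
Lemma mfun_wrt_ae_eq (f g : Omega -> R) :
  {ae P, forall w, f w = g w} -> mfun_wrt G f -> mfun_wrt G g.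
Proof.
move=> fg /(mfun_wrtP _ sG) mf; apply/(mfun_wrtP _ sG) => A mA.
pose N := ~` [set w | f w = g w].
have GN B : B `<=` N -> G B by move=> BN; apply: nG; exact: negligibleS BN fg.
have mG B : G B = measurable (B : set (g_sigma_algebraType G)).
  by rewrite /measurable/= sigma_algebra_id.
have -> : g @^-1` A = (f @^-1` A `\` N) `|` (g @^-1` A `&` N).
  apply/seteqP; split=> w /=.
    by move=> gA; have [fgw|] := pselect (f w = g w);
      [left; rewrite /N/= fgw; split => //; exact|right].
  by move=> [[fA /contrapT <-//]|[]].
rewrite mG; apply: measurableU.
  by apply: measurableD; rewrite -mG; [exact: mf|exact: GN].
by rewrite -mG; exact: GN.
Qed.

(** The convergence set is the complement of a negligible set, so it lies in [G]. Multiplying by its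
    indicator makes the convergence hold everywhere and changes [f] only on a null set. *)
Lemma mfun_wrt_ae_cvg (h : nat -> Omega -> R) (f : Omega -> R) :
  (forall k, mfun_wrt G (h k)) ->
  {ae P, forall w, h k w @[k --> \oo] --> f w} -> mfun_wrt G f.
Proof.
move=> mh hf.
pose E := [set w | h k w @[k --> \oo] --> f w].
have GE : measurable (E : set (g_sigma_algebraType G)).
  rewrite -[E]setCK; apply: measurableC; rewrite /measurable/=
    sigma_algebra_id//.
  exact: nG.
apply: (@mfun_wrt_ae_eq (fun w => f w * \1_E w)).
  apply: filterS hf => w Ew; rewrite indicE mem_set ?mulr1//.
apply: (@measurable_fun_cvg _ (g_sigma_algebraType G) _ _ (fun k w => h k w *
  \1_E w)).
  move=> k; apply: measurable_funM; first exact: mh.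
  exact: (@measurable_indic _ (g_sigma_algebraType G) R setT E GE).
move=> w _; rewrite indicE; have [Ew|Ew] := boolP (w \in E).
  by rewrite mulr1; under eq_fun do rewrite mulr1; rewrite inE in Ew.
by rewrite mulr0; under eq_fun do rewrite mulr0; exact: cvg_cst.
Qed.

Lemma measurable_wrt_ae_cvg (h : nat -> Omega -> 'M[R]_(m, n))
    (f : Omega -> 'M[R]_(m, n)) :
  (forall k, measurable_wrt G (h k)) ->
  {ae P, forall w, h k w @[k --> \oo] --> f w} -> measurable_wrt G f.
Proof.
move=> mh hf; apply/(measurable_wrt_coordP _ sG) => i j.
apply: (@mfun_wrt_ae_cvg (fun k w => h k w i j)).
  by move=> k; have /(measurable_wrt_coordP _ sG) := mh k; exact.
apply: filterS hf => w hw.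
by apply: (cvg_comp _ (fun x : 'M[R]_(m, n) => x i j) hw);
  exact: coord_continuous.
Qed.

End ae_limit.

(* Extending a path by a constant to negative times turns continuity within
   [0, +oo[ into plain continuity. *)
Lemma within_continuous_max (R : realType) (U : topologicalType) (f : R -> U) :
  {within `[0, +oo[, continuous f} -> continuous (fun s : R => f (Num.max s 0)).
Proof.
move=> /subspace_continuousP cf x.
have max0 (s : R) : 0 <= Num.max s 0 by rewrite le_max lexx orbT.
have cx := cf (Num.max x 0); rewrite /= in_itv/= max0 in cx.
suff cw : (fun s : R => Num.max s 0) @ x --> within `[0,
  +oo[ (nbhs (Num.max x 0)).
  exact: (cvg_comp _ _ cw (cx isT)).
rewrite /= => W nW.
have : \forall s \near x, `[0, +oo[%classic (Num.max s 0) -> W (Num.max s 0).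
  have cmax : {for x, continuous (fun s : R => Num.max s 0)}.
    by apply: continuous_max; [exact: cvg_id|exact: cvg_cst].
  exact: (cmax _ nW).
by apply: filterS => s; apply; rewrite /= in_itv/= max0.
Qed.

(** * Joint measurability of continuous processes *)

Section joint_measurability.
Context (R : realType) disp (Omega : measurableType disp).

(** Time is rounded down to a multiple [r m s] of 1 / (m + 1). The rounded process has preimages
    that are countable unions of measurable rectangles, and it converges to [h] by path
    continuity. *)
Lemma joint_measurable (h : R -> Omega -> R) :
  (forall s, 0 <= s -> measurable_fun setT (h s)) ->
  (forall w, {within `[0, +oo[, continuous (h^~ w)}) ->
  measurable_fun setT (fun p : R * Omega => h (Num.max p.1 0) p.2).
Proof.
move=> mh ch.
pose q m (s : R) : nat := Num.truncn (Num.max s 0 * m.+1%:R).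
pose r m (s : R) : R := (q m s)%:R / m.+1%:R.
have max0 (s : R) : 0 <= Num.max s 0 by rewrite le_max lexx orbT.
apply: (@measurable_fun_cvg _ _ _ _ (fun m (p : R * Omega) => h (r m p.1) p.2)).
  move=> m _ A mA; rewrite setTI.
  have -> : (fun p : R * Omega => h (r m p.1) p.2) @^-1` A =
      \bigcup_i ([set s | q m s = i] `*` (h (i%:R / m.+1%:R) @^-1` A)).
    apply/seteqP; split=> [[s w] /= Ap|[s w] [i _ [/= <-]]//].
    by exists (q m s).
  apply: bigcupT_measurable => i; apply: measurableX; last first.
    rewrite -[X in measurable X]setTI; exact: mh.
  have -> : [set s | q m s = i] =
      (fun s => Num.max s 0 * m.+1%:R) @^-1` `[i%:R, i.+1%:R[.
    apply/seteqP; split => s; rewrite /q /= in_itv/= -truncn_eq ?mulr_ge0//.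
      by move=> ->.
    by move/eqP.
  have mg : measurable_fun setT (fun s : R => Num.max s 0 * m.+1%:R).
    by apply: measurable_funM => //; exact: measurable_maxr.
  by rewrite -[X in measurable X]setTI; apply: mg.
move=> [s w] _ /=.
have -> : (fun m => h (r m s) w) = (fun x : R => h (Num.max x 0) w) \o (r ^~ s).
  apply/funext => m /=; congr (h _ w); apply/esym/max_idPl; exact: divr_ge0.
have -> : h (Num.max s 0) w = h (Num.max (Num.max s 0) 0) w by rewrite (max_l
  (max0 s)).
suff cr : r m s @[m --> \oo] --> Num.max s 0.
  exact: (cvg_comp _ _ cr (within_continuous_max (ch w) (x := Num.max s 0))).
apply/cvgrPdist_le => /= e e0.
have [N Ne] := ltr_add_invr e0; rewrite add0r in Ne.
near=> m.
have m0 : 0 < m.+1%:R :> R by [].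
have /andP[q1 q2] : (q m s)%:R <= Num.max s 0 * m.+1%:R < (q m s).+1%:R.
  by rewrite -truncn_eq ?mulr_ge0.
have h1 : r m s <= Num.max s 0 by rewrite ler_pdivrMr.
rewrite ger0_norm ?subr_ge0//.
apply: (@le_trans _ _ m.+1%:R^-1).
  rewrite lerBlDr -[X in X + _]mul1r -mulrDl ler_pdivlMr// -[1]/(1%:R) -natrD
    add1n.
  exact: ltW.
apply: le_trans (ltW Ne); rewrite lef_pV2 ?posrE// ler_nat ltnS.
by near: m; exists N.
Unshelve. all: by end_near. Qed.

Variables (P : probability Omega R) (P_complete : measure_is_complete P).
Variables (n : nat) (t : R) (K H : R -> Omega -> 'M[R]_n).
Hypothesis mK : forall i j,
  measurable_fun setT (fun p : R * Omega => K p.1 p.2 i j).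
Hypothesis mH : forall s i j, 0 <= s ->
  measurable_fun setT (fun w => H s w i j).
Hypothesis cH : {ae P, forall w, {within `[0, +oo[, continuous (H ^~ w)}}.

(* A probability measure is unconstrained on non-measurable sets, so the
   convergence in ito_integral only carries information once this
   measurability is known. *)
Lemma measurable_integral_sqr : measurable_fun setT (fun w =>
  (\int[lebesgue_measure]_(s in `[0%R, t])
      ((`|K s w - H s w| ^+ 2)%R)%:E)%E).
Proof.
pose E := [set w | {within `[0, +oo[, continuous (H ^~ w)}].
have mE : measurable E.
  rewrite -[E]setCK; apply: measurableC; exact: P_complete.
(* Paths are continuous only almost surely. Putting 0 on the exceptional set makes all of them
   continuous, as [joint_measurable] requires. *)
pose h s w i j : R := H s w i j * \1_E w.
pose H' (s : R) w : 'M[R]_n := \matrix_(i, j) h (Num.max s 0) w i j.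
pose f (w : Omega) (s : R) : \bar R :=
  (\1_(`[0, t] : set R) s * `|K s w - H' s w| ^+ 2)%:E.
have mH' i j : measurable_fun setT (fun p : R * Omega => H' p.1 p.2 i j).
  under eq_fun do rewrite mxE.
  apply: (joint_measurable (h := fun s w => h s w i j)) => [s s0|w].
    by apply: measurable_funM; [exact: mH|exact: measurable_indic].
  rewrite /h indicE; have [wE|wE] := boolP (w \in E).
    rewrite (_ : (fun _ => _) = (fun s => H s w i j)); last first.
      by apply/funext => s; rewrite mulr1.
    rewrite inE in wE.
    have cg : {in (H ^~ w) @` `[0, +oo[, continuous (fun x : 'M[R]_n => x i j)}.
      by move=> x _; exact: coord_continuous.
    exact: (within_continuous_comp _ _ _ cg wE).
  rewrite (_ : (fun _ => _) = cst 0); last by apply/funext => s; rewrite mulr0.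
  by move=> x; exact: cst_continuous.
have mf : measurable_fun setT (fun p : Omega * R => f p.1 p.2).
  have mf' : measurable_fun setT (fun p : R * Omega => f p.2 p.1).
    apply/measurable_EFinP; apply: measurable_funM.
      have m1 : measurable_fun setT (\1_(`[0, t] : set R) : R -> R).
        exact: measurable_indic.
      exact: (measurableT_comp m1 measurable_fst).
    apply: measurable_funX; apply: measurable_mx_norm => i j.
    rewrite (_ : (fun _ => _) = (fun p : R * Omega => K p.1 p.2 i j) \-
      (fun p : R * Omega => H' p.1 p.2 i j)); last by apply/funext => p /=;
        rewrite !mxE.
    by apply: measurable_funB; [exact: mK|exact: mH'].
  exact: (measurableT_comp mf' (measurable_fun_pair measurable_snd
    measurable_fst)).
have f0 p : (0 <= f p.1 p.2)%E by rewrite lee_fin mulr_ge0 ?sqr_ge0.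
have := @measurable_fun_fubini_tonelli_F _ _ Omega (measurableTypeR R) R
  lebesgue_measure (fun p => f p.1 p.2) mf f0.
(* The integral formed with [H'] is measurable by Tonelli's theorem; completeness passes this on to
   the original integral, which agrees with it almost surely. *)
apply: (ae_measurable_fun P_complete).
apply: filterS cH => w Ew _.
rewrite /fubini_F/= [RHS]integral_mkcond; apply: eq_integral => s _.
rewrite patchE /f indicE; case: ifPn => st; rewrite ?mul0r// mul1r.
congr (`| _ - _| ^+ 2)%:E; apply/matrixP => i j; rewrite mxE /h indicE
  mem_set// mulr1.
by rewrite inE/= in_itv/= in st; case/andP: st => s0 _; rewrite max_l.
Qed.

End joint_measurability.

(** * Estimates for Ito integrals *)

Section brownian_increments.
Context (R : realType) (disp : measure_display) (Omega : measurableType disp).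
Variables (P : probability Omega R) (F : R -> set (set Omega)) (n : nat).
Variable B : R -> Omega -> 'cV[R]_n.
Hypotheses (FF : filtration F) (BB : brownian_motion P F B).

Lemma filtration_sigma s : 0 <= s -> sigma_algebra setT (F s).
Proof. by case: FF => + _ _; exact. Qed.

Lemma filtration_measurable s : 0 <= s -> F s `<=` measurable.
Proof. by case: FF => _ + _; exact. Qed.

Lemma filtration_le s t : 0 <= s -> s <= t -> F s `<=` F t.
Proof. by case: FF => _ _; exact. Qed.

Lemma bm_coord_mfun s t j : 0 <= s -> s <= t ->
  mfun_wrt (F t) (fun w => B s w j ord0).
Proof.
move=> s0 st; apply: (mfun_wrtS (filtration_sigma s0)).
- exact: filtration_sigma (le_trans s0 st).
- exact: filtration_le.
have /(measurable_wrt_coordP _ (filtration_sigma s0)) := bm_adapted BB s0;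
  exact.
Qed.

Definition bm_incr s t j (w : Omega) : R := B t w j ord0 - B s w j ord0.

Lemma bm_incr_mfun s t j : 0 <= s -> s <= t -> mfun_wrt (F t) (bm_incr s t j).
Proof.
move=> s0 st; apply: measurable_funB; last exact: bm_coord_mfun.
by apply: bm_coord_mfun => //; exact: le_trans st.
Qed.

Lemma bm_incr_measurable s t j : 0 <= s -> s <= t ->
  measurable_fun setT (bm_incr s t j).
Proof.
move=> s0 st; have t0 := le_trans s0 st.
exact: (mfun_wrt_measurable (filtration_sigma t0) (filtration_measurable t0)
          (bm_incr_mfun _ s0 st)).
Qed.

(** A marginal of the product law: the other coordinates are left unrestricted and contribute
    factors 1. *)
Lemma bm_incr_law s t j A : 0 <= s -> s < t -> measurable A ->
  P (bm_incr s t j @^-1` A) = normal_prob 0 (Num.sqrt (t - s)) A.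
Proof.
move=> s0 st mA.
pose As (i : 'I_n) : set R := if i == j then A else setT.
have mAs i : measurable (As i) by rewrite /As; case: ifP.
have := bm_normal BB s0 st mAs.
rewrite (bigD1 j)//= /As eqxx big1 ?mulr1; last first.
  by move=> i /negbTE ->; rewrite probability_setT.
rewrite fineK ?fin_num_measure// => <-; congr (P _).
apply/seteqP; split=> w /=.
  by move=> Aw i; case: ifP => // /eqP ->; rewrite !mxE.
by move=> /(_ j); rewrite eqxx !mxE.
Qed.

(** The case s = t is included, with an increment that is constantly 0, because consecutive times of
    a simple process may coincide. *)
Lemma bm_incr_indep s t j E A : 0 <= s -> s <= t -> F s E -> measurable A ->
  P (E `&` bm_incr s t j @^-1` A) = (P E * P (bm_incr s t j @^-1` A))%E.
Proof.
move=> s0; rewrite le_eqVlt => /predU1P[<-|st] FE mA.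
  have -> : bm_incr s s j = cst 0 by apply/funext => w; rewrite /bm_incr subrr.
  rewrite preimage_cst; case: ifPn => _.
    by rewrite setIT probability_setT mule1.
  by rewrite setI0 measure0 mule0.
have E1 : bm_incr s t j @^-1` A =
    [set w | [set x : 'cV[R]_n | A (x j ord0)] (B t w - B s w)].
  by apply/seteqP; split=> w /=; rewrite !mxE.
rewrite E1; exact: (bm_independent BB s0 st FE (coord_borel j ord0 mA)).
Qed.

Lemma ge0_integral_bm_incr s t j (f : R -> \bar R) : 0 <= s -> s < t ->
  measurable_fun setT f -> (forall x, 0 <= f x)%E ->
  (\int[P]_w f (bm_incr s t j w) =
   \int[normal_prob 0 (Num.sqrt (t - s))]_x f x)%E.
Proof.
move=> s0 st mf f0.
have mU : measurable_fun setT (bm_incr s t j : Omega -> measurableTypeR R).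
  exact: bm_incr_measurable (ltW st).
pose Um : {mfun Omega >-> measurableTypeR R} := @mfun_Sub _ _ Omega
  (measurableTypeR R) _ (mem_set mU).
transitivity (\int[distribution P Um]_x f x)%E.
  by rewrite ge0_integral_distribution.
by apply: eq_measure_integral => A mA _; exact: bm_incr_law.
Qed.

Lemma bm_incr_sqr_le s t j : 0 <= s -> s <= t ->
  (\int[P]_w (bm_incr s t j w ^+ 2)%:E <= (8 * (t - s))%:E)%E.
Proof.
move=> s0; rewrite le_eqVlt => /predU1P[<-|st].
  under eq_integral do rewrite /bm_incr subrr expr0n/=.
  by rewrite integral0 subrr mulr0.
rewrite (@ge0_integral_bm_incr s t j (fun x => (x ^+ 2)%:E))//.
- have st0 : 0 < t - s by rewrite subr_gt0.
  rewrite -[X in (_ <= (8 * X)%:E)%E](sqr_sqrtr (ltW st0)).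
  by apply: normal_prob_sqr_le; rewrite sqrtr_gt0.
- by apply/measurable_EFinP; exact: measurable_funX.
- by move=> x; rewrite lee_fin sqr_ge0.
Qed.

Lemma bm_incr_sym s t j : 0 <= s -> s <= t ->
  (\int[P]_w (Num.max (bm_incr s t j w) 0)%:E =
   \int[P]_w (Num.max (- bm_incr s t j w) 0)%:E)%E.
Proof.
move=> s0; rewrite le_eqVlt => /predU1P[<-|st].
  by under [RHS]eq_integral do rewrite /bm_incr subrr oppr0;
     under [LHS]eq_integral do rewrite /bm_incr subrr.
have max0 (x : R) : 0 <= Num.max x 0 by rewrite le_max lexx orbT.
have mp : measurable_fun setT (fun x : R => (Num.max x 0)%:E).
  by apply/measurable_EFinP; exact: measurable_maxr.
have mn : measurable_fun setT (fun x : R => (Num.max (- x) 0)%:E).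
  by apply/measurable_EFinP; exact: measurable_maxr.
rewrite (ge0_integral_bm_incr j s0 st mp); last by move=> x; rewrite lee_fin.
rewrite (ge0_integral_bm_incr j s0 st mn); last by move=> x; rewrite lee_fin.
by apply: normal_prob_sym; rewrite gt_eqF// sqrtr_gt0 subr_gt0.
Qed.

Section step_integrals.
Variables (N : nat) (tau : nat -> R).
Hypotheses (tau0 : tau 0%N = 0).
Hypothesis tauS : forall i, (i < N)%N -> tau i <= tau i.+1.

Lemma step_time_ge0 i : (i <= N)%N -> 0 <= tau i.
Proof.
elim: i => [|i IH iN]; first by rewrite tau0.
by apply: le_trans (tauS iN); exact/IH/ltnW.
Qed.

Lemma step_integral_sqr_le (z : nat -> Omega -> R) (C : R) j :
  (forall i, (i < N)%N -> mfun_wrt (F (tau i)) (z i)) ->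
  (forall i w, (i < N)%N -> `|z i w| <= C) ->
  mfun_wrt (F (tau N))
    (fun w => \sum_(i < N) z i w * bm_incr (tau i) (tau i.+1) j w) /\
  (\int[P]_w ((\sum_(i < N) z i w * bm_incr (tau i) (tau i.+1) j w) ^+ 2)%:E <=
   \sum_(i < N) (8 * (tau i.+1 - tau i))%:E * \int[P]_w (z i w ^+ 2)%:E)%E.
Proof.
move=> mz zC.
apply: (@martingale_transform_sqr_le _ _ _ P (fun i => F (tau i)) z
  (fun i => bm_incr (tau i) (tau i.+1) j) (fun i => 8 * (tau i.+1 - tau i)) C
    N) => // i iN.
- exact/filtration_sigma/step_time_ge0.
- exact/filtration_measurable/step_time_ge0.
- by apply: filtration_le; [exact/step_time_ge0/ltnW|exact: tauS].
- by apply: bm_incr_mfun; [exact/step_time_ge0/ltnW|exact: tauS].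
- by apply: bm_incr_sqr_le; [exact/step_time_ge0/ltnW|exact: tauS].
- by apply: bm_incr_sym; [exact/step_time_ge0/ltnW|exact: tauS].
- by move=> E A FE mA; apply: bm_incr_indep => //;
    [exact/step_time_ge0/ltnW|exact: tauS].
Qed.

End step_integrals.

End brownian_increments.

(** * Tail bound for integrals of step processes *)

Section simple_estimate.
Context (R : realType) (disp : measure_display) (Omega : measurableType disp).
Variables (P : probability Omega R) (F : R -> set (set Omega)) (n : nat).
Variable B : R -> Omega -> 'cV[R]_n.
Hypotheses (FF : filtration F) (BB : brownian_motion P F B).

Lemma probability_exists_le (I : finType) (A : I -> set Omega) :
  (forall i, measurable (A i)) ->
  (P [set w | exists i, A i w] <= \sum_i P (A i))%E.
Proof.
move=> mA.
have -> : [set w | exists i, A i w] = \big[setU/set0]_i A i.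
  rewrite -bigcup_seq; apply/seteqP; split => w /=.
    by move=> [i Aw]; exists i => //=; rewrite mem_index_enum.
  by move=> [i _ Aw]; exists i.
suff [_] : measurable (\big[setU/set0]_i A i) /\
  (P (\big[setU/set0]_i A i) <= \sum_i P (A i))%E by [].
elim/big_rec2 : _ => [|i p D _ [mD pD]]; first by rewrite measure0.
split; first exact: measurableU.
by apply: le_trans (measureU2 _ _ _) _ => //; exact: leeD2l.
Qed.

Lemma sqr_markov (f : Omega -> R) (eps M : R) : measurable_fun setT f -> 0 <
  eps ->
  (\int[P]_w (f w ^+ 2)%:E <= M%:E)%E ->
  (P [set w | (eps <= `|f w|)%R] <= (M / eps ^+ 2)%:E)%E.
Proof.
move=> mf eps0 fM.
pose X : {RV P >-> R} := mfun_Sub (mem_set mf).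
have := @markov _ _ _ P X (fun x => x ^+ 2) _ eps0.
move=> /(_ (measurable_funX _ (@measurable_id _ _ _))).
move=> /(_ (fun x _ => sqr_ge0 x)).
have h : {in Num.nneg &, {homo (fun x : R => x ^+ 2) : x y / x <= y}}.
  by move=> x y; rewrite !nnegrE => x0 y0; rewrite ler_sqr.
move=> /(_ h) {h} H.
have e2 : 0 < eps ^+ 2 by rewrite exprn_gt0.
rewrite EFinM muleC lee_pdivlMl//.
apply: le_trans fM; apply: le_trans H _.
rewrite unlock /= le_eqVlt; apply/orP; left; apply/eqP.
by apply: eq_integral => w _ /=; rewrite real_normK ?num_real.
Qed.

Variables (N : nat) (tau : nat -> R) (eta : nat -> Omega -> 'M[R]_n) (C : R).
Hypotheses (tau0 : tau 0%N = 0).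
Hypothesis tauS : forall i, (i < N)%N -> tau i <= tau i.+1.
Hypothesis meta : forall i, (i < N)%N -> measurable_wrt (F (tau i)) (eta i).
Hypothesis etaC : forall i w, (i < N)%N -> `|eta i w| <= C.

Let tau_ge0 i : (i <= N)%N -> 0 <= tau i.
Proof. exact: step_time_ge0. Qed.

Let tau_le i j : (i <= j)%N -> (j <= N)%N -> tau i <= tau j.
Proof.
elim: j => [|j IH]; first by rewrite leqn0 => /eqP ->.
rewrite leq_eqVlt => /predU1P[-> //|]; rewrite ltnS => ij jN.
exact: le_trans (IH ij (ltnW jN)) (tauS jN).
Qed.

Let dt_ge0 i : (i < N)%N -> 0 <= tau i.+1 - tau i.
Proof. by move=> iN; rewrite subr_ge0 tauS. Qed.

(** The integral of |H_s|^2 over [0, tau k] for the step integrand H equal to [eta i] on ]tau i, tau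
    i.+1]. *)
Definition step_energy k (w : Omega) : R :=
  \sum_(i < k) `|eta i w| ^+ 2 * (tau i.+1 - tau i).

Let energyS k w : step_energy k.+1 w =
  step_energy k w + `|eta k w| ^+ 2 * (tau k.+1 - tau k).
Proof. by rewrite /step_energy big_ord_recr. Qed.

(** The hypothesis concerns the indices of the coefficients, which stay below [k], so k = i.+1 is
    allowed: the energy after the next step is already known at time [tau i], and the integrand can
    be stopped before that step. *)
Lemma step_energy_mfun k i : (i <= N)%N ->
  (forall j, (j < k)%N -> (j <= i)%N /\ (j < N)%N) ->
  mfun_wrt (F (tau i)) (step_energy k).
Proof.
move=> iN; elim: k => [|k IH] ki.
  rewrite (_ : step_energy 0 = cst 0); first exact: measurable_cst.
  by apply/funext => w; rewrite /step_energy big_ord0.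
rewrite (_ : step_energy k.+1 = fun w => step_energy k w + `|eta k w| ^+ 2 *
  (tau k.+1 - tau k));
  last by apply/funext => w; rewrite energyS.
have [ki' kN] := ki k (ltnSn k).
apply: measurable_funD; first by apply: IH => j jk; apply: ki; exact: ltnW.
apply: measurable_funM => //; apply: measurable_funX.
apply: measurable_mx_norm => r c.
apply: (mfun_wrtS (filtration_sigma FF (tau_ge0 (ltnW kN)))
   (filtration_sigma FF (tau_ge0 iN))).
  exact: (filtration_le FF (tau_ge0 (ltnW kN)) (tau_le ki' iN)).
have /(measurable_wrt_coordP _ (filtration_sigma FF (tau_ge0 (ltnW kN)))) :=
  meta kN; exact.
Qed.

Let energy_le i j w : (i <= j)%N -> (j <= N)%N -> step_energy i w <=
  step_energy j w.
Proof.
elim: j => [|j IH]; first by rewrite leqn0 => /eqP ->.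
rewrite leq_eqVlt => /predU1P[-> //|]; rewrite ltnS => ij jN.
apply: le_trans (IH ij (ltnW jN)) _.
by rewrite energyS lerDl mulr_ge0 ?dt_ge0// exprn_ge0.
Qed.

Variables (eps delta : R) (eps0 : 0 < eps) (delta0 : 0 < delta).

(* The integrand is stopped once its energy reaches delta. The energy up to
   tau i.+1 only involves eta 0, ..., eta i, so it is F (tau i)-measurable. *)
Let z (r c : 'I_n) i w := if step_energy i.+1 w < delta then eta i w r c else 0.

Let z_mfun r c i : (i < N)%N -> mfun_wrt (F (tau i)) (z r c i).
Proof.
move=> iN; apply: measurable_fun_ifT.
- apply: measurable_fun_ltr; last exact: measurable_cst.
  apply: step_energy_mfun => [|j]; first exact: ltnW.
  by rewrite ltnS => ji; split => //; exact: leq_ltn_trans iN.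
- have /(measurable_wrt_coordP _ (filtration_sigma FF (tau_ge0 (ltnW iN)))) :=
    meta iN; exact.
- exact: measurable_cst.
Qed.

Let z_bounded r c i w : (i < N)%N -> `|z r c i w| <= C.
Proof.
move=> iN; have etaCi := etaC w iN; rewrite /z; case: ifP => _.
  exact: le_trans (ler_mx_norm _ _ _) etaCi.
by rewrite normr0; exact: le_trans etaCi.
Qed.

(** A term is kept only if the energy including it is still below delta. The induction carries both
    bounds: the sum is at most the energy, which serves at a kept term, and at most delta, which
    serves at a dropped one. *)
Let z_energy r c w : \sum_(i < N) (tau i.+1 - tau i) * z r c i w ^+ 2 <= delta.
Proof.
pose S k := \sum_(i < k) (tau i.+1 - tau i) * z r c i w ^+ 2.
suff H k : (k <= N)%N -> S k <= delta /\ S k <= step_energy k w.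
  by have [] := H N (leqnn N).
elim: k => [_|k IH kN].
  by rewrite /S /step_energy !big_ord0; split => //; exact: ltW.
have [S1 S2] := IH (ltnW kN).
have a0 := dt_ge0 kN.
rewrite [S k.+1]big_ord_recr/= -/(S k).
have le_V : step_energy k w <= step_energy k.+1 w by exact: energy_le.
rewrite /z; case: ifPn => Vd; last first.
  by rewrite expr0n/= mulr0 addr0; split => //; exact: le_trans le_V.
have zk : (tau k.+1 - tau k) * eta k w r c ^+ 2 <= `|eta k w| ^+ 2 * (tau k.+1
  - tau k).
  rewrite mulrC ler_wpM2r// -(real_normK (num_real (eta k w r c))).
  by rewrite lerXn2r ?nnegrE//; exact: ler_mx_norm.
have S3 : S k + (tau k.+1 - tau k) * eta k w r c ^+ 2 <= step_energy k.+1 w.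
  by rewrite energyS lerD.
by split => //; apply: le_trans S3 (ltW Vd).
Qed.

Let W r c w := \sum_(i < N) z r c i w * bm_incr B (tau i) (tau i.+1) c w.

Let W_mfun r c : mfun_wrt (F (tau N)) (W r c).
Proof. by case: (step_integral_sqr_le FF BB tau0 tauS c (z_mfun r c) (z_bounded
  r c)). Qed.

Let W_measurable r c : measurable_fun setT (W r c).
Proof.
exact: (mfun_wrt_measurable (filtration_sigma FF (tau_ge0 (leqnn N)))
  (filtration_measurable FF (tau_ge0 (leqnn N))) (W_mfun r c)).
Qed.

(** [z_energy] holds path by path, so the sum of expectations is gathered under one integral before
    it is bounded. *)
Let W_sqr_le r c : (\int[P]_w (W r c w ^+ 2)%:E <= (8 * delta)%:E)%E.
Proof.
have [_] := step_integral_sqr_le FF BB tau0 tauS c (z_mfun r c) (z_bounded r c).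
move=> /le_trans; apply.
have mzT (i : 'I_N) : measurable_fun setT (z r c i).
  have iN := tau_ge0 (ltnW (ltn_ord i)).
  exact: (mfun_wrt_measurable (filtration_sigma FF iN) (filtration_measurable
    FF iN)
    (z_mfun r c (ltn_ord i))).
under eq_bigr => i _.
  rewrite -ge0_integralZl//; last 3 first.
  - by apply/measurable_EFinP; exact: measurable_funX.
  - by move=> w _; rewrite lee_fin sqr_ge0.
  - by rewrite lee_fin mulr_ge0// dt_ge0.
  over.
rewrite -ge0_integral_sum//; last 2 first.
- move=> i; apply: measurable_funeM; apply/measurable_EFinP;
    exact: measurable_funX.
- by move=> i w _; rewrite mule_ge0// lee_fin ?sqr_ge0// mulr_ge0// dt_ge0.
apply: (@le_trans _ _ (\int[P]_w (8 * delta)%:E)%E); last first.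
  by rewrite integral_cst//= probability_setT mule1.
apply: ge0_le_integral => //.
- move=> w _; apply: sume_ge0 => i _.
  by rewrite mule_ge0// lee_fin ?sqr_ge0// mulr_ge0// dt_ge0.
- apply: emeasurable_sum => i; apply: measurable_funeM; apply/measurable_EFinP;
    exact: measurable_funX.
- move=> w _; under eq_bigr do rewrite -EFinM.
  rewrite sumEFin lee_fin; under eq_bigr do rewrite -mulrA.
  by rewrite -mulr_sumr ler_pM2l// z_energy.
Qed.

(** Where the energy stays below delta, the stopped and the original integrals coincide. The stopped
    one is controlled entry by entry with Chebyshev's inequality, and the factor n * n is the union
    bound over the entries of the integrand. *)
Lemma step_integral_prob_le :
  (P [set w | (eps <= `|\sum_(i < N) eta i w *m (B (tau i.+1) w - B (tau i)
    w)|)%R] <=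
   P [set w | (delta <= step_energy N w)%R] +
     ((8 * delta) / (eps / n.+1%:R) ^+ 2 *+ (n * n))%:E)%E.
Proof.
pose I w := \sum_(i < N) eta i w *m (B (tau i.+1) w - B (tau i) w).
(* A row is a sum of n scalar integrals; n.+1 instead of n makes the total strictly smaller than eps
   and avoids a zero denominator. *)
have n0 : 0 < eps / n.+1%:R by rewrite divr_gt0.
pose D (p : 'I_n * 'I_n) := [set w | eps / n.+1%:R <= `|W p.1 p.2 w|].
have mD p : measurable (D p).
  rewrite /D (_ : [set _ | _] = (fun w => `|W p.1 p.2 w|) @^-1` `[eps /
    n.+1%:R, +oo[); last first.
    by apply/seteqP; split => w /=; rewrite in_itv/= andbT.
  have mW : measurable_fun setT (fun w => `|W p.1 p.2 w|) by exact:
    measurableT_comp.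
  by rewrite -[X in measurable X]setTI; apply: mW.
have mV : measurable [set w | delta <= step_energy N w].
  rewrite (_ : [set _ | _] = step_energy N @^-1` `[delta, +oo[); last first.
    by apply/seteqP; split => w /=; rewrite in_itv/= andbT.
  have mV : measurable_fun setT (step_energy N).
    apply: (mfun_wrt_measurable (filtration_sigma FF (tau_ge0 (leqnn N)))
      (filtration_measurable FF (tau_ge0 (leqnn N)))).
    by apply: step_energy_mfun => // j jN; split => //; exact: ltnW.
  by rewrite -[X in measurable X]setTI; apply: mV.
have IE w r : I w r ord0 = \sum_c \sum_(i < N) eta i w r c * bm_incr B (tau i)
  (tau i.+1) c w.
  rewrite /I summxE exchange_big/=; apply: eq_bigr => i _.
  by rewrite mxE; apply: eq_bigr => c _; rewrite !mxE.
have mI : measurable [set w | eps <= `|I w|].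
  rewrite (_ : [set _ | _] = (fun w => `|I w|) @^-1` `[eps, +oo[); last first.
    by apply/seteqP; split => w /=; rewrite in_itv/= andbT.
  have mI : measurable_fun setT (fun w => `|I w|).
    apply: measurable_mx_norm => r c; rewrite ord1.
    rewrite (_ : (fun _ => _) = (fun w => \sum_c \sum_(i < N) eta i w r c *
      bm_incr B (tau i) (tau i.+1) c w)); last by apply/funext => w; rewrite IE.
    apply: measurable_sum => c'; apply: measurable_sum => i.
    have iN := tau_ge0 (ltnW (ltn_ord i)).
    apply: measurable_funM.
      apply: (mfun_wrt_measurable (filtration_sigma FF iN)
        (filtration_measurable FF iN)).
      have /(measurable_wrt_coordP _ (filtration_sigma FF iN)) := meta (ltn_ord
        i); exact.
    exact: (bm_incr_measurable FF BB _ iN (tauS (ltn_ord i))).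
  by rewrite -[X in measurable X]setTI; apply: mI.
have sub : [set w | eps <= `|I w|] `<=`
    [set w | delta <= step_energy N w] `|` [set w | exists p, D p w].
  move=> w /= Iw; have [Vd|Vd] := leP delta (step_energy N w); first by left.
  right; apply: contrapT => /forallNP noD.
  move: Iw; apply/negP; rewrite -ltNge mx_norm_lt//.
  apply/forallP => r; apply/forallP => c0; rewrite ord1 IE.
  rewrite (eq_bigr (fun c => W r c w)); last first.
    move=> c _; apply: eq_bigr => i _; congr (_ * _).
    by rewrite /z ifT//; apply: le_lt_trans Vd; exact: energy_le.
  apply: le_lt_trans (ler_norm_sum _ _ _) _.
  apply: (@le_lt_trans _ _ (\sum_(c < n) eps / n.+1%:R)).
    by apply: ler_sum => c _; have /negP := noD (r, c); rewrite -ltNge => /ltW.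
  rewrite sumr_const card_ord -[X in X < _]mulr_natr mulrAC -mulrA gtr_pMr//.
  by rewrite ltr_pdivrMr// mul1r ltr_nat.
have mE : measurable [set w | exists p, D p w].
  rewrite (_ : [set _ | _] = \big[setU/set0]_p D p); first exact:
    bigsetU_measurable.
  rewrite -bigcup_seq; apply/seteqP; split => w /=.
    by move=> [i Aw]; exists i => //=; rewrite mem_index_enum.
  by move=> [i _ Aw]; exists i.
apply: (@le_trans _ _ (P ([set w | delta <= step_energy N w] `|` [set w |
  exists p, D p w]))).
  by apply: le_measure => //; rewrite inE//; exact: measurableU.
apply: le_trans (measureU2 _ _ _) _ => //.
apply: leeD2l; apply: le_trans (probability_exists_le mD) _.
rewrite (_ : _ *+ (n * n) = \sum_(p : 'I_n * 'I_n) (8 * delta / (eps / n.+1%:R)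
  ^+ 2)); last first.
  by rewrite sumr_const card_prod card_ord.
rewrite -sumEFin; apply: lee_sum => p _.
exact: sqr_markov.
Qed.

End simple_estimate.

(** * Comparison of an Ito integral with that of a constant matrix *)

Section ito_distance.
Context (R : realType) (disp : measure_display) (Omega : measurableType disp).
Variables (P : probability Omega R) (F : R -> set (set Omega)) (n : nat).
Variable B : R -> Omega -> 'cV[R]_n.
Hypotheses (FF : filtration F) (BB : brownian_motion P F B).
Hypothesis P_complete : measure_is_complete P.

Lemma ae_le_probability (A D : set Omega) : measurable A -> measurable D ->
  {ae P, forall w, A w -> D w} -> (P A <= P D)%E.
Proof.
move=> mA mD AD.
have mN : measurable (~` [set w | A w -> D w]) by exact: P_complete.
have N0 : P (~` [set w | A w -> D w]) = 0%E by exact: measure_negligible.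
apply: (@le_trans _ _ (P (D `|` ~` [set w | A w -> D w]))).
  apply: le_measure; rewrite ?inE//; first exact: measurableU.
  move=> w Aw; have [Dw|Dw] := pselect (D w); first by left.
  by right => /= /(_ Aw).
by apply: le_trans (measureU2 P mD mN) _; rewrite [X in (_ + X)%E]N0 adde0.
Qed.

Section simple_process_facts.
Variables (t : R) (K : simple_process F n t).

Lemma sp_time_le i j : (i <= j)%N -> (j <= sp_size K)%N -> sp_time K i <=
  sp_time K j.
Proof.
elim: j => [|j IH]; first by rewrite leqn0 => /eqP ->.
rewrite leq_eqVlt => /predU1P[-> //|]; rewrite ltnS => ij jN.
exact: le_trans (IH ij (ltnW jN)) (sp_time_mono jN).
Qed.

Lemma sp_time_ge0 i : (i <= sp_size K)%N -> 0 <= sp_time K i.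
Proof. by move=> iN; rewrite -(sp_time_first K) sp_time_le. Qed.

Lemma sp_coef_mfun i r c : (i < sp_size K)%N ->
  measurable_fun setT (fun w => sp_coef K i w r c).
Proof.
move=> iN; have t0 := sp_time_ge0 (ltnW iN).
apply: (mfun_wrt_measurable (filtration_sigma FF t0) (filtration_measurable FF
  t0)).
have /(measurable_wrt_coordP _ (filtration_sigma FF t0)) := sp_coef_measurable
  iN; exact.
Qed.

Lemma sp_eval_joint r c :
  measurable_fun setT (fun p : R * Omega => sp_eval K p.1 p.2 r c).
Proof.
rewrite (_ : (fun _ => _) = (fun p : R * Omega =>
  \sum_(i < sp_size K) \1_(`]sp_time K i, sp_time K i.+1] : set R) p.1 *
     sp_coef K i p.2 r c)); last first.
  by apply/funext => p; rewrite /sp_eval summxE; apply: eq_bigr => i _;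
    rewrite mxE.
apply: measurable_sum => i; apply: measurable_funM.
  have m1 : measurable_fun setT (\1_(`]sp_time K i, sp_time K i.+1] : set R) :
    R -> R).
    exact: measurable_indic.
  exact: (measurableT_comp m1 measurable_fst).
exact: (measurableT_comp (sp_coef_mfun r c (ltn_ord i)) measurable_snd).
Qed.

Lemma sp_eval_itv i s w : (i < sp_size K)%N ->
  sp_time K i < s <= sp_time K i.+1 -> sp_eval K s w = sp_coef K i w.
Proof.
move=> iN si; rewrite /sp_eval (bigD1 (Ordinal iN))//= indicE mem_set/=
  ?in_itv//.
rewrite scale1r big1 ?addr0// => j ji.
rewrite indicE memNset ?scale0r// /= in_itv/=.
move: si => /andP[si1 si2] /andP[sj1 sj2].
have : (j : nat) != i by apply: contra ji => /eqP ji; apply/eqP/val_inj.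
rewrite neq_ltn => /orP[jlt|ilt].
  have := sp_time_le jlt (ltnW iN); lra.
have := sp_time_le ilt (ltnW (ltn_ord j)); lra.
Qed.

Lemma sp_itvN s i : (i < sp_size K)%N -> ~~ (sp_time K i < s <= sp_time K i.+1)
  ->
  (\1_(`]sp_time K i, sp_time K i.+1] : set R) s : R) = 0.
Proof. by move=> iN si; rewrite indicE memNset//= in_itv/=; apply/negP. Qed.

(** The energy of the coefficients minus [S] is the integral of a step function, and on each cell |K
    - S|^2 <= 2 |K - h|^2 + 2 |S - h|^2. *)
Lemma sp_energy_le (S : 'M[R]_n) (h : R -> 'M[R]_n) w :
  {within `[0, +oo[, continuous h} ->
  ((step_energy (sp_time K) (fun i w => (sp_coef K i w - S)%R) (sp_size K)
    w)%:E <=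
  2%:E * \int[lebesgue_measure]_(s in `[0%R, t]) ((`|sp_eval K s w - h s| ^+
    2)%R)%:E +
  2%:E * \int[lebesgue_measure]_(s in `[0%R, t]) ((`|S - h s| ^+ 2)%R)%:E)%E.
Proof.
move=> ch.
pose h' (s : R) := h (Num.max s 0).
have mh r c : measurable_fun setT (fun s : R => h' s r c).
  apply: continuous_measurable_fun => s.
  apply: (@continuous_comp _ _ _ h' (fun x : 'M[R]_n => x r c)).
    exact: (within_continuous_max ch).
  exact: coord_continuous.
have hE s : `[0, t]%classic s -> h s = h' s.
  by rewrite /= in_itv/= => /andP[s0 _]; rewrite /h' max_l.
have mK r c : measurable_fun setT (fun s : R => sp_eval K s w r c).
  exact: (measurableT_comp (sp_eval_joint r c) (pair2_measurable w)).
have m1 : measurable_fun `[0, t] (fun s : R => (`|sp_eval K s w - h s| ^+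
  2)%:E).
  apply: (@eq_measurable_fun _ _ _ _ _ (fun s : R => (`|sp_eval K s w - h' s|
    ^+ 2)%:E)).
    by move=> s; rewrite inE => /hE ->.
  apply: measurable_funTS; apply/measurable_EFinP; apply: measurable_funX.
  apply: measurable_mx_norm => r c.
  rewrite (_ : (fun _ => _) = (fun s : R => sp_eval K s w r c) \- (fun s : R =>
    h' s r c)).
    by apply: measurable_funB.
  by apply/funext => s /=; rewrite !mxE.
have m2 : measurable_fun `[0, t] (fun s : R => (`|S - h s| ^+ 2)%:E).
  apply: (@eq_measurable_fun _ _ _ _ _ (fun s : R => (`|S - h' s| ^+ 2)%:E)).
    by move=> s; rewrite inE => /hE ->.
  apply: measurable_funTS; apply/measurable_EFinP; apply: measurable_funX.
  apply: measurable_mx_norm => r c.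
  rewrite (_ : (fun _ => _) = (cst (S r c)) \- (fun s : R => h' s r c)).
    by apply: measurable_funB.
  by apply/funext => s /=; rewrite !mxE.
rewrite -!ge0_integralZl//; try by move=> s _; rewrite lee_fin sqr_ge0.
rewrite -ge0_integralD//; first last.
- exact: measurable_funeM.
- exact: measurable_funeM.
pose I i : set R := `]sp_time K i, sp_time K i.+1]%classic.
have m1I i : measurable_fun `[0, t] (fun s : R => (\1_(I i) s)%:E : \bar R).
  by apply/measurable_EFinP; apply: measurable_indic; rewrite /I.
have IE : (step_energy (sp_time K) (fun i w => (sp_coef K i w - S)%R) (sp_size
  K) w)%:E =
  (\int[lebesgue_measure]_(s in `[0%R, t]) (\sum_(i < sp_size K)
      (`|(sp_coef K i w - S)%R| ^+ 2)%:E * (\1_(I i) s)%:E))%E.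
  rewrite ge0_integral_sum//; last first.
    by move=> i; apply: measurable_funeM; exact: m1I.
  rewrite /step_energy -sumEFin; apply: eq_bigr => i _.
  rewrite ge0_integralZl//; last first.
    exact: m1I.
  rewrite integral_indic//=; last by rewrite /I.
  rewrite setIidl; last first.
    move=> s; rewrite /I /= !in_itv/= => /andP[s1 s2]; apply/andP; split.
      by apply: ltW; apply: le_lt_trans s1; exact: sp_time_ge0 (ltnW (ltn_ord
        i)).
    by apply: (le_trans s2); rewrite -[leRHS](sp_time_last K);
      exact: sp_time_le.
  rewrite /I lebesgue_measure_itv/= lte_fin EFinM.
  case: ltP => [//|le_t].
  have -> : sp_time K i.+1 = sp_time K i.
    by apply/eqP; rewrite eq_le le_t sp_time_mono.
  by rewrite subrr.
rewrite IE; apply: ge0_le_integral => //.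
- by move=> s _; apply: sume_ge0 => i _; rewrite mule_ge0// lee_fin ?sqr_ge0.
- apply: emeasurable_sum => i; apply: measurable_funeM; exact: m1I.
- by apply: emeasurable_funD; exact: measurable_funeM.
move=> s _.
under eq_bigr do rewrite -EFinM.
rewrite sumEFin -!EFinM -EFinD lee_fin.
have H0 : 0 <= 2 * `|sp_eval K s w - h s| ^+ 2 + 2 * `|S - h s| ^+ 2.
  by rewrite addr_ge0// mulr_ge0// sqr_ge0.
have [[i si]|noi] := pselect (exists i : 'I_(sp_size K),
  sp_time K i < s <= sp_time K i.+1).
  rewrite (bigD1 i)//= big1; last first.
    move=> j ji; rewrite sp_itvN ?mulr0//; apply/negP => /andP[sj1 sj2].
    move: si => /andP[si1 si2].
    have : (j : nat) != i by apply: contra ji => /eqP ji; apply/eqP/val_inj.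
    rewrite neq_ltn => /orP[jlt|ilt].
      have := lt_le_trans (lt_le_trans si1 sj2) (sp_time_le jlt (ltnW (ltn_ord
        i))).
      by rewrite ltxx.
    have := lt_le_trans (lt_le_trans sj1 si2) (sp_time_le ilt (ltnW (ltn_ord
      j))).
    by rewrite ltxx.
  rewrite addr0 indicE mem_set/= ?in_itv// mulr1 -(sp_eval_itv w (ltn_ord i)
    si).
  set a := sp_eval K s w; set c := h s.
  have tri : `|a - S| <= `|a - c| + `|S - c|.
    have -> : a - S = (a - c) - (S - c) by rewrite opprB addrA subrK.
    exact: ler_normB.
  have : `|a - S| ^+ 2 <= (`|a - c| + `|S - c|) ^+ 2.
    by rewrite lerXn2r ?nnegrE// addr_ge0.
  have := sqr_ge0 (`|a - c| - `|S - c|); rewrite sqrrB sqrrD; lra.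
(* A time in no cell, such as 0, contributes nothing on the left. *)
rewrite big1// => i _; rewrite sp_itvN ?mulr0//.
by apply/negP => si; apply: noi; exists i.
Qed.

End simple_process_facts.

Variables (t : R) (H : R -> Omega -> 'M[R]_n) (Y : Omega -> 'cV[R]_n).
Hypothesis t0 : 0 <= t.
Hypothesis mH : forall s i j, 0 <= s -> measurable_fun setT (fun w => H s w i
  j).
Hypothesis cH : {ae P, forall w, {within `[0, +oo[, continuous (H ^~ w)}}.
Hypothesis HY : ito_integral P F B t H Y.

Lemma measurable_norm_ge (m k : nat) (f : Omega -> 'M[R]_(m, k)) (c : R) :
  (forall i j, measurable_fun setT (fun w => f w i j)) ->
  measurable [set w | c <= `|f w|].
Proof.
move=> mf; rewrite (_ : [set _ | _] = (fun w => `|f w|) @^-1` `[c, +oo[);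
  last first.
  by apply/seteqP; split => w /=; rewrite in_itv/= andbT.
rewrite -[X in measurable X]setTI.
by apply: (measurable_mx_norm mf).
Qed.

(** For an approximating simple process K, the process K - S is again a step process, with integral
    I(K) - S (B_t - B_0), and [step_integral_prob_le] applies to it. Half of eps pays for replacing
    Y by I(K). The events [D1 k] and [D2 k], where K is far from H or I(K) far from Y, disappear in
    the limit. *)
Lemma ito_distance_le (S : 'M[R]_n) (eps delta : R) : 0 < eps -> 0 < delta ->
  (P [set w | (eps <= `|Y w - S *m (B t w - B 0 w)|)%R] <=
   P [set w | ((delta / 4)%:E <=
       \int[lebesgue_measure]_(s in `[0%R, t]) ((`|S - H s w| ^+ 2)%R)%:E)%E] +
   ((8 * delta) / (eps / 2 / n.+1%:R) ^+ 2 *+ (n * n))%:E)%E.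
Proof.
move=> eps0 delta0.
have [mY [K [cvgK cvgI]]] := HY.
have mYr r : measurable_fun setT (fun w => Y w r ord0).
  apply: (mfun_wrt_measurable (filtration_sigma FF t0) (filtration_measurable
    FF t0)).
  by have /(measurable_wrt_coordP _ (filtration_sigma FF t0)) := mY; exact.
have mdB r : measurable_fun setT (fun w => (S *m (B t w - B 0 w)) r ord0).
  rewrite (_ : (fun _ => _) = (fun w => \sum_j S r j * bm_incr B 0 t j w)).
    apply: measurable_sum => j; apply: measurable_funM => //.
    exact: (bm_incr_measurable FF BB).
  by apply/funext => w; rewrite mxE; apply: eq_bigr => j _; rewrite !mxE.
pose A := [set w | eps <= `|Y w - S *m (B t w - B 0 w)|].
have mA : measurable A.
  apply: measurable_norm_ge => r c; rewrite ord1.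
  rewrite (_ : (fun _ => _) = (fun w => Y w r ord0) \- (fun w => (S *m (B t w -
    B 0 w)) r ord0)).
    exact: measurable_funB.
  by apply/funext => w; rewrite /= !mxE.
pose D := [set w | ((delta / 4)%:E <=
   \int[lebesgue_measure]_(s in `[0%R, t]) ((`|S - H s w| ^+ 2)%R)%:E)%E].
have mD : measurable D.
  rewrite -[D]setTI; apply: emeasurable_fun_c_infty => //.
  exact: (@measurable_integral_sqr _ _ _ P P_complete n t (fun _ _ => S) H).
pose D1 k := [set w | ((delta / 4)%:E <=
   \int[lebesgue_measure]_(s in `[0%R, t]) ((`|sp_eval (K k) s w - H s w| ^+
     2)%R)%:E)%E].
have mD1 k : measurable (D1 k).
  rewrite -[D1 k]setTI; apply: emeasurable_fun_c_infty => //.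
  apply: (@measurable_integral_sqr _ _ _ P P_complete n t (sp_eval (K k)) H) =>
    // i j.
  exact: sp_eval_joint.
pose D2 k := [set w | ((eps / 2)%:E <= (`|sp_integral B (K k) w - Y w|)%:E)%E].
pose eta k i w := sp_coef (K k) i w - S.
pose I k w := \sum_(i < sp_size (K k))
   eta k i w *m (B (sp_time (K k) i.+1) w - B (sp_time (K k) i) w).
(* The part with the constant coefficient [S] telescopes. *)
have IE k w : I k w = sp_integral B (K k) w - S *m (B t w - B 0 w).
  rewrite /I /eta; under eq_bigr do rewrite mulmxBl.
  rewrite big_split/= sumrN -mulmx_sumr; congr (_ - S *m _).
  rewrite -(big_mkord xpredT (fun i => B (sp_time (K k) i.+1) w - B (sp_time (K
    k) i) w)).
  by rewrite (telescope_sumr (fun i => B (sp_time (K k) i) w))// sp_time_last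
    sp_time_first.
have meta k i : (i < sp_size (K k))%N -> measurable_wrt (F (sp_time (K k) i))
  (eta k i).
  move=> iN; have sG := filtration_sigma FF (sp_time_ge0 (ltnW iN)).
  apply/(measurable_wrt_coordP _ sG) => r c.
  rewrite (_ : (fun _ => _) = (fun w => sp_coef (K k) i w r c) \- cst (S r c)).
    apply: measurable_funB => //.
    by have /(measurable_wrt_coordP _ sG) := sp_coef_measurable iN; exact.
  by apply/funext => w; rewrite /= !mxE.
have Ir k w r : I k w r ord0 = \sum_c \sum_(i < sp_size (K k))
    eta k i w r c * bm_incr B (sp_time (K k) i) (sp_time (K k) i.+1) c w.
  rewrite /I summxE exchange_big/=; apply: eq_bigr => i _.
  by rewrite mxE; apply: eq_bigr => c _; rewrite !mxE.
have mIr k r : measurable_fun setT (fun w => I k w r ord0).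
  rewrite (_ : (fun _ => _) = (fun w => \sum_c \sum_(i < sp_size (K k))
    eta k i w r c * bm_incr B (sp_time (K k) i) (sp_time (K k) i.+1) c w)).
    apply: measurable_sum => c; apply: measurable_sum => i.
    have iN := sp_time_ge0 (ltnW (ltn_ord i)).
    apply: measurable_funM.
      apply: (mfun_wrt_measurable (filtration_sigma FF iN)
        (filtration_measurable FF iN)).
      by have /(measurable_wrt_coordP _ (filtration_sigma FF iN)) := meta k i
        (ltn_ord i); exact.
    exact: (bm_incr_measurable FF BB _ iN (sp_time_mono (ltn_ord i))).
  by apply/funext => w; rewrite Ir.
have mD2 k : measurable (D2 k).
  rewrite /D2 (_ : [set _ | _] = [set w | eps / 2 <= `|sp_integral B (K k) w -
    Y w|]).
    apply: measurable_norm_ge => r c; rewrite ord1.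
    rewrite (_ : (fun _ => _) = (fun w => I k w r ord0 + (S *m (B t w - B 0 w))
      r ord0) \-
       (fun w => Y w r ord0)).
      by apply: measurable_funB => //; exact: measurable_funD.
    by apply/funext => w; rewrite /= IE !mxE subrK.
  by apply/seteqP; split => w /=; rewrite lee_fin.
pose V k w := step_energy (sp_time (K k)) (eta k) (sp_size (K k)) w.
have mV k : measurable [set w | delta <= V k w].
  rewrite (_ : [set _ | _] = V k @^-1` `[delta, +oo[); last first.
    by apply/seteqP; split => w /=; rewrite in_itv/= andbT.
  have N0 := sp_time_ge0 (leqnn (sp_size (K k))).
  have mV : measurable_fun setT (V k).
    apply: (mfun_wrt_measurable (filtration_sigma FF N0) (filtration_measurable
      FF N0)).
    apply: (step_energy_mfun FF (N := sp_size (K k)) (sp_time_first (K k))) =>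
      //.
    - by move=> i; exact: sp_time_mono.
    - by move=> i; exact: meta.
    - by move=> j jN; split => //; exact: ltnW.
  by rewrite -[X in measurable X]setTI; apply: mV.
pose c : R := (8 * delta) / (eps / 2 / n.+1%:R) ^+ 2 *+ (n * n).
rewrite -/A -/D -/c.
have bound k : (P A <= (P D + c%:E) + (P (D2 k) + P (D1 k)))%E.
  have sub : A `<=` D2 k `|` [set w | eps / 2 <= `|I k w|].
    move=> w /= Aw; rewrite /D2 /=.
    have [h|h] := leP (eps / 2) `|sp_integral B (K k) w - Y w|; first by left;
      rewrite lee_fin.
    right; rewrite leNgt; apply/negP => h2.
    suff : `|Y w - S *m (B t w - B 0 w)| < eps by rewrite ltNge Aw.
    have -> : Y w - S *m (B t w - B 0 w) = I k w - (sp_integral B (K k) w - Y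
      w).
      by rewrite IE opprB [RHS]addrC addrA subrK.
    by apply: le_lt_trans (ler_normB _ _) _; rewrite (splitr eps) ltrD.
  have mI : measurable [set w | eps / 2 <= `|I k w|].
    by apply: measurable_norm_ge => r c0; rewrite ord1.
  have h1 : (P A <= P (D2 k) + P [set w | (eps / 2 <= `|I k w|)%R])%E.
    apply: le_trans (measureU2 P (mD2 k) mI).
    by apply: le_measure => //; rewrite inE//; exact: measurableU.
  have [C etaC] := sp_coef_bounded (K k).
  have h2 : (P [set w | (eps / 2 <= `|I k w|)%R] <= P [set w | (delta <= V k
    w)%R] + c%:E)%E.
    apply: (@step_integral_prob_le _ _ _ P F n B FF BB (sp_size (K k)) (sp_time
      (K k))
      (eta k) (C + `|S|)) => //.
    - exact: sp_time_first.
    - by move=> i; exact: sp_time_mono.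
    - by move=> i; exact: meta.
    - move=> i w iN; apply: le_trans (ler_normB _ _) _; rewrite lerD2r;
        exact: etaC.
    - by rewrite divr_gt0.
  (* By [sp_energy_le], if both integrals were below delta / 4 the energy would be below 2 (delta /
     4) + 2 (delta / 4) = delta. *)
  have h3 : (P [set w | (delta <= V k w)%R] <= P (D1 k) + P D)%E.
    apply: le_trans (measureU2 P (mD1 k) mD).
    apply: ae_le_probability => //; first exact: measurableU.
    apply: filterS cH => w cw Vw.
    have := sp_energy_le (K k) S w cw.
    rewrite -/(eta k) -/(V k w) => Vle.
    rewrite /D1 /D /=.
    apply: contrapT => /not_orP[/negP + /negP]; rewrite -!ltNge => l1 l2.
    have Vd : (delta%:E <= (V k w)%:E)%E by rewrite lee_fin.
    move: (le_trans Vd Vle).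
    apply/negP; rewrite -ltNge.
    have -> : delta%:E = (2%:E * (delta / 4)%:E + 2%:E * (delta / 4)%:E)%E.
      by rewrite -!EFinM -EFinD; congr EFin; field.
    by apply: lteD; rewrite lte_pmul2l.
  apply: le_trans h1 _; rewrite addeC -addeA.
  apply: (@le_trans _ _ (P (D1 k) + P D + c%:E + P (D2 k))%E).
    by apply: leeD2r; apply: le_trans h2 _; exact: leeD2r.
  by rewrite [leLHS]addeC addeA [leRHS]addeC -!addeA; apply: leeD2l;
    rewrite addeCA; apply: leeD2l; rewrite addeC.
have cD2 : P (D2 k) @[k --> \oo] --> 0%E by apply: cvgI; rewrite divr_gt0.
have cD1 : P (D1 k) @[k --> \oo] --> 0%E by apply: cvgK; rewrite divr_gt0.
have cv : ((P D + c%:E) + (P (D2 k) + P (D1 k)))%E @[k --> \oo] -->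
    (P D + c%:E + (0 + 0))%E.
  by apply: cvgeD; [rewrite adde0 fin_num_adde_defl|exact: cvg_cst|apply:
    cvgeD].
rewrite !adde0 in cv.
by apply: (cvge_ge _ cv); exact: nearW.
Qed.

End ito_distance.

(** * Linear Volterra equations and Riemann sums *)

Section continuous_integrals.
Variable R : realType.
Local Notation mu := (@lebesgue_measure R).
Implicit Types (f g c y : R -> R) (a b t e : R).

Lemma continuous_integrable f a b : continuous f ->
  mu.-integrable `[a, b] (EFin \o f).
Proof.
move=> cf; apply: continuous_compact_integrable; first exact: segment_compact.
exact: continuous_subspaceT.
Qed.

Lemma Rintegral_avg_le f e : continuous f -> 0 < e ->
  \forall t \near 0^'+, `|\int[mu]_(s in `[0%R, t]) f s - t * f 0| <= e * t.
Proof.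
move=> cf e0.
have /cvgrPdist_lt /(_ _ e0) [r /= r0 rf] := cf 0.
near=> t.
have t0 : 0 < t by [].
have tr : t < r by near: t; exact: nbhs_right_lt.
have E : \int[mu]_(s in `[0%R, t]) (cst (f 0) s) = t * f 0.
  by rewrite Rintegral_cst//= lebesgue_measure_itv/= lte_fin t0 oppr0 adde0
    mulrC.
have i1 := @continuous_integrable f 0 t cf.
have cc : continuous (cst (f 0) : R -> R) by move=> x; exact: cst_continuous.
have i2 := @continuous_integrable _ 0 t cc.
have cd : continuous (f \- cst (f 0)) by move=> x; apply: cvgB;
  [exact: cf|exact: cc].
have i3 := @continuous_integrable _ 0 t cd.
rewrite -E -RintegralB//.
apply: le_trans (le_normr_Rintegral _ i3) _ => //.
have Ee : \int[mu]_(s in `[0%R, t]) (cst e s) = e * t.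
  by rewrite Rintegral_cst//= lebesgue_measure_itv/= lte_fin t0 oppr0 adde0
    mulrC.
rewrite -Ee; apply: le_Rintegral => //.
- by apply: integrable_norm.
- by apply: continuous_integrable => x; exact: cst_continuous.
move=> s /=; rewrite in_itv/= => /andP[s0 st]; rewrite distrC ltW//.
by apply: rf => /=; rewrite sub0r normrN ger0_norm// (le_lt_trans st).
Unshelve. all: by end_near. Qed.

Lemma continuous_unif_segment f t e : continuous f -> 0 < e ->
  \forall d \near 0^'+, forall x, x \in `[0, t] -> forall x', `|x - x'| < d ->
    `|f x - f x'| < e.
Proof.
move=> cf e0.
have /compact_near_coveringP := @segment_compact R 0 t.
move=> /(_ R 0^'+ (fun d x => forall x', `|x - x'| < d -> `|f x - f x'| < e)) H.
have : \forall d \near 0^'+, `[0, t] `<=` [set x | forall x',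
  `|x - x'| < d -> `|f x - f x'| < e].
  apply: H => x _.
  have e20 : 0 < e / 2 by rewrite divr_gt0.
  have /cvgrPdist_lt /(_ _ e20) [r /= r0 rf] := cf x.
  have r20 : 0 < r / 2 by rewrite divr_gt0.
  near=> z d => x' zx'.
  have xz : `|x - z| < r / 2.
    near: z. by apply: nbhsx_ballx.
  have dr : d < r / 2 by near: d; exact: nbhs_right_lt.
  have xx' : `|x - x'| < r.
    rewrite (splitr r) -(subrK z x) -addrA; apply: le_lt_trans (ler_normD _ _)
      _.
    by rewrite ltrD// (lt_trans zx').
  rewrite (splitr e) -(subrK (f x) (f z)) -addrA; apply: le_lt_trans (ler_normD
    _ _) _.
  rewrite ltrD//; first by rewrite distrC; apply: rf; apply: (lt_trans xz); lra.
  exact: rf.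
by apply: filterS => d H' x xt; apply: H'; rewrite /= in xt *.
Unshelve. all: by end_near. Qed.

Lemma derive_integral f t : continuous f -> 0 < t ->
  is_derive t (1 : R) (fun t => \int[mu]_(s in `[0%R, t]) f s) (f t).
Proof.
move=> cf t0.
have tt : t < t + 1 by rewrite ltrDl.
have [d1 d2] := @continuous_FTC1_closed R f 0 t (t + 1) tt
  (@continuous_integrable f 0 (t + 1) cf) t0 (cf t).
by split; [exact: d1|rewrite -derive1E; exact: d2].
Qed.

Lemma within_continuous_integral f t : continuous f -> 0 <= t ->
  {within `[0, t], continuous (fun t => \int[mu]_(s in `[0%R, t]) f s)}.
Proof.
move=> cf t0; apply: parameterized_integral_continuous => //.
exact: continuous_integrable.
Qed.

Lemma is_derive_expRM (b u : R) :
  is_derive u (1 : R) (fun s => expR (b * s)) (b * expR (b * u)).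
Proof.
have h : is_derive u (1 : R) (b \*: (id : R -> R)) b.
  by move: (is_deriveZ b (is_derive_id u (1 : R))) => /is_derive_eq; apply;
    rewrite /GRing.scale/= mulr1.
have := @is_derive1_comp R expR (b \*: (id : R -> R)) u (expR (b * u)) b
  (is_derive_expR (b * u)) h.
by rewrite mulrC.
Qed.

Lemma continuous_expRM (b : R) : continuous (fun s : R => expR (b * s)).
Proof.
move=> u; apply: (@continuous_comp _ _ _ (fun s : R => b * s) expR).
  exact: mulrl_continuous.
exact: continuous_expR.
Qed.

(** For c 0 = 0 this is the integral of e^(b (t - s)) dc(s) over [0, t] after integration by parts,
    a form that makes sense for a merely continuous c such as a Brownian path. *)
Definition exp_convolution (b : R) c t : R :=
  c t + b * \int[mu]_(s in `[0%R, t]) (expR (b * (t - s)) * c s).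

Lemma exp_convolutionE (b : R) c t : continuous c ->
  exp_convolution b c t =
  c t + b * (expR (b * t) * \int[mu]_(s in `[0%R, t]) (expR ((- b) * s) * c s)).
Proof.
move=> cc; rewrite /exp_convolution; congr (_ + _ * _).
rewrite -RintegralZl//; last first.
  apply: continuous_integrable => u; apply: cvgM; last exact: cc.
  exact: continuous_expRM.
apply: eq_Rintegral => s _; rewrite mulrA -expRD; congr (expR _ * _); ring.
Qed.

(** Neither y nor c need be differentiable, but the integral G of y is, and it solves the linear
    equation G' = b G + x + c. *)
Lemma linear_volterra (b x : R) c y t : continuous c -> continuous y -> b != 0
  ->
  (forall u, 0 <= u -> y u = x + c u + b * \int[mu]_(s in `[0%R, u]) y s) ->
  0 <= t -> y t = expR (b * t) * x + exp_convolution b c t.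
Proof.
move=> cc cy b0 yE; rewrite le_eqVlt => /predU1P[<-|t0].
  rewrite yE// /exp_convolution set_itv1 !Rintegral_set1 !mulr0 expR0; ring.
pose G u := \int[mu]_(s in `[0%R, u]) y s.
(* The integrating factor makes H a primitive of exp (- b u) c u. *)
pose H (u : R) : R := expR ((- b) * u) * (G u + x / b).
pose h (u : R) : R := expR ((- b) * u) * c u.
have dH (u : R) : 0 < u -> is_derive u (1 : R) H (h u).
  move=> u0.
  have dG : is_derive u (1 : R) G (y u) by exact: derive_integral.
  have := @is_deriveM _ _ _ _ _ _ _ _ (is_derive_expRM (- b) u) (is_deriveD dG
    (is_derive_cst (x / b) u 1)).
  move/is_derive_eq; apply.
  rewrite /h yE ?ltW// -/(G u) /GRing.scale/=.
  by rewrite -[(G + cst (x / b)) u]/(G u + x / b); field.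
have ch : continuous h.
  by move=> u; apply: cvgM; [exact: continuous_expRM|exact: cc].
have cH : {within `[0, t], continuous H}.
  have cG := within_continuous_integral cy (ltW t0).
  move=> u; apply: cvgM.
    by apply: continuous_subspaceT; exact: continuous_expRM.
  by apply: cvgD; [exact: cG|exact: cvg_cst].
have FTC := @continuous_FTC2 R h H 0 t t0 (continuous_subspaceT ch).
have /FTC {}FTC : derivable_oo_LRcontinuous H 0 t.
  have /(continuous_within_itvP _ t0)[_ c0 ct] := cH.
  split => // u; rewrite in_itv/= => /andP[u0 _].
  by have [] := dH u u0.
have /FTC {}FTC : {in `]0, t[, derive1 H =1 h}.
  move=> u; rewrite in_itv/= => /andP[u0 _].
  by rewrite derive1E; have [_ ->] := dH u u0.
have {}FTC : \int[mu]_(s in `[0%R, t]) h s = H t - H 0.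
  by rewrite /Rintegral FTC.
rewrite exp_convolutionE// FTC.
have G0 : G 0 = 0 by rewrite /G set_itv1 Rintegral_set1.
rewrite yE ?ltW// -/(G t) /H G0 mulr0 expR0 mul1r add0r mulrBr mulrA -expRD
  mulNr subrr expR0 mul1r.
by field.
Qed.

Lemma affine_volterra (a b x : R) c y t : continuous c -> continuous y ->
  (forall u, 0 <= u -> y u = x + c u + \int[mu]_(s in `[0%R,
    u]) (a + b * y s)) ->
  0 <= t ->
  (b != 0 -> y t = expR (b * t) * x + exp_convolution b c t + (expR (b * t) -
    1) / b * a) /\
  (b = 0 -> y t = x + c t + t * a).
Proof.
move=> cc cy yE t0; split=> [b0|b0]; last first.
  rewrite yE//; congr (_ + _); rewrite b0.
  rewrite (@eq_Rintegral _ _ _ _ _ (cst a)); last by move=> s _;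
    rewrite mul0r addr0.
  rewrite Rintegral_cst//= lebesgue_measure_itv/= lte_fin mulrC.
  by case: ltP => h; rewrite ?oppr0 ?adde0//= ; have -> : t = 0 by
    apply/le_anti; rewrite h t0.
(* Translation by the equilibrium - a / b of the drift removes the constant term. *)
pose y' u := y u + a / b.
have cy' : continuous y' by move=> u; apply: cvgD; [exact: cy|exact: cvg_cst].
have := @linear_volterra b (x + a / b) c y' t cc cy' b0 _ t0.
have h u : 0 <= u -> y' u = x + a / b + c u + b * \int[mu]_(s in `[0%R,
  u]) y' s.
  move=> u0; rewrite /y' yE// -RintegralZl//; last exact: continuous_integrable.
  have -> : \int[mu]_(s in `[0%R, u]) (a + b * y s) =
      \int[mu]_(s in `[0%R, u]) (b * (y s + a / b)).
    by apply: eq_Rintegral => s _; field.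
  by ring.
move=> /(_ h) E; apply: (addIr (a / b)); rewrite -/(y' t) E; by field.
Qed.

End continuous_integrals.

(** * Riemann-Stieltjes sums against an exponential *)

Section riemann_sums.
Variable R : realType.
Local Notation mu := (@lebesgue_measure R).
Implicit Types (c : R -> R) (b t e : R).

Definition mesh t m i : R := t * i%:R / m.+1%:R.

Lemma mesh0 t m : mesh t m 0 = 0. Proof. by rewrite /mesh mulr0 mul0r. Qed.

Lemma mesh_last t m : mesh t m m.+1 = t.
Proof. by rewrite /mesh mulfK// pnatr_eq0. Qed.

Lemma meshS t m i : mesh t m i.+1 = mesh t m i + t / m.+1%:R.
Proof. by rewrite /mesh -natr1 mulrDr mulr1 mulrDl. Qed.

Lemma mesh_le t m i : 0 <= t -> mesh t m i <= mesh t m i.+1.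
Proof. by move=> t0; rewrite meshS lerDl divr_ge0. Qed.

Lemma mesh_itv t m i : 0 <= t -> (i <= m.+1)%N -> 0 <= mesh t m i <= t.
Proof.
move=> t0 im; rewrite /mesh divr_ge0 ?mulr_ge0//= ler_pdivrMr//.
by rewrite ler_wpM2l// ler_nat.
Qed.

Lemma mesh_small t d : 0 < d -> \forall m \near \oo, t / m.+1%:R < d.
Proof.
move=> d0.
have c0 : t * m.+1%:R^-1 @[m --> \oo] --> (t * 0 : R).
  by apply: cvgM; [exact: cvg_cst|exact: cvg_harmonic].
rewrite mulr0 in c0.
have /cvgrPdist_lt /(_ _ d0) := c0.
apply: filterS => m; rewrite sub0r normrN; apply: le_lt_trans; exact: ler_norm.
Qed.

Lemma mesh_unif (f : R -> R) t e : 0 <= t -> continuous f -> 0 < e ->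
  \forall m \near \oo, forall i s, (i < m.+1)%N ->
    mesh t m i <= s <= mesh t m i.+1 ->
    `|f s - f (mesh t m i)| < e /\ `|f s - f (mesh t m i.+1)| < e.
Proof.
move=> t0 cf e0.
have [d [d0 H]] : exists d : R, 0 < d /\ forall x, x \in `[0, t] ->
    forall x', `|x - x'| < d -> `|f x - f x'| < e.
  have nd : \forall d \near (0 : R)^'+, 0 < d by exact: nbhs_right_gt.
  by have [d []] := filter_ex (filterI nd (@continuous_unif_segment R f t e cf
    e0)); exists d.
near=> m => i s im /andP[s1 s2].
have md : t / m.+1%:R < d by near: m; exact: mesh_small.
have /andP[m0 _] := mesh_itv t0 (ltnW im).
have /andP[_ m1] := mesh_itv t0 im.
have st : s \in `[0, t] by rewrite in_itv/= (le_trans m0 s1) (le_trans s2 m1).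
have step : mesh t m i.+1 - mesh t m i < d by rewrite meshS addrC addKr.
split; apply: H => //.
  by rewrite ger0_norm ?subr_ge0//; apply: le_lt_trans step; rewrite lerD2r.
rewrite ler0_norm ?subr_le0// opprB; apply: le_lt_trans step.
by rewrite lerD2l lerN2.
Unshelve. all: by end_near. Qed.

(** The smoothness of the exponential replaces bounded variation of c: the differences are moved
    from c to the exponential. *)
Lemma riemann_sum_exp b c t : continuous c -> 0 <= t ->
  \sum_(i < m.+1) expR (b * (t - mesh t m i)) * (c (mesh t m i.+1) - c (mesh t
    m i))
    @[m --> \oo] --> exp_convolution b c t - expR (b * t) * c 0.
Proof.
move=> cc t0.
pose phi u : R := expR (b * (t - u)).
have phiE u : phi u = expR (b * t) * expR (- b * u) by rewrite /phi -expRD;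
  congr expR; ring.
have cphi : continuous phi.
  rewrite (_ : phi = fun u => expR (b * t) * expR (- b * u)); last exact/funext.
  by move=> u; apply: cvgM; [exact: cvg_cst|exact: continuous_expRM].
pose Phi u := \int[mu]_(s in `[0%R, u]) (phi s * c s).
have cpc : continuous (fun s => phi s * c s).
  by move=> u; apply: cvgM; [exact: cphi|exact: cc].
pose M : R := expR (`|b| * t).
have M0 : 0 < M by exact: expR_gt0.
have phiM u : 0 <= u <= t -> 0 <= phi u <= M.
  move=> /andP[u0 ut]; rewrite expR_ge0/= ler_expR.
  apply: le_trans (ler_norm _) _; rewrite normrM ler_wpM2l// ger0_norm; lra.
apply/cvgrPdist_le => e e0.
(* The m.+1 cell errors, each at most (|b| M + 1) e' t / m.+1, add up to e t / (t + 1). The two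
   added 1s keep the denominators positive. *)
pose e' := e / ((`|b| * M + 1) * (t + 1)).
have k0 : 0 < `|b| * M + 1 by rewrite ltr_wpDl// mulr_ge0// ltW.
have e'0 : 0 < e' by rewrite divr_gt0// mulr_gt0//; lra.
near=> m.
have Hm : forall i s, (i < m.+1)%N -> mesh t m i <= s <= mesh t m i.+1 ->
    `|c s - c (mesh t m i)| < e' /\ `|c s - c (mesh t m i.+1)| < e'.
  by near: m; exact: mesh_unif.
(* Summation by parts leaves one error term per cell of the mesh, which the
   mean value theorem bounds by the oscillation of c on that cell. *)
pose err i := (phi (mesh t m i.+1) - phi (mesh t m i)) * c (mesh t m i.+1)
   + b * (Phi (mesh t m i.+1) - Phi (mesh t m i)).
have errle i : (i < m.+1)%N -> `|err i| <= (`|b| * M + 1) * e' * (t / m.+1%:R).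
  move=> im.
  have /andP[m0 mt] := mesh_itv t0 (ltnW im).
  have /andP[m0' mt'] := mesh_itv t0 im.
  (* With c frozen at the right end of the cell, psi is differentiable and its derivative b phi(u)
     (c(u) - c(mesh t m i.+1)) sees only the oscillation of c. *)
  pose psi u := phi u * c (mesh t m i.+1) + b * Phi u.
  have dpsi (u : R) : u \in `]mesh t m i, mesh t m i.+1[ ->
     is_derive u (1 : R) psi (b * phi u * (c u - c (mesh t m i.+1))).
    rewrite in_itv/= => /andP[u0 _].
    have dphi : is_derive u (1 : R) phi (- b * phi u).
      rewrite phiE (_ : phi = expR (b * t) \*: (fun u => expR (- b * u)));
        last exact/funext.
      have := is_deriveZ (expR (b * t)) (is_derive_expRM (- b) u).
      by move/is_derive_eq; apply; rewrite /GRing.scale/=; ring.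
    have dPhi : is_derive u (1 : R) Phi (phi u * c u).
      by apply: derive_integral => //; exact: le_lt_trans u0.
    have := is_deriveD (is_deriveM dphi (is_derive_cst (c (mesh t m i.+1)) u
      1)) (is_deriveZ b dPhi).
    by move/is_derive_eq; apply; rewrite /GRing.scale/=; ring.
  have cpsi : {within `[mesh t m i, mesh t m i.+1], continuous psi}.
    have cPhi : {within `[mesh t m i, mesh t m i.+1], continuous Phi}.
      apply: (@continuous_subspaceW _ _ _ `[0, t]); last exact:
        within_continuous_integral.
      by move=> u /=; rewrite !in_itv/= => /andP[u1 u2];
        rewrite (le_trans m0)//= (le_trans u2).
    move=> u; apply: cvgD.
      by apply: cvgM; [exact: (continuous_subspaceT cphi)|exact: cvg_cst].
    by apply: cvgM; [exact: cvg_cst|exact: cPhi].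
  have [u uin psiE] := MVT_segment (mesh_le m i t0) dpsi cpsi.
  rewrite in_itv/= in uin.
  have -> : err i = psi (mesh t m i.+1) - psi (mesh t m i) by rewrite /err
    /psi; ring.
  have dm : mesh t m i.+1 - mesh t m i = t / m.+1%:R by rewrite meshS addrC
    addKr.
  have dm0 : 0 <= t / m.+1%:R by exact: divr_ge0.
  rewrite psiE dm normrM [X in _ * X <= _]ger0_norm//.
  apply: ler_wpM2r => //.
  have /andP[p0 pM] : 0 <= phi u <= M.
    by apply: phiM; case/andP: uin => u1 u2; rewrite (le_trans m0)//= (le_trans
      u2).
  have [_ cu] := Hm i u im uin.
  rewrite !normrM (ger0_norm p0); apply: ler_pM => //.
  - by rewrite mulr_ge0.
  - apply: (@le_trans _ _ (`|b| * M)); last by rewrite lerDl.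
    by rewrite ler_wpM2l.
  - exact: ltW.
have -> : exp_convolution b c t - expR (b * t) * c 0 -
   \sum_(i < m.+1) expR (b * (t - mesh t m i)) * (c (mesh t m i.+1) - c (mesh t
     m i)) =
   \sum_(i < m.+1) err i.
  have -> : exp_convolution b c t - expR (b * t) * c 0 =
      \sum_(i < m.+1) (phi (mesh t m i.+1) * c (mesh t m i.+1) -
        phi (mesh t m i) * c (mesh t m i) +
        b * (Phi (mesh t m i.+1) - Phi (mesh t m i))).
    (* The values of T at t and at 0 are [exp_convolution b c t] and e^(b t) c(0), so the limit is
       itself a telescoping sum over the mesh. *)
    pose T u := phi u * c u + b * Phi u.
    rewrite (eq_bigr (fun i : 'I_m.+1 => T (mesh t m i.+1) - T (mesh t m i)));
      last first.
      by move=> i _; rewrite /T; ring.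
    rewrite -(big_mkord xpredT (fun i => T (mesh t m i.+1) - T (mesh t m i))).
    rewrite (telescope_sumr (fun i => T (mesh t m i)))// mesh_last mesh0 /T
      /exp_convolution.
    rewrite /Phi set_itv1 Rintegral_set1 /phi subrr mulr0 expR0 subr0; ring.
  rewrite -sumrB; apply: eq_bigr => i _; rewrite /err /phi; ring.
apply: le_trans (ler_norm_sum _ _ _) _.
apply: (@le_trans _ _ (\sum_(i < m.+1) (`|b| * M + 1) * e' * (t / m.+1%:R))).
  by apply: ler_sum => i _; exact: errle.
rewrite sumr_const card_ord -[X in X <= _]mulr_natr.
have -> : (`|b| * M + 1) * e' * (t / m.+1%:R) * m.+1%:R = e * (t / (t + 1)).
  rewrite /e'; field; rewrite (gt_eqF k0) nat1r pnatr_eq0 andbT/= gt_eqF//; lra.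
apply: ler_piMr; first exact: ltW.
by rewrite ler_pdivrMr ?mul1r; lra.
Unshelve. all: by end_near. Qed.

End riemann_sums.

(** * Almost sure statements and affine equations *)

Lemma cvg_mx (R : realType) (T : Type) (F : set_system T) (FF : Filter F) (m n
  : nat)
    (f : T -> 'M[R]_(m, n)) (l : 'M[R]_(m, n)) :
  (forall i j, (fun x => f x i j) @ F --> l i j) -> f @ F --> l.
Proof.
move=> fl; apply/cvgrPdist_lt => e e0.
have : \forall x \near F, forall i, forall j, `|l i j - f x i j| < e.
  apply: filter_forall => i; apply: filter_forall => j.
  by have /cvgrPdist_lt := fl i j; exact.
apply: filterS => x H; rewrite mx_norm_lt//.
by apply/forallP => i; apply/forallP => j; rewrite !mxE.
Qed.

Lemma within_continuous_mx (R : realType) (A : set R) (m n : nat)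
    (f : R -> 'M[R]_(m, n)) :
  (forall i j, {within A, continuous (fun x => f x i j)}) -> {within A,
    continuous f}.
Proof. by move=> cf x; apply: cvg_mx => i j; exact: cf. Qed.

Section almost_sure.
Context (R : realType) (disp : measure_display) (Omega : measurableType disp).
Variable P : probability Omega R.

(** The hypothesis says that the upper limit of the events is null; the probabilities of the tail
    unions decrease to its measure and dominate P (E k). *)
Lemma ae_prob_cvg0 (E : nat -> set Omega) : (forall k, measurable (E k)) ->
  {ae P, forall w, \forall k \near \oo, ~ E k w} ->
  P (E k) @[k --> \oo] --> 0%E.
Proof.
move=> mE aeE.
have mU k : measurable (\bigcup_(j >= k) E j) by exact: bigcup_measurable.
have mL : measurable (lim_sup_set E) by exact: bigcap_measurable.
have L0 : P (lim_sup_set E) = 0%E.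
  apply: measure_negligible => //; apply: negligibleS aeE => w /= Lw [N _ NE].
  by have [k /= Nk Ek] := Lw N I; exact: NE Nk Ek.
have H : P (\bigcup_(j >= k) E j) @[k --> \oo] --> 0%E.
  rewrite -L0; apply: lim_sup_set_cvg => //.
  by apply: le_lt_trans (probability_le1 _ _) _ => //; exact: ltry.
apply: (@squeeze_cvge _ _ _ _ (fun=> 0%E) _ (fun k => P (\bigcup_(j >= k) E
  j))).
- apply: nearW => k; rewrite measure_ge0/=; apply: le_measure; rewrite ?inE//.
  by apply: bigcup_sup => /=.
- exact: cvg_cst.
- exact: H.
Qed.

(** One null set serves for all rational times clamped at 0, and path continuity extends the
    equality to every other time. *)
Lemma ae_all_times (n : nat) (U V : R -> Omega -> 'cV[R]_n) :
  continuous_paths P U -> continuous_paths P V ->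
  (forall t, 0 <= t -> {ae P, forall w, U t w = V t w}) ->
  {ae P, forall w, forall t, 0 <= t -> U t w = V t w}.
Proof.
move=> cU cV UV.
have max0 (s : R) : 0 <= Num.max s 0 by rewrite le_max lexx orbT.
pose q_ k : R := ratr (odflt 0 (unpickle k)).
have : {ae P, forall w, forall k, U (Num.max (q_ k) 0) w = V (Num.max (q_ k) 0)
  w}.
  by apply: ae_foralln => k; exact: UV.
apply: filterS3 cU cV => w cU cV Q t t0.
pose D s := `|U (Num.max s 0) w - V (Num.max s 0) w|.
have cD : continuous D.
  move=> s; apply: (@continuous_comp _ _ _ (fun s : R => U (Num.max s 0) w - V
    (Num.max s 0) w)).
    apply: continuousB; exact: (@within_continuous_max R _ (fun s => _ s w)).
  exact: norm_continuous.
have [/eqP|Dt] := eqVneq (D t) 0.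
  by rewrite /D normr_eq0 subr_eq0 max_l// => /eqP.
have Dt0 : 0 < D t by rewrite lt_neqAle eq_sym Dt normr_ge0.
have /cvgrPdist_lt /(_ _ Dt0) [r /= r0 rD] := cD t.
have tr : t - r < t + r by lra.
have [q] := rat_in_itvoo tr; rewrite in_itv/= => /andP[q1 q2].
have : `|D t - D (ratr q)| < D t by apply: rD => /=; rewrite ltr_norml; lra.
have -> : D (ratr q) = 0.
  have Qq := Q (pickle q).
  have qE : q_ (pickle q) = ratr q by rewrite /q_ pickleK.
  rewrite qE in Qq.
  by rewrite /D Qq subrr normr0.
by rewrite subr0 ger0_norm ?ltxx// ltW.
Qed.

End almost_sure.

Section brownian_lower_bound.
Context (R : realType) (disp : measure_display) (Omega : measurableType disp).
Variables (P : probability Omega R) (F : R -> set (set Omega)) (n : nat).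
Variable B : R -> Omega -> 'cV[R]_n.
Hypotheses (FF : filtration F) (BB : brownian_motion P F B).

(* On the event where every coordinate of the increment has the sign of the
   matching entry of row i and modulus in [sqrt t, 2 sqrt t], no cancellation
   occurs in that row. *)
Lemma bm_mul_lower_bound (D : 'M[R]_n) i j t : 0 < t ->
  (((expR (- 2) / Num.sqrt (pi *+ 2)) ^+ n)%:E <=
   P [set w | (`|D i j| * Num.sqrt t <= `|D *m (B t w - B 0 w)|)%R])%E.
Proof.
move=> t0.
set c := expR _ / _; set s := Num.sqrt t.
have s0 : 0 < s by rewrite sqrtr_gt0.
pose A (k : 'I_n) : set R :=
  if 0 <= D i k then `[s, 2 * s]%classic else `[- (2 * s), - s]%classic.
have mA k : measurable (A k) by rewrite /A; case: ifP.
have c0 : 0 <= c by rewrite divr_ge0 ?expR_ge0.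
have cA k : c <= fine (normal_prob 0 (Num.sqrt (t - 0)) (A k)).
  rewrite subr0 -/s -lee_fin fineK; last by apply: fin_num_measure; exact: mA.
  rewrite /A.
  by have [] := normal_prob_itv_ge s0; case: ifP.
have := bm_normal BB (lexx 0) t0 mA.
move=> PA.
have le1 : ((c ^+ n)%:E <= P [set w | forall k, A k ((B t w - B 0 w)%R k
  ord0)])%E.
  rewrite PA lee_fin (_ : c ^+ n = \prod_(k < n) c); last by rewrite
    prodr_const card_ord.
  by apply: ler_prod => k _; rewrite c0 cA.
apply: (le_trans le1); apply: le_measure; rewrite ?inE.
- rewrite (_ : [set _ | _] = \bigcap_k (bm_incr B 0 t k @^-1` A k)).
    apply: fin_bigcap_measurable => // k _.
    rewrite -[X in measurable X]setTI.
    exact: (bm_incr_measurable FF BB k (lexx 0) (ltW t0)).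
  apply/seteqP; split => w /=.
    by move=> H k _; have := H k; rewrite !mxE.
  by move=> H k; have := H k I; rewrite /= /bm_incr !mxE.
- apply: measurable_norm_ge => r q; rewrite ord1.
  rewrite (_ : (fun _ => _) = (fun w => \sum_j D r j * bm_incr B 0 t j w)).
    apply: measurable_sum => k; apply: measurable_funM => //.
    exact: (bm_incr_measurable FF BB k (lexx 0) (ltW t0)).
  by apply/funext => w; rewrite mxE; apply: eq_bigr => k _; rewrite !mxE.
move=> w /= H.
have Hk k : 0 <= D i k * (B t w - B 0 w) k ord0.
  have := H k; rewrite /A; case: leP => Dk; rewrite /= in_itv/= => /andP[h1 h2].
    by rewrite mulr_ge0// (le_trans (ltW s0)).
  by rewrite mulr_le0 ?(ltW Dk)//; lra.
apply: le_trans (ler_mx_norm _ i ord0); apply: le_trans (ler_norm _).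
rewrite mxE (bigD1 j)//=.
apply: (@le_trans _ _ (D i j * (B t w - B 0 w) j ord0)); last first.
  by rewrite lerDl sumr_ge0.
have := H j; rewrite /A; case: leP => Dj; rewrite /= in_itv/= => /andP[h1 h2].
  by rewrite ger0_norm// ler_wpM2l.
rewrite ltr0_norm// mulNr -mulrN; apply: ler_wnM2l; first exact: ltW.
exact: h2.
Qed.

End brownian_lower_bound.

Lemma cvg_sum_fun (R : realType) (T : Type) (F : set_system T) (FF : Filter F)
    (I : Type) (s : seq I) (f : I -> T -> R) (l : I -> R) :
  (forall i, f i @ F --> l i) ->
  (fun x => \sum_(i <- s) f i x) @ F --> \sum_(i <- s) l i.
Proof.
move=> fl; elim: s => [|i s IH].
  rewrite big_nil (_ : (fun _ => _) = cst 0); first exact: cvg_cst.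
  by apply/funext => x; rewrite big_nil.
rewrite big_cons (_ : (fun _ => _) = f i \+ (fun x => \sum_(j <- s) f j x)).
  exact: cvgD.
by apply/funext => x; rewrite big_cons.
Qed.

Lemma mulmx_continuous (R : realType) (m n : nat) (S : 'M[R]_(m, n)) :
  continuous (fun v : 'cV[R]_n => S *m v).
Proof.
move=> v; apply: (cvg_mx (nbhs_filter v)) => i j; rewrite mxE.
rewrite (_ : (fun _ => _) = (fun x : 'cV[R]_n => \sum_k S i k * x k j)).
  apply: (cvg_sum_fun (nbhs_filter v)) => k; apply: cvgM; first exact: cvg_cst.
  exact: coord_continuous.
by apply/funext => x; rewrite mxE.
Qed.

Section constant_integrand.
Context (R : realType) (disp : measure_display) (Omega : measurableType disp).
Variables (P : probability Omega R) (F : R -> set (set Omega)) (n : nat).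
Variable B : R -> Omega -> 'cV[R]_n.
Hypothesis P_complete : measure_is_complete P.
Hypotheses (FF : filtration F) (BB : brownian_motion P F B).

Lemma measurable_sub_bm_ge (S : 'M[R]_n) (Y : Omega -> 'cV[R]_n) t e : 0 <= t ->
  measurable_wrt (F t) Y ->
  measurable [set w | e <= `|Y w - S *m (B t w - B 0 w)|].
Proof.
move=> t0 mY; apply: measurable_norm_ge => r c; rewrite ord1.
rewrite (_ : (fun _ => _) = (fun w => Y w r ord0) \-
    (fun w => \sum_j S r j * bm_incr B 0 t j w)).
  apply: measurable_funB.
    apply: (mfun_wrt_measurable (filtration_sigma FF t0) (filtration_measurable
      FF t0)).
    by have /(measurable_wrt_coordP _ (filtration_sigma FF t0)) := mY; exact.
  apply: measurable_sum => j; apply: measurable_funM => //.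
  exact: (bm_incr_measurable FF BB).
apply/funext => w; rewrite /= !mxE; congr (_ - _).
by apply: eq_bigr => j _; rewrite !mxE.
Qed.

(** In [ito_distance_le] the first event is empty for every delta, and the remaining term tends to 0
    with delta. *)
Lemma ito_integral_cst (S : 'M[R]_n) (H : R -> Omega -> 'M[R]_n)
    (Y : Omega -> 'cV[R]_n) t : 0 <= t -> (forall s w, H s w = S) ->
  ito_integral P F B t H Y -> {ae P, forall w, Y w = S *m (B t w - B 0 w)}.
Proof.
move=> t0 HS HY.
have mH s i j : 0 <= s -> measurable_fun setT (fun w => H s w i j).
  by move=> _; under eq_fun do rewrite HS; exact: measurable_cst.
have cH : {ae P, forall w, {within `[0, +oo[, continuous (H ^~ w)}}.
  apply: aeW => w; rewrite (_ : H ^~ w = cst S); last by apply/funext => s;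
    exact: HS.
  by move=> x; exact: cst_continuous.
have E0 e : 0 < e -> P [set w | e <= `|Y w - S *m (B t w - B 0 w)|] = 0%E.
  move=> e0; apply/eqP; rewrite eq_le measure_ge0 andbT.
  apply/lee_addgt0Pr => d d0; rewrite add0e.
  pose e2 := (e / 2 / n.+1%:R) ^+ 2.
  pose k : R := 8 / e2 *+ (n * n).
  have k0 : 0 <= k by rewrite mulrn_wge0// divr_ge0// sqr_ge0.
  (* With delta = d / (k + 1) the bound delta k is at most d, also when k = 0. *)
  have dk0 : 0 < d / (k + 1) by rewrite divr_gt0// ltr_wpDl.
  apply: le_trans (ito_distance_le FF BB P_complete t0 mH cH HY S e0 dk0) _.
  rewrite (_ : [set _ | _] = set0); last first.
    apply/seteqP; split => w //=; apply/negP; rewrite -ltNge.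
    rewrite (eq_integral (fun=> 0%E)); last by move=> s _;
      rewrite HS subrr normr0 expr0n.
    by rewrite integral0 lte_fin divr_gt0.
  rewrite measure0 add0e lee_fin.
  rewrite (_ : _ *+ _ = d * (k / (k + 1))); last first.
    rewrite -/e2 (_ : 8 * (d / (k + 1)) / e2 = d / (k + 1) * (8 / e2));
      last by ring.
    by rewrite -mulrnAr -/k mulrAC mulrA.
  by apply: ler_piMr; [exact: ltW|rewrite ler_pdivrMr ?mul1r; lra].
have : {ae P, forall w, forall k : nat, ~ (k.+1%:R^-1 <= `|Y w - S *m (B t w -
  B 0 w)|)}.
  apply: ae_foralln => k.
  exists [set w | k.+1%:R^-1 <= `|Y w - S *m (B t w - B 0 w)|]; split.
  - by apply: measurable_sub_bm_ge => //; case: HY.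
  - by apply: E0; rewrite invr_gt0.
  - by move=> w /= /contrapT.
apply: filterS => w Hw; apply/eqP; rewrite -subr_eq0 -normr_eq0 eq_le normr_ge0
  andbT.
rewrite leNgt; apply/negP => y0.
have [k] := ltr_add_invr y0; rewrite add0r => /ltW; exact: Hw.
Qed.

End constant_integrand.

Section exp_convolution_facts.
Variable R : realType.
Local Notation mu := (@lebesgue_measure R).
Implicit Types (c : R -> R) (b t : R).

(** Linearity lets the matrix S pass from the path S B to [S *m exp_wiener]. *)
Lemma exp_convolution_sum b (I : Type) (s : seq I) (k : I -> R) (f : I -> R ->
  R) t :
  (forall i, continuous (f i)) ->
  exp_convolution b (fun u => \sum_(i <- s) k i * f i u) t =
  \sum_(i <- s) k i * exp_convolution b (f i) t.
Proof.
move=> cf; elim: s => [|i s IH].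
  rewrite big_nil /exp_convolution big_nil.
  under eq_Rintegral do rewrite big_nil mulr0.
  by rewrite Rintegral_cst//= mul0r mulr0 addr0.
have cs : continuous (fun u => \sum_(j <- s) k j * f j u).
  move=> u; apply: (cvg_sum_fun (nbhs_filter u)) => j.
  by apply: cvgM; [exact: cvg_cst|exact: cf].
have ce : continuous (fun u : R => expR (b * (t - u))).
  rewrite (_ : (fun _ => _) = (fun u => expR (b * t) * expR (- b * u)));
    last first.
    by apply/funext => u; rewrite -expRD; congr expR; ring.
  by move=> u; apply: cvgM; [exact: cvg_cst|exact: continuous_expRM].
rewrite big_cons -IH /exp_convolution big_cons.
under eq_Rintegral do rewrite big_cons mulrDr mulrCA.
rewrite RintegralD//; last 2 first.
- apply: continuous_integrable => u; apply: cvgM; first exact: cvg_cst.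
  by apply: cvgM; [exact: ce|exact: cf].
- by apply: continuous_integrable => u; apply: cvgM; [exact: ce|exact: cs].
rewrite RintegralZl//; last first.
  by apply: continuous_integrable => u; apply: cvgM; [exact: ce|exact: cf].
ring.
Qed.

Lemma within_continuous_integral_itvcy c : continuous c ->
  {within `[0, +oo[, continuous (fun t => \int[mu]_(s in `[0%R, t]) c s)}.
Proof.
move=> cc; apply/continuous_within_itvcyP; split.
  move=> t; rewrite in_itv/= andbT => t0.
  apply: differentiable_continuous; apply/derivable1_diffP.
  by have [] := derive_integral cc t0.
have lt01 : (0 : R) < 1 by [].
by have /(continuous_within_itvP _ lt01)[_ + _] := within_continuous_integral
  cc (@ler01 R).
Qed.

Lemma within_continuous_exp_convolution b c : continuous c ->
  {within `[0, +oo[, continuous (exp_convolution b c)}.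
Proof.
move=> cc.
rewrite (_ : exp_convolution b c = (fun t => c t + b * (expR (b * t) *
  \int[mu]_(s in `[0%R, t]) (expR ((- b) * s) * c s)))); last first.
  by apply/funext => t; exact: exp_convolutionE.
have ci : continuous (fun s => expR ((- b) * s) * c s).
  by move=> s; apply: cvgM; [exact: continuous_expRM|exact: cc].
move=> t; apply: cvgD; first exact: continuous_subspaceT.
apply: cvgM; first exact: cvg_cst.
apply: cvgM; last exact: within_continuous_integral_itvcy.
by apply: continuous_subspaceT; exact: continuous_expRM.
Qed.

End exp_convolution_facts.

Section affine_sde.
Context (R : realType) (disp : measure_display) (Omega : measurableType disp).
Variables (P : probability Omega R) (F : R -> set (set Omega)) (n : nat).
Variable B : R -> Omega -> 'cV[R]_n.
Hypothesis P_complete : measure_is_complete P.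
Hypotheses (FF : filtration F) (BB : brownian_motion P F B).

(** Defined path by path, hence for all t at once and without choosing a version at each t. The
    clamp [Num.max s 0] extends a path continuously to negative times. *)
Definition exp_wiener (b t : R) (w : Omega) : 'cV[R]_n :=
  \col_i exp_convolution b (fun s => B (Num.max s 0) w i ord0) t.

Lemma path_coord_continuous (X : R -> Omega -> 'cV[R]_n) w i :
  {within `[0, +oo[, continuous (fun t => X t w)} ->
  continuous (fun s : R => X (Num.max s 0) w i ord0).
Proof.
move=> cX s.
apply: (@continuous_comp _ _ _ (fun s : R => X (Num.max s 0) w)
  (fun x : 'cV[R]_n => x i ord0)).
  exact: (@within_continuous_max R _ (fun s => X s w) cX).
exact: coord_continuous.
Qed.

(** The stochastic integral is identified at each t up to a null set depending on t; continuity of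
    both sides makes the null set uniform in t. *)
Lemma sde_cst_diffusion sigma b x S X : sde_solution P F B sigma b x X ->
  (forall x, sigma x = S) ->
  {ae P, forall w, forall t, 0 <= t -> X t w = x + S *m B t w +
     \col_i \int[lebesgue_measure]_(s in `[0%R, t]) b (X s w) i ord0}.
Proof.
move=> [_ cX _ [M [cM itoM XE]]] sS.
have cSB : continuous_paths P (fun t w => S *m (B t w - B 0 w)).
  apply: filterS (bm_continuous BB) => w cB.
  have cg : {in (fun t => B t w) @` `[0, +oo[, continuous (fun v : 'cV[R]_n =>
    S *m (v - B 0 w))}.
    move=> v _.
    have cs : {for v, continuous (fun v : 'cV[R]_n => v - B 0 w)}.
      by apply: continuousB; [exact: cvg_id|exact: cst_continuous].
    exact: (continuous_comp cs (@mulmx_continuous _ _ _ S _)).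
  exact: (within_continuous_comp _ _ _ cg cB).
have MS : {ae P, forall w, forall t, 0 <= t -> M t w = S *m (B t w - B 0 w)}.
  apply: ae_all_times => // t t0.
  by apply: (ito_integral_cst P_complete FF BB t0 _ (itoM t t0)) => s w;
    exact: sS.
apply: filterS3 MS XE (bm_start BB) => w MS XE B0 t t0.
by rewrite XE// MS// B0 subr0.
Qed.

(** The linear part of the drift is a scalar, so on each path the equation decouples into one scalar
    Volterra equation per coordinate, forced by a row of S B. *)
Lemma sde_affine_solution sigma b x S alpha beta X :
  sde_solution P F B sigma b x X ->
  (forall x, sigma x = S) -> (forall x, b x = alpha + beta *: x) ->
  {ae P, forall w, forall t, 0 <= t ->
    (beta != 0 -> X t w = expR (beta * t) *: x + S *m exp_wiener beta t w
                           + ((expR (beta * t) - 1) / beta) *: alpha) /\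
    (beta = 0 -> X t w = x + t *: alpha + S *m B t w)}.
Proof.
move=> HX sS bE.
have cX : continuous_paths P X by case: HX.
apply: filterS3 (sde_cst_diffusion HX sS) cX (bm_continuous BB) => w XE cX' cB
  t t0.
have max0 (s : R) : 0 <= Num.max s 0 by rewrite le_max lexx orbT.
have key i := @affine_volterra R (alpha i ord0) beta (x i ord0)
  (fun s => \sum_k S i k * B (Num.max s 0) w k ord0)
  (fun s => X (Num.max s 0) w i ord0) t.
have cc i : continuous (fun s : R => \sum_k S i k * B (Num.max s 0) w k ord0).
  move=> u; apply: (cvg_sum_fun (nbhs_filter u)) => j.
  by apply: cvgM; [exact: cvg_cst|exact: path_coord_continuous].
have yE i u : 0 <= u -> X (Num.max u 0) w i ord0 =
    x i ord0 + \sum_k S i k * B (Num.max u 0) w k ord0 +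
    \int[lebesgue_measure]_(s in `[0%R, u])
      (alpha i ord0 + beta * X (Num.max s 0) w i ord0).
  move=> u0; rewrite max_l// XE// !mxE; congr (_ + _).
  apply: eq_Rintegral => s; rewrite inE/= in_itv/= => /andP[s0 _].
  by rewrite bE !mxE max_l.
split=> b0; apply/colP => i.
  have [/(_ b0) + _] := key i (cc i) (path_coord_continuous (i := i) cX') (yE
    i) t0.
  rewrite max_l// => ->; rewrite !mxE exp_convolution_sum; last first.
    by move=> k; exact: path_coord_continuous.
  congr (_ + _ + _); apply: eq_bigr => k _.
  by rewrite mxE.
have [_ /(_ b0)] := key i (cc i) (path_coord_continuous (i := i) cX') (yE i) t0.
by rewrite max_l// => ->; rewrite !mxE addrAC.
Qed.

End affine_sde.

Lemma mx_norm_scalar_le (R : realType) n (a : R) : `|a%:M : 'M[R]_n| <= `|a|.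
Proof.
rewrite mx_norm_le//; apply/forallP => i; apply/forallP => j.
by rewrite mxE; case: eqP => _; rewrite ?mulr1n ?mulr0n ?normr0.
Qed.

Lemma measurable_wrt_cst (d : measure_display) (T : topologicalType)
  (O : measurableType d) (G : set (set O)) (a : T) :
  sigma_algebra setT G -> measurable_wrt G (fun=> a).
Proof.
move=> [G0 GC _] A _; rewrite [X in G X](_ : _ = if a \in A then setT else
  set0).
  by case: ifP => // _; rewrite -(setD0 setT); exact: GC.
by rewrite -preimage_cst.
Qed.

Lemma mesh_cover (R : realType) (t s : R) m : 0 < s <= t ->
  exists2 i, (i < m.+1)%N & mesh t m i < s <= mesh t m i.+1.
Proof.
move=> /andP[s0 st].
have ex : exists k, s <= mesh t m k by exists m.+1; rewrite mesh_last.
have [[|k] sk kmin] := ex_minnP ex; first by move: sk; rewrite mesh0 leNgt s0.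
have lt_k : mesh t m k < s.
  by rewrite ltNge; apply/negP => /kmin; rewrite ltnn.
exists k; last by rewrite lt_k.
by apply: kmin; rewrite mesh_last.
Qed.

(** * The Ito integral of an exponential *)

Section exp_wiener_integral.
Context (R : realType) (disp : measure_display) (Omega : measurableType disp).
Variables (P : probability Omega R) (F : R -> set (set Omega)) (n : nat).
Variable B : R -> Omega -> 'cV[R]_n.
Hypotheses (FF : filtration F) (FU : usual_conditions P F) (BB :
  brownian_motion P F B).

Lemma exp_wiener_continuous b : continuous_paths P (exp_wiener B b).
Proof.
apply: filterS (bm_continuous BB) => w cB.
apply: within_continuous_mx => i j.
rewrite (_ : (fun _ => _) = exp_convolution b (fun s => B (Num.max s 0) w i
  ord0)).
  by apply: within_continuous_exp_convolution; exact: path_coord_continuous.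
by apply/funext => t; rewrite mxE.
Qed.

Variables (b t : R) (t0 : 0 <= t).

Let phi (s : R) : R := expR (b * (t - s)).

Let phi_continuous : continuous phi.
Proof.
rewrite (_ : phi = (fun u => expR (b * t) * expR (- b * u))); last first.
  by apply/funext => u; rewrite -expRD /phi; congr expR; ring.
by move=> u; apply: cvgM; [exact: cvg_cst|exact: continuous_expRM].
Qed.

Let coef m i (w : Omega) : 'M[R]_n := (phi (mesh t m i))%:M.

Let coef_measurable m i : (i < m.+1)%N ->
  measurable_wrt (F (mesh t m i)) (coef m i).
Proof.
move=> im; apply: measurable_wrt_cst.
by apply: (filtration_sigma FF); case/andP: (mesh_itv t0 (ltnW im)).
Qed.

Let coef_bounded m : exists C : R, forall i w, (i < m.+1)%N -> `|coef m i w| <=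
  C.
Proof.
exists (expR (`|b| * t)) => i w im; apply: le_trans (mx_norm_scalar_le _ _) _.
have /andP[m0 mt] := mesh_itv t0 (ltnW im).
rewrite ger0_norm ?expR_ge0// ler_expR; apply: le_trans (ler_norm _) _.
by rewrite normrM ler_wpM2l// ger0_norm ?subr_ge0// gerBl.
Qed.

Let exp_simple m : simple_process F n t := {|
  sp_size := m.+1 ;
  sp_time := mesh t m ;
  sp_coef := coef m ;
  sp_time_first := mesh0 t m ;
  sp_time_last := mesh_last t m ;
  sp_time_mono := fun i _ => mesh_le m i t0 ;
  sp_coef_measurable := @coef_measurable m ;
  sp_coef_bounded := coef_bounded m |}.

Let integral_diff_le e : 0 < e -> \forall m \near \oo, forall w,
  (\int[lebesgue_measure]_(s in `[0%R, t])
     ((`|sp_eval (exp_simple m) s w - (phi s)%:M| ^+ 2)%R)%:E <= (e ^+ 2 *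
       t)%:E)%E.
Proof.
move=> e0; near=> m => w.
have He : forall i s, (i < m.+1)%N -> mesh t m i <= s <= mesh t m i.+1 ->
    `|phi s - phi (mesh t m i)| < e /\ `|phi s - phi (mesh t m i.+1)| < e.
  by near: m; exact: mesh_unif.
have mf : measurable_fun setT
    (fun s : R => (`|sp_eval (exp_simple m) s w - (phi s)%:M| ^+ 2)%:E).
  apply/measurable_EFinP; apply: measurable_funX; apply: measurable_mx_norm =>
    r c.
  rewrite (_ : (fun _ => _) = (fun s : R => sp_eval (exp_simple m) s w r c) \-
     (fun s : R => phi s *+ (r == c))); last by apply/funext => s /=;
       rewrite !mxE.
  apply: measurable_funB.
    exact: (measurableT_comp (sp_eval_joint FF (exp_simple m) r c)
      (pair2_measurable w)).
  apply: continuous_measurable_fun => s.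
  case: eqP => _; last exact: cvg_cst.
  exact: phi_continuous.
(* The cells are open on the left, so the simple process vanishes at time 0; that point is dropped
   from the integral. *)
rewrite -integral_itv_obnd_cbnd; last exact: measurable_funTS.
apply: (@le_trans _ _ (\int[lebesgue_measure]_(s in `]0%R,
  t]) (e ^+ 2)%:E)%E); last first.
  rewrite integral_cst//= lebesgue_measure_itv/= lte_fin.
  by case: ltP => h; rewrite ?oppr0 ?adde0 ?mule0 -?EFinM lee_fin// mulr_ge0//
    sqr_ge0.
apply: ge0_le_integral => //.
- exact: measurable_funTS.
- move=> s /=; rewrite in_itv/= => st.
  have [i im si] := mesh_cover m st.
  have -> : sp_eval (exp_simple m) s w = (phi (mesh t m i))%:M.
    by rewrite (@sp_eval_itv _ _ _ F n t (exp_simple m) i s w im si).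
  rewrite lee_fin -raddfB/= lerXn2r ?nnegrE ?(ltW e0)//.
  apply: le_trans (mx_norm_scalar_le _ _) _.
  have [|h _] := He i s im; first by case/andP: si => /ltW -> ->.
  by rewrite distrC ltW.
Unshelve. all: by end_near. Qed.

Let sp_integralE m w r :
  sp_integral B (exp_simple m) w r ord0 = \sum_(i < m.+1) expR (b * (t - mesh t
    m i)) *
    (B (mesh t m i.+1) w r ord0 - B (mesh t m i) w r ord0).
Proof.
rewrite /sp_integral summxE; apply: eq_bigr => i _.
by rewrite mul_scalar_mx !mxE.
Qed.

Let sp_integral_cvg w : {within `[0, +oo[, continuous (fun s => B s w)} -> B 0
  w = 0 ->
  sp_integral B (exp_simple m) w @[m --> \oo] --> exp_wiener B b t w.
Proof.
move=> cB B0; apply: cvg_mx => r j; rewrite ord1 mxE.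
have := @riemann_sum_exp R b (fun s => B (Num.max s 0) w r ord0) t
  (path_coord_continuous (i := r) cB) t0.
rewrite maxxx B0 [X in _ - _ * X]mxE mulr0 subr0.
rewrite [X in X @ _ --> _ -> _](_ : _ = (fun m => sp_integral B (exp_simple m)
  w r ord0))//.
apply/funext => m; rewrite sp_integralE; apply: eq_bigr => i _.
have /andP[m0 _] := mesh_itv t0 (ltn_ord i).
have /andP[m1 _] := mesh_itv t0 (ltnW (ltn_ord i)).
by rewrite !max_l.
Qed.

Let sp_integral_measurable m : measurable_wrt (F t) (sp_integral B (exp_simple
  m)).
Proof.
have sG := filtration_sigma FF t0.
apply/(measurable_wrt_coordP _ sG) => r j; rewrite ord1.
rewrite (_ : (fun _ => _) = (fun w => \sum_(i < m.+1) expR (b * (t - mesh t m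
  i)) *
    bm_incr B (mesh t m i) (mesh t m i.+1) r w)); last first.
  by apply/funext => w; rewrite sp_integralE.
apply: measurable_sum => i; apply: measurable_funM => //.
have /andP[m0 mt] := mesh_itv t0 (ltn_ord i).
have /andP[m1 _] := mesh_itv t0 (ltnW (ltn_ord i)).
apply: (mfun_wrtS (filtration_sigma FF m0) sG); first exact: (filtration_le FF).
by apply: (bm_incr_mfun FF BB) => //; exact: mesh_le.
Qed.

(** The approximating processes take the left-endpoint values of the exponential on a regular mesh.
    Their integrals converge almost surely by [riemann_sum_exp], with no boundary term since B_0 =
    0. The limit is [F t]-measurable because [F 0], hence [F t], contains the null sets. *)
Lemma exp_wiener_ito : ito_integral P F B t
  (fun s _ => (expR (b * (t - s)))%:M) (exp_wiener B b t).
Proof.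
have sG := filtration_sigma FF t0.
have [cP nF0 _] := FU.
have nG : P.-negligible `<=` F t.
  by apply: subset_trans nF0 _; exact: (filtration_le FF (lexx 0) t0).
have cvgI : {ae P, forall w, sp_integral B (exp_simple m) w @[m --> \oo] -->
  exp_wiener B b t w}.
  by apply: filterS2 (bm_continuous BB) (bm_start BB) => w;
    exact: sp_integral_cvg.
have mJ : measurable_wrt (F t) (exp_wiener B b t).
  exact: (measurable_wrt_ae_cvg sG nG sp_integral_measurable cvgI).
split => //; exists exp_simple; split=> eps eps0.
  (* The integrand is deterministic, so the event is empty for large m as soon as e^2 t < eps; this
     follows from e <= 1 and e t < eps. *)
  pose e : R := Num.min 1 (eps / (2 * (t + 1))).
  have e0 : 0 < e by rewrite lt_min ltr01 divr_gt0// mulr_gt0// ltr_wpDl.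
  apply: cvg_near_cst; near=> m.
  rewrite [X in P X](_ : _ = set0) ?measure0//.
  apply/seteqP; split => w //=; apply/negP; rewrite -ltNge.
  have He : forall w, (\int[lebesgue_measure]_(s in `[0%R, t])
     ((`|sp_eval (exp_simple m) s w - (phi s)%:M| ^+ 2)%R)%:E <= (e ^+ 2 *
       t)%:E)%E.
    by near: m; exact: integral_diff_le.
  apply: le_lt_trans (He w) _; rewrite lte_fin.
  have e1 : e <= 1 by rewrite ge_min lexx.
  have e2 : e <= eps / (2 * (t + 1)) by rewrite ge_min lexx orbT.
  have e3 : e * (2 * (t + 1)) <= eps by rewrite -ler_pdivlMr// mulr_gt0//
    ltr_wpDl.
  apply: (@le_lt_trans _ _ (e * t)); last by lra.
  by rewrite ler_wpM2r// expr2 ler_piMl// ltW.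
pose E m := [set w | (eps%:E <= (`|sp_integral B (exp_simple m) w - exp_wiener
  B b t w|)%:E)%E].
have mfT (f : Omega -> R) : mfun_wrt (F t) f -> measurable_fun setT f.
  exact: (mfun_wrt_measurable sG (filtration_measurable FF t0)).
apply: (@ae_prob_cvg0 _ _ _ P E).
  move=> m; rewrite /E (_ : [set _ | _] =
    [set w | eps <= `|sp_integral B (exp_simple m) w - exp_wiener B b t w|]);
      last first.
    by apply/seteqP; split => w /=; rewrite lee_fin.
  apply: measurable_norm_ge => r j.
  rewrite (_ : (fun _ => _) = (fun w => sp_integral B (exp_simple m) w r j) \-
     (fun w => exp_wiener B b t w r j)); last by apply/funext => w /=;
       rewrite !mxE.
  apply: measurable_funB; apply: mfT.
    by have /(measurable_wrt_coordP _ sG) := sp_integral_measurable m; exact.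
  by have /(measurable_wrt_coordP _ sG) := mJ; exact.
apply: filterS cvgI => w /cvgrPdist_lt /(_ _ eps0).
by apply: filterS => m; rewrite /E/= lee_fin distrC ltNge => /negP.
Unshelve. all: by end_near. Qed.

End exp_wiener_integral.

(** * Small times and the main theorem *)

Lemma lipschitz_continuous (R : realType) (V W : normedModType R) (f : V -> W) :
  lipschitz f -> continuous f.
Proof.
move=> /pinfty_ex_gt0[k k0 kf] x.
apply/cvgrPdist_lt => e e0; near=> y.
have : `|x - y| < e / k by near: y; apply: cvgr_dist_lt => //; rewrite divr_gt0.
rewrite ltr_pdivlMr// mulrC; apply: le_lt_trans.
exact: (kf (x, y)).
Unshelve. all: by end_near. Qed.

Lemma C1_nonneg_right_diff (R : realType) (g : R -> R) : C1_nonneg g ->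
  exists g0 : R, forall e, 0 < e ->
    \forall t \near 0^'+, `|g t - g 0 - t * g0| <= e * t.
Proof.
move=> [g' [_ dg]]; exists (g' 0) => e e0.
have /cvgrPdist_lt /(_ _ e0) H := dg 0 (lexx 0).
rewrite !near_withinE in H.
rewrite near_withinE; apply: filterS H => t H t0.
have tn0 : t != 0 by rewrite gt_eqF.
have t0' : t \in `[0, +oo[ by rewrite in_itv/= andbT ltW.
have := H tn0 t0'; rewrite subr0 => /ltW H'.
have -> : g t - g 0 - t * g' 0 = - (t * (g' 0 - (g t - g 0) / t)) by field.
by rewrite normrN normrM gtr0_norm// mulrC ler_wpM2r// ltW.
Qed.

Lemma cvge0_near_le (R : realType) (u : nat -> \bar R) e :
  (forall k, u k \is a fin_num) -> u k @[k --> \oo] --> 0%E -> 0 < e ->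
  \forall k \near \oo, (u k <= e%:E)%E.
Proof.
move=> uf /fine_cvg /cvgrPdist_lt uc e0.
have := uc _ e0; apply: filterS => k; rewrite sub0r normrN => /ltW h.
by rewrite -(fineK (uf k)) lee_fin; apply: le_trans (ler_norm _) h.
Qed.

Section small_time.
Context (R : realType) (disp : measure_display) (Omega : measurableType disp).
Variables (P : probability Omega R) (F : R -> set (set Omega)) (n : nat).
Variable B : R -> Omega -> 'cV[R]_n.
Hypothesis P_complete : measure_is_complete P.
Hypotheses (FF : filtration F) (BB : brownian_motion P F B).

(** Squares, so that the Brownian scale sqrt (T k) is exactly 1 / (k + 1); a sequence, so that
    almost sure convergence can be turned into convergence of probabilities. *)
Definition small_times (k : nat) : R := (k.+1%:R^-1) ^+ 2.

Local Notation T := small_times.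

Lemma small_times_gt0 k : 0 < T k.
Proof. by rewrite exprn_gt0// invr_gt0. Qed.

Lemma sqrt_small_times k : Num.sqrt (T k) = k.+1%:R^-1.
Proof. by rewrite sqrtr_sqr ger0_norm// invr_ge0. Qed.

Lemma small_times_cvg : T k @[k --> \oo] --> 0^'+.
Proof.
have c0 : T k @[k --> \oo] --> (0 : R).
  rewrite -[X in _ --> X](mulr0 0); apply: cvgM; exact: cvg_harmonic.
move=> W; rewrite nbhs_simpl/= => nW.
have : \forall k \near \oo, 0 < T k -> W (T k) by exact: (c0 _ nW).
by apply: filterS => k; apply; exact: small_times_gt0.
Qed.

Lemma drift_avg (b : 'cV[R]_n -> 'cV[R]_n) (X : R -> 'cV[R]_n) x e :
  continuous b -> {within `[0, +oo[, continuous X} -> X 0 = x -> 0 < e ->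
  \forall t \near 0^'+, forall i,
    `|\int[lebesgue_measure]_(s in `[0%R, t]) (b (X s) i ord0) - t * b x i
      ord0| <= e * t.
Proof.
move=> cb cX X0 e0; apply: filter_forall => i.
have cf : continuous (fun s : R => b (X (Num.max s 0)) i ord0).
  move=> s.
  have c1 := @within_continuous_max R _ X cX s.
  have c2 : {for X (Num.max s 0), continuous (fun v => b v i ord0)}.
    exact: (continuous_comp (cb _) (@coord_continuous R n 1 i ord0 _)).
  exact: (continuous_comp c1 c2).
have := Rintegral_avg_le cf e0.
apply: filterS => t; rewrite maxxx X0.
rewrite [X in `|X - _|](_ : _ = \int[lebesgue_measure]_(s in `[0%R,
  t]) (b (X s) i ord0))//.
apply: eq_Rintegral => s; rewrite inE/= in_itv/= => /andP[s0 _].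
by rewrite max_l.
Qed.

(** In [ito_distance_le] take eps = e sqrt T and delta = dl T: the factor T cancels in delta /
    eps^2. The integral of |S - H|^2 over [0, T] is o(T) on almost every path, so it eventually
    falls below dl T / 4. *)
Lemma ito_small_time (H : R -> Omega -> 'M[R]_n) (Y : R -> Omega -> 'cV[R]_n) S
  e d :
  (forall t, 0 <= t -> ito_integral P F B t H (Y t)) ->
  (forall s i j, 0 <= s -> measurable_fun setT (fun w => H s w i j)) ->
  {ae P, forall w, {within `[0, +oo[, continuous (H ^~ w)}} ->
  {ae P, forall w, H 0 w = S} -> 0 < e -> 0 < d ->
  \forall k \near \oo,
    (P [set w | (e * Num.sqrt (T k) <= `|Y (T k) w - S *m (B (T k) w - B 0
      w)|)%R] <= d%:E)%E.
Proof.
move=> HY mH cH H0 e0 d0.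
pose K : R := 8 / (e / 2 / n.+1%:R) ^+ 2 *+ (n * n).
have K0 : 0 <= K by rewrite mulrn_wge0// divr_ge0// sqr_ge0.
(* Chosen so that the Chebyshev term dl K is at most d / 2; the other half of d is left for
   [E k]. *)
pose dl := d / (2 * (K + 1)).
have dl0 : 0 < dl by rewrite divr_gt0// mulr_gt0// ltr_wpDl.
have dlK : dl * K <= d / 2.
  have -> : d / 2 = dl * (K + 1).
    have : K + 1 != 0 by rewrite gt_eqF// ltr_wpDl.
    by rewrite /dl; move: (K + 1) => q q0; field.
  by rewrite ler_pM2l// lerDl.
pose E k := [set w | ((dl * T k / 4)%:E <=
  \int[lebesgue_measure]_(s in `[0%R, T k]) ((`|S - H s w| ^+ 2)%R)%:E)%E].
have mE k : measurable (E k).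
  rewrite -[E k]setTI; apply: emeasurable_fun_c_infty => //.
  exact: (@measurable_integral_sqr _ _ _ P P_complete n (T k) (fun _ _ => S) H).
have cE : P (E k) @[k --> \oo] --> 0%E.
  apply: ae_prob_cvg0 => //.
  apply: filterS2 cH H0 => w cw H0w.
  pose phi s := `|S - H (Num.max s 0) w| ^+ 2.
  have cphi : continuous phi.
    move=> s.
    have c1 := @within_continuous_max R _ (H ^~ w) cw s.
    have c2 : {for s, continuous (fun s : R => `|S - H (Num.max s 0) w|)}.
      apply: cvg_norm; apply: cvgB; [exact: cvg_cst|exact: c1].
    exact: (cvgM c2 c2).
  have dl8 : 0 < dl / 8 by rewrite divr_gt0.
  have : \forall k \near \oo, `|\int[lebesgue_measure]_(s in `[0%R,
    T k]) phi s -
      T k * phi 0| <= dl / 8 * T k.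
    exact: (small_times_cvg (Rintegral_avg_le cphi dl8)).
  apply: filterS => k; rewrite /= {2}/phi maxxx H0w subrr normr0 expr0n mulr0
    subr0 => le8.
  apply/negP; rewrite -ltNge.
  have -> : (\int[lebesgue_measure]_(s in `[0%R, T k]) ((`|S - H s w| ^+
    2)%R)%:E =
     (\int[lebesgue_measure]_(s in `[0%R, T k]) phi s)%:E)%E.
    rewrite /Rintegral fineK; last first.
      by apply: integrable_fin_num => //; exact: continuous_integrable.
    apply: eq_integral => s; rewrite inE/= in_itv/= => /andP[s0 _].
    by rewrite /phi max_l.
  rewrite lte_fin; apply: le_lt_trans (ler_norm _) _; apply: le_lt_trans le8 _.
  by have := mulr_gt0 dl0 (small_times_gt0 k); lra.
have d20 : 0 < d / 2 by rewrite divr_gt0.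
have Ef k : P (E k) \is a fin_num by exact: fin_num_measure.
have := cvge0_near_le Ef cE d20.
apply: filterS => k Ek.
have Tk0 := small_times_gt0 k.
have eT0 : 0 < e * Num.sqrt (T k) by rewrite mulr_gt0// sqrtr_gt0.
have dT0 : 0 < dl * T k by rewrite mulr_gt0.
apply: le_trans (ito_distance_le FF BB P_complete (ltW Tk0) mH cH (HY _ (ltW
  Tk0)) S eT0 dT0) _.
have -> : 8 * (dl * T k) / (e * Num.sqrt (T k) / 2 / n.+1%:R) ^+ 2 *+ (n * n) =
  dl * K.
  rewrite /K mulrnAr; congr (_ *+ _).
  rewrite sqrt_small_times /T; field; rewrite !nat1r !pnatr_eq0/= gt_eqF//.
rewrite (splitr d) EFinD; apply: leeD => //.
Qed.

End small_time.

Lemma ae_ex (R : realType) d (T : measurableType d) (P : probability T R)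
    (Q : T -> Prop) : {ae P, forall w, Q w} -> exists w, Q w.
Proof.
move=> aeQ; apply: contrapT => /forallNP nQ.
have : P setT = 0%E.
  apply: measure_negligible => //; apply: negligibleS aeQ => w _; exact: nQ.
by rewrite probability_setT => /eqP; rewrite onee_eq0.
Qed.

(** * Two solutions differing by a deterministic shift *)

Section shifted_solutions.
Context (R : realType) (disp : measure_display) (Omega : measurableType disp).
Variables (P : probability Omega R) (F : R -> set (set Omega)) (n : nat).
Variable B : R -> Omega -> 'cV[R]_n.
Hypothesis P_complete : measure_is_complete P.
Hypotheses (FF : filtration F) (BB : brownian_motion P F B).
Variables (sigma : 'cV[R]_n -> 'M[R]_n) (b : 'cV[R]_n -> 'cV[R]_n).
Hypotheses (csigma : continuous sigma) (cb : continuous b).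
Variables (x y : 'cV[R]_n) (X Y : R -> Omega -> 'cV[R]_n).
Hypotheses (HX : sde_solution P F B sigma b x X) (HY : sde_solution P F B sigma
  b y Y).
Variables (g : R -> R) (g0 : R) (v : 'cV[R]_n).
Hypothesis g1 : g 0 = 1.
Hypothesis dg : forall e, 0 < e -> \forall t \near 0^'+,
  `|g t - g 0 - t * g0| <= e * t.
Hypothesis XY : {ae P, forall w, forall t, 0 <= t -> X t w = g t *: v + Y t w}.
Hypothesis xyv : x = v + y.

Lemma sde_coef_measurable z Z : sde_solution P F B sigma b z Z ->
  forall s i j, 0 <= s -> measurable_fun setT (fun w => sigma (Z s w) i j).
Proof.
move=> [aZ _ _ _] s i j s0.
have sG := filtration_sigma FF s0.
apply: (mfun_wrt_measurable sG (filtration_measurable FF s0)).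
apply/(mfun_wrtP _ sG) => A mA.
pose C := (fun u : 'cV[R]_n => sigma u i j) @^-1` A.
have cC : continuous (fun u : 'cV[R]_n => sigma u i j).
  by move=> u; exact: (continuous_comp (@csigma u) (@coord_continuous R n n i j
    _)).
have : measurable_fun setT ((fun u => sigma u i j) : g_sigma_algebraType (@open
  'cV[R]_n) -> R).
  apply: (measurability _ (RGenOpens.measurableE R)) => // _ [_ [p [q ->]] <-].
  rewrite setTI; apply: sub_sigma_algebra; apply: open_comp;
    last exact: interval_open.
  by move=> u _; exact: cC.
move=> /(_ measurableT _ mA); rewrite setTI => mC.
exact: (aZ s s0 C mC).
Qed.

Lemma sde_coef_continuous z Z : sde_solution P F B sigma b z Z ->
  {ae P, forall w, {within `[0, +oo[, continuous (fun s => sigma (Z s w))}}.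
Proof.
move=> [_ cZ _ _]; apply: filterS cZ => w cZ.
have cg : {in (fun s => Z s w) @` `[0, +oo[, continuous sigma} by move=> u _;
  exact: csigma.
exact: (within_continuous_comp _ _ _ cg cZ).
Qed.

(** With M and N the two stochastic integrals and u = B_t - B_0, D u = (M - N) - (M - sigma(x) u) +
    (N - sigma(y) u). Each of the three terms is below e sqrt t outside an event of small
    probability, while D u reaches 4 e sqrt t with probability at least c. *)
Lemma sde_shift_diffusion_eq : sigma x = sigma y.
Proof.
apply/eqP; rewrite -subr_eq0; apply/negP => /negP D0.
have [i [j Dij]] : exists i j, (sigma x - sigma y) i j != 0.
  apply: contrapT => H; move/eqP: D0; apply; apply/matrixP => i j;
    rewrite [RHS]mxE.
  by apply/eqP/negP => /negP Dij; apply: H; exists i, j.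
set D := sigma x - sigma y in D0 Dij.
(* Three errors of size e stay strictly below |D i j| = 4 e; likewise three probabilities c / 4 stay
   below c. *)
pose e := `|D i j| / 4.
have e0 : 0 < e by rewrite divr_gt0// normr_gt0.
pose c : R := (expR (- 2) / Num.sqrt (pi *+ 2)) ^+ n.
have c0 : 0 < c.
  by rewrite exprn_gt0// divr_gt0 ?expR_gt0// sqrtr_gt0 mulrn_wgt0// pi_gt0.
have c40 : 0 < c / 4 by rewrite divr_gt0.
have [_ cX X0 [M [_ itoM XE]]] := HX.
have [_ cY Y0 [N [_ itoN YE]]] := HY.
pose T := @small_times R.
pose A1 k := [set w | e * Num.sqrt (T k) <= `|M (T k) w - sigma x *m (B (T k) w
  - B 0 w)|].
pose A2 k := [set w | e * Num.sqrt (T k) <= `|N (T k) w - sigma y *m (B (T k) w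
  - B 0 w)|].
pose A3 k := [set w | e * Num.sqrt (T k) <= `|M (T k) w - N (T k) w|].
pose A k := [set w | `|D i j| * Num.sqrt (T k) <= `|D *m (B (T k) w - B 0 w)|].
have T0 k : 0 < T k := small_times_gt0 R k.
have h1 : \forall k \near \oo, (P (A1 k) <= (c / 4)%:E)%E.
  apply: (ito_small_time P_complete FF BB itoM (sde_coef_measurable HX)
    (sde_coef_continuous HX) _ e0 c40).
  by apply: filterS X0 => w ->.
have h2 : \forall k \near \oo, (P (A2 k) <= (c / 4)%:E)%E.
  apply: (ito_small_time P_complete FF BB itoN (sde_coef_measurable HY)
    (sde_coef_continuous HY) _ e0 c40).
  by apply: filterS Y0 => w ->.
have mT (f : R -> Omega -> 'cV[R]_n) H k r : (forall t, 0 <= t -> ito_integral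
  P F B t H (f t)) ->
    measurable_fun setT (fun w => f (T k) w r ord0).
  move=> /(_ _ (ltW (T0 k))) [mf _].
  have sG := filtration_sigma FF (ltW (T0 k)).
  apply: (mfun_wrt_measurable sG (filtration_measurable FF (ltW (T0 k)))).
  by have /(measurable_wrt_coordP _ sG) := mf; exact.
have mA3 k : measurable (A3 k).
  apply: measurable_norm_ge => r q; rewrite ord1.
  rewrite (_ : (fun _ => _) = (fun w => M (T k) w r ord0) \- (fun w => N (T k)
    w r ord0)).
    by apply: measurable_funB; [exact: (mT _ _ _ _ itoM)|exact: (mT _ _ _ _
      itoN)].
  by apply/funext => w; rewrite /= !mxE.
have h3 : \forall k \near \oo, (P (A3 k) <= (c / 4)%:E)%E.
  apply: cvge0_near_le => //; first by move=> k; exact: fin_num_measure.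
  apply: ae_prob_cvg0 => //.
  have good : {ae P, forall w, [/\ {within `[0, +oo[, continuous (fun s => X s
    w)} /\
     {within `[0, +oo[, continuous (fun s => Y s w)}, X 0 w = x /\ Y 0 w = y,
     forall t, 0 <= t -> X t w = x + M t w + \col_i \int[lebesgue_measure]_(s
       in `[0%R, t]) b (X s w) i ord0,
     forall t, 0 <= t -> Y t w = y + N t w + \col_i \int[lebesgue_measure]_(s
       in `[0%R, t]) b (Y s w) i ord0 &
     forall t, 0 <= t -> X t w = g t *: v + Y t w]}.
    near=> w; split; [split|split|..].
    - by near: w.
    - by near: w.
    - by near: w.
    - by near: w.
    - by near: w.
    - by near: w.
    - by near: w.
  apply: filterS good => w [[cXw cYw] [X0w Y0w] XEw YEw XYw].
  have l1 : (0 : R) < 1 by [].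
  (* The first summand bounds (g(t) - 1) v / t, and the others bound the two averaged drifts, each
     within 1 of its value at time 0. *)
  pose C : R := (`|g0| + 1) * `|v| + `|b x| + `|b y| + 2.
  have C0 : 0 < C.
    by rewrite ltr_wpDl// !addr_ge0// mulr_ge0// addr_ge0.
  have near_bound : \forall t \near 0^'+, 0 < t /\ `|M t w - N t w| <= C * t.
    near=> t.
    have t0 : 0 < t by near: t; exact: nbhs_right_gt.
    split => //.
    rewrite mx_norm_le; last by rewrite mulr_ge0// ltW.
    apply/forallP => r; apply/forallP => q; rewrite ord1.
    have bX : forall i, `|\int[lebesgue_measure]_(s in `[0%R,
      t]) (b (X s w) i ord0) - t * b x i ord0| <= 1 * t.
      by near: t; exact: (drift_avg cb cXw X0w l1).
    have bY : forall i, `|\int[lebesgue_measure]_(s in `[0%R,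
      t]) (b (Y s w) i ord0) - t * b y i ord0| <= 1 * t.
      by near: t; exact: (drift_avg cb cYw Y0w l1).
    have gt : `|g t - g 0 - t * g0| <= 1 * t by near: t; exact: dg.
    move: (bX r) (bY r) gt; rewrite g1 !mul1r.
    have EX := congr1 (fun u : 'cV[R]_n => u r ord0) (XEw t (ltW t0)).
    have EY := congr1 (fun u : 'cV[R]_n => u r ord0) (YEw t (ltW t0)).
    have EXY := congr1 (fun u : 'cV[R]_n => u r ord0) (XYw t (ltW t0)).
    have Exy : x r ord0 = v r ord0 + y r ord0 by rewrite xyv mxE.
    move: EX EY EXY; rewrite /= !mxE.
    set IX := \int[_]_(_ in _) _; set IY := \int[_]_(_ in _) _ => EX EY EXY bXr
      bYr gtr.
    have -> : M t w r ord0 - N t w r ord0 = (g t - 1 - t * g0) * v r ord0 + t *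
      g0 * v r ord0
       - (IX - t * b x r ord0) - t * b x r ord0
       + (IY - t * b y r ord0) + t * b y r ord0.
      have -> : M t w r ord0 = X t w r ord0 - x r ord0 - IX by rewrite EX; ring.
      have -> : N t w r ord0 = Y t w r ord0 - y r ord0 - IY by rewrite EY; ring.
      by rewrite EXY Exy; ring.
    have vr := ler_mx_norm v r ord0.
    have bxr := ler_mx_norm (b x) r ord0.
    have byr := ler_mx_norm (b y) r ord0.
    have n1 : `|(g t - 1 - t * g0) * v r ord0| <= t * `|v| by rewrite normrM
      ler_pM.
    have n2 : `|t * g0 * v r ord0| <= t * `|g0| * `|v|.
      by rewrite !normrM (gtr0_norm t0) ler_wpM2l// mulr_ge0// ltW.
    have n3 : `|t * b x r ord0| <= t * `|b x|.
      by rewrite normrM (gtr0_norm t0) ler_wpM2l// ltW.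
    have n4 : `|t * b y r ord0| <= t * `|b y|.
      by rewrite normrM (gtr0_norm t0) ler_wpM2l// ltW.
    have tri (a1 a2 a3 a4 a5 a6 : R) :
        `|a1 + a2 - a3 - a4 + a5 + a6| <= `|a1| + `|a2| + `|a3| + `|a4| + `|a5|
          + `|a6|.
      do 2 (apply: le_trans (ler_normD _ _) _; apply: lerD => //).
      do 2 (apply: le_trans (ler_normB _ _) _; apply: lerD => //).
      exact: ler_normD.
    apply: le_trans (tri _ _ _ _ _ _) _.
    apply: (@le_trans _ _ (t * `|v| + t * `|g0| * `|v| + t + t * `|b x| + t + t
      * `|b y|)).
      by rewrite !lerD.
    by rewrite /C; lra.
  have : \forall k \near \oo, 0 < T k /\ `|M (T k) w - N (T k) w| <= C * T k.
    exact: (small_times_cvg near_bound).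
  (* Here [mesh_small] is read as C / (k + 1) < e, which makes C T k smaller than e sqrt (T k). *)
  apply: filterS2 (mesh_small C e0) => k Ck [_ MNk] /=; apply/negP;
    rewrite -ltNge.
  apply: le_lt_trans MNk _; rewrite sqrt_small_times /T /small_times expr2
    mulrA.
  by rewrite ltr_pM2r// invr_gt0.
pose U k := A1 k `|` A2 k `|` A3 k.
have sub k : A k `<=` U k.
  move=> w Aw; apply: contrapT => /not_orP[/not_orP[/negP n1 /negP n2] /negP
    n3].
  move: n1 n2 n3; rewrite -!ltNge => n1 n2 n3; move: Aw; apply/negP;
    rewrite -ltNge.
  set u := B (T k) w - B 0 w in n1 n2 n3 *.
  have -> : D *m u = (M (T k) w - N (T k) w) - (M (T k) w - sigma x *m u) + (N
    (T k) w - sigma y *m u).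
    have Z (p q a : 'cV[R]_n) : (p - q) - (p - a) = a - q.
      by rewrite opprB addrC addrA subrK.
    by rewrite Z addrA subrK /D mulmxBl.
  apply: le_lt_trans (ler_normD _ _) _.
  apply: (@le_lt_trans _ _ (`|M (T k) w - N (T k) w| + `|M (T k) w - sigma x *m
    u| + `|N (T k) w - sigma y *m u|)).
    by rewrite lerD2r; exact: ler_normB.
  have sT0 : 0 < Num.sqrt (T k) by rewrite sqrtr_gt0.
  have eT0 := mulr_gt0 e0 sT0.
  have -> : `|D i j| = 4 * e by rewrite /e mulrC divfK.
  lra.
have mA1 k : measurable (A1 k).
  by apply: (measurable_sub_bm_ge FF BB) (ltW (T0 k)) _;
    case: (itoM _ (ltW (T0 k))).
have mA2 k : measurable (A2 k).
  by apply: (measurable_sub_bm_ge FF BB) (ltW (T0 k)) _;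
    case: (itoN _ (ltW (T0 k))).
have mA k : measurable (A k).
  have sG := filtration_sigma FF (ltW (T0 k)).
  have := @measurable_sub_bm_ge _ _ _ P F n B FF BB D (fun=> 0) (T k)
    (`|D i j| * Num.sqrt (T k)) (ltW (T0 k)) (measurable_wrt_cst (0 : 'cV[R]_n)
      sG).
  by rewrite /A; under eq_set do rewrite sub0r normrN.
near \oo => k.
have Ak : (c%:E <= P (A k))%E by apply: (bm_mul_lower_bound FF BB).
have : (P (A k) <= (c / 4)%:E + (c / 4)%:E + (c / 4)%:E)%E.
  apply: (@le_trans _ _ (P (U k))).
    by apply: le_measure; rewrite ?inE//; do 2 apply: measurableU => //.
  apply: le_trans (measureU2 _ _ _) _ => //; first exact: measurableU.
  apply: leeD; last by near: k.
  apply: le_trans (measureU2 _ _ _) _ => //.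
  by apply: leeD; near: k.
move=> /(le_trans Ak); rewrite -!EFinD lee_fin; lra.
Unshelve. all: by end_near.
Qed.

(** The claim is deterministic, so a single path from the almost sure event suffices. On it the
    terms S B_t cancel, and t times the difference of the two sides is at most e t for small t,
    whatever e > 0. *)
Lemma sde_shift_drift_eq S : (forall z, sigma z = S) -> b x = b y + g0 *: v.
Proof.
move=> sS.
have [_ cX X0 _] := HX; have [_ cY Y0 _] := HY.
have := sde_cst_diffusion P_complete FF BB HX sS.
have := sde_cst_diffusion P_complete FF BB HY sS.
move=> YE XE.
have [w [[cXw cYw] [X0w Y0w] XEw YEw XYw]] : exists w, [/\ {within `[0, +oo[,
  continuous (fun s => X s w)} /\
     {within `[0, +oo[, continuous (fun s => Y s w)}, X 0 w = x /\ Y 0 w = y,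
     forall t, 0 <= t -> X t w = x + S *m B t w + \col_i
       \int[lebesgue_measure]_(s in `[0%R, t]) b (X s w) i ord0,
     forall t, 0 <= t -> Y t w = y + S *m B t w + \col_i
       \int[lebesgue_measure]_(s in `[0%R, t]) b (Y s w) i ord0 &
     forall t, 0 <= t -> X t w = g t *: v + Y t w].
  apply: (@ae_ex _ _ _ P).
  by near=> w; split; [split; near: w|split; near: w|near: w..].
apply/colP => r; rewrite !mxE; apply/eqP; rewrite -subr_eq0 -normr_eq0 eq_le
  normr_ge0 andbT.
apply/ler_addgt0Pr => e e0; rewrite add0r.
(* The expansion of g costs e' |v| and each of the two averaged drifts costs e'. *)
pose e' := e / (`|v| + 2).
have v2 : 0 < `|v| + 2 by rewrite ltr_wpDl.
have e'0 : 0 < e' by rewrite divr_gt0.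
near (0 : R)^'+ => t.
have t0 : 0 < t by near: t; exact: nbhs_right_gt.
have bX : forall i, `|\int[lebesgue_measure]_(s in `[0%R,
  t]) (b (X s w) i ord0) - t * b x i ord0| <= e' * t.
  by near: t; exact: (drift_avg cb cXw X0w e'0).
have bY : forall i, `|\int[lebesgue_measure]_(s in `[0%R,
  t]) (b (Y s w) i ord0) - t * b y i ord0| <= e' * t.
  by near: t; exact: (drift_avg cb cYw Y0w e'0).
have gt : `|g t - g 0 - t * g0| <= e' * t by near: t; exact: dg.
move: (bX r) (bY r) gt; rewrite g1.
have EX := congr1 (fun u : 'cV[R]_n => u r ord0) (XEw t (ltW t0)).
have EY := congr1 (fun u : 'cV[R]_n => u r ord0) (YEw t (ltW t0)).
have EXY := congr1 (fun u : 'cV[R]_n => u r ord0) (XYw t (ltW t0)).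
have Exy : x r ord0 = v r ord0 + y r ord0 by rewrite xyv mxE.
move: EX EY EXY; rewrite /= !mxE.
set IX := \int[_]_(_ in _) _; set IY := \int[_]_(_ in _) _ => EX EY EXY bXr bYr
  gtr.
rewrite -(ler_pM2l t0) -[X in X * `|_|](gtr0_norm t0) -normrM.
have -> : t * (b x r ord0 - (b y r ord0 + g0 * v r ord0)) =
   (g t - 1 - t * g0) * v r ord0 - (IX - t * b x r ord0) + (IY - t * b y r
     ord0).
  have -> : IX = X t w r ord0 - x r ord0 - \sum_j S r j * B t w j ord0 by
    rewrite EX; ring.
  have -> : IY = Y t w r ord0 - y r ord0 - \sum_j S r j * B t w j ord0 by
    rewrite EY; ring.
  by rewrite EXY Exy; ring.
have vr := ler_mx_norm v r ord0.
have n1 : `|(g t - 1 - t * g0) * v r ord0| <= e' * t * `|v| by rewrite normrM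
  ler_pM.
apply: le_trans (ler_normD _ _) _.
apply: (@le_trans _ _ (e' * t * `|v| + e' * t + e' * t)).
  by apply: lerD => //; apply: le_trans (ler_normB _ _) _; exact: lerD.
have -> : e' * t * `|v| + e' * t + e' * t = t * (e' * (`|v| + 2)) by ring.
by rewrite /e' divfK// gt_eqF.
Unshelve. all: by end_near. Qed.

End shifted_solutions.

Lemma C1_nonnegZr (R : realType) (g : R -> R) (a : R) :
  C1_nonneg g -> C1_nonneg (fun t => g t * a).
Proof.
move=> [g' [cg' dg]]; exists (fun t => g' t * a); split.
  by move=> t; apply: cvgM; [exact: cg'|exact: cvg_cst].
move=> t t0.
rewrite (_ : (fun s => _) = (fun s => (g s - g t) / (s - t) * a)).
  by apply: cvgM; [exact: dg|exact: cvg_cst].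
by apply/funext => s; rewrite -mulrBl mulrAC.
Qed.

(** Both explicit formulas contain the same noise and alpha terms, so only the initial-value terms
    differ. *)
Lemma sde_affine_shift (R : realType) (disp : measure_display)
    (Omega : measurableType disp) (P : probability Omega R)
    (F : R -> set (set Omega)) (n : nat) (B : R -> Omega -> 'cV[R]_n)
    (sigma : 'cV[R]_n -> 'M[R]_n) (b : 'cV[R]_n -> 'cV[R]_n)
    (x alpha : 'cV[R]_n) (S : 'M[R]_n) (beta : R) (X Y : R -> Omega ->
      'cV[R]_n) :
  measure_is_complete P -> filtration F -> brownian_motion P F B ->
  (forall z, sigma z = S) -> (forall z, b z = alpha + beta *: z) ->
  sde_solution P F B sigma b x X -> sde_solution P F B sigma b 0 Y ->
  {ae P, forall w, forall t, 0 <= t -> X t w = expR (beta * t) *: x + Y t w}.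
Proof.
move=> P_complete FF BB sS bE HX HY.
have := sde_affine_solution P_complete FF BB HX sS bE.
have := sde_affine_solution P_complete FF BB HY sS bE.
apply: filterS2 => w YE XE t t0.
have [Y1 Y2] := YE t t0; have [X1 X2] := XE t t0.
have [b0|b0] := eqVneq beta 0; last first.
  by rewrite X1// Y1// scaler0 add0r addrA.
by rewrite X2// Y2// b0 mul0r expR0 scale1r add0r addrA.
Qed.

(** An Ito integral is determined only up to a null set at each t, so the integral in the solution
    formula is given as one continuous process [J], common to all x. *)
Theorem proposition2p4 (R : realType) (disp : measure_display)
    (Omega : measurableType disp) (P : probability Omega R)
    (F : R -> set (set Omega)) (d : nat) (B : R -> Omega -> 'cV[R]_d)
    (sigma : 'cV[R]_d -> 'M[R]_d) (b : 'cV[R]_d -> 'cV[R]_d)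
    (X : 'cV[R]_d -> R -> Omega -> 'cV[R]_d)
    (d_gt0 : (0 < d)%N)
    (F_filtration : filtration F) (F_usual : usual_conditions P F)
    (B_brownian : brownian_motion P F B)
    (sigma_lipschitz : lipschitz sigma) (b_lipschitz : lipschitz b)
    (X_solution : forall x : 'cV[R]_d, sde_solution P F B sigma b x (X x)) :
  (* (i) *)
  (forall (f : R -> 'cV[R]_d -> 'cV[R]_d) (g : R -> R)
      (h : 'cV[R]_d -> 'cV[R]_d),
     (forall x : 'cV[R]_d, {ae P, forall w, forall t, 0 <= t ->
        X x t w = f t x + X 0 t w}) ->
     C1_nonneg g ->
     (forall (t : R) (x : 'cV[R]_d), 0 <= t -> f t x = g t *: h x) ->
     exists2 g1 : R -> R, D_class g1 &
       forall (t : R) (x : 'cV[R]_d), 0 <= t -> f t x = g1 t *: x) /\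
  (* (ii) *)
  (forall g : R -> R, D_class g ->
     ((forall x : 'cV[R]_d, {ae P, forall w, forall t, 0 <= t ->
         X x t w = g t *: x + X 0 t w}) <->
      (exists (S : 'M[R]_d) (alpha : 'cV[R]_d) (beta : R),
         [/\ forall x : 'cV[R]_d, sigma x = S,
             forall x : 'cV[R]_d, b x = alpha + beta *: x
           & forall t : R, 0 <= t -> g t = expR (beta * t)])) /\
     (forall (S : 'M[R]_d) (alpha : 'cV[R]_d) (beta : R),
        (forall x : 'cV[R]_d, sigma x = S) ->
        (forall x : 'cV[R]_d, b x = alpha + beta *: x) ->
        (forall t : R, 0 <= t -> g t = expR (beta * t)) ->
        (beta != 0 ->
         exists J : R -> Omega -> 'cV[R]_d,
           [/\ continuous_paths P J,
               forall t : R, 0 <= t ->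
                 ito_integral P F B t
                   (fun s _ => (expR (beta * (t - s)))%:M) (J t)
             & forall x : 'cV[R]_d, {ae P, forall w, forall t, 0 <= t ->
                 X x t w = expR (beta * t) *: x + S *m J t w
                           + ((expR (beta * t) - 1) / beta) *: alpha}]) /\
        (beta = 0 ->
         forall x : 'cV[R]_d, {ae P, forall w, forall t, 0 <= t ->
           X x t w = x + t *: alpha + S *m B t w}))).
Proof.
have [P_complete _ _] := F_usual.
have csigma := lipschitz_continuous sigma_lipschitz.
have cb := lipschitz_continuous b_lipschitz.
(* A nonzero vector, available because d > 0, from which scalar factors can be read off. *)
pose one : 'cV[R]_d := const_mx 1.
pose i0 := Ordinal d_gt0.
have one_inj (a c : R) : a *: one = c *: one -> a = c.
  by move=> /colP/(_ i0); rewrite !mxE !mulr1.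
split=> [f g h fX gC1 fE|g [gC1 g1]].
  (* The shift formula at t = 0, on one path where both initial conditions hold. *)
  have hE x : g 0 *: h x = x.
    have [_ _ Xx _] := X_solution x; have [_ _ X0 _] := X_solution 0.
    have [w [E1 [E2 E3]]] : exists w, X x 0 w = x /\ X 0 0 w = 0 /\
        X x 0 w = f 0 x + X 0 0 w.
      apply: (@ae_ex _ _ _ P); apply: filterS3 Xx X0 (fX x) => w e1 e2 e3.
      by split=> //; split=> //; exact: e3.
    by rewrite -fE// -[RHS]E1 E3 E2 addr0.
  have g0 : g 0 != 0.
    apply/eqP => g0; have := hE one; rewrite g0 scale0r => /esym/eqP.
    by rewrite -(scale0r one) -[X in X == _]scale1r => /eqP/one_inj/eqP;
      rewrite oner_eq0.
  exists (fun t => g t / g 0).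
    by split; [exact: C1_nonnegZr|rewrite divff].
  by move=> t x t0; rewrite fE// -[in RHS](hE x) scalerA divfK.
have [g0 dg] := C1_nonneg_right_diff gC1.
split; last first.
  move=> S alpha beta sS bE gE; split=> [b0|b0].
    exists (exp_wiener B beta); split.
    - exact: (exp_wiener_continuous B_brownian).
    - by move=> t t0; exact: (exp_wiener_ito F_filtration F_usual B_brownian).
    - move=> x.
      apply: filterS (sde_affine_solution P_complete F_filtration B_brownian
        (X_solution x) sS bE).
      by move=> w H t t0; have [+ _] := H t t0; exact.
  move=> x.
  apply: filterS (sde_affine_solution P_complete F_filtration B_brownian
    (X_solution x) sS bE).
  by move=> w H t t0; have [_] := H t t0; exact.
split=> [XE|[S [alpha [beta [sS bE gE]]]] x]; last first.
  apply: filterS (sde_affine_shift P_complete F_filtration B_brownian sS bE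
    (X_solution x) (X_solution 0)).
  by move=> w H t t0; rewrite H// gE.
have sS x : sigma x = sigma 0.
  apply: (sde_shift_diffusion_eq P_complete F_filtration B_brownian csigma cb
    (X_solution x) (X_solution 0) g1 dg (XE x)).
  by rewrite addr0.
have bE x : b x = b 0 + g0 *: x.
  apply: (sde_shift_drift_eq P_complete F_filtration B_brownian cb
    (X_solution x) (X_solution 0) g1 dg (XE x) _ sS).
  by rewrite addr0.
exists (sigma 0), (b 0), g0; split=> // t t0.
(* The same difference of solutions now has two expressions, with factors g(t) and e^(g0 t); one
   path and the vector [one] suffice to equate them. *)
have := sde_affine_shift P_complete F_filtration B_brownian sS bE
  (X_solution one) (X_solution 0).
move=> XE'.
have [w [E1 E2]] : exists w, X one t w = g t *: one + X 0 t w /\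
    X one t w = expR (g0 * t) *: one + X 0 t w.
  by apply: (@ae_ex _ _ _ P); apply: filterS2 (XE one) XE' => w e1 e2; split;
    [exact: e1|exact: e2].
by apply: one_inj; apply: (addIr (X 0 t w)); rewrite -E1.
Qed.
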